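(* Let $m\in\mathbb{R}$, let $S\in\mathbb{Z}\setminus\{-1,0\}$, and let $W=(W_1,W_2)$ be a nonlinearity satisfying the standing structural assumptions described in the context (polynomial type, gauge property with vorticity $S$), together with the bounds: there are $C>0$ and $p\ge p_*$ such that $|W_1|+|W_2|\le C|\phi|^p$ and $|\partial_r W_1|+|\partial_r W_2|\le C|\phi|^{p-1}|\nabla\phi|$ whenever $|\phi|<1$, where (i) $p_*=3$ in the massless case $m=0$; (ii) $p_*=5$ in the massive case $m\neq 0$. Let $\delta>0$ be fixed. Then there exists $\varepsilon>0$ such that the following holds. Let $$\phi=(\phi_1,\phi_2)\in C^1_{loc}\left(\mathbb{R};L^2(\mathbb{R}^2;\mathbb{C})^2\right)\cap C_{loc}\left(\mathbb{R};E(\delta)\right)$$ be any radial global solution to the 2D Dirac equation with vorticity $S$ (that is, $\psi=(\phi_1(t,r)e^{iS\theta},\, i\phi_2(t,r)e^{i(S+1)\theta})$ solves the 2D nonlinear Dirac equation, equivalently $(\phi_1,\phi_2)$ solves the radial system in the context) which is small in the sense that $$\sup_{t\ge 0}\|\phi(t)\|_{E(\delta)\cap L^\infty}<\varepsilon .$$ Then for every $R>0$, $$\lim_{t\to\infty}\|\phi(t)\|_{L^2(B(0,R))}=0 .$$ Consequently, there exist neither small standing solitons nor small breather solutions (in this class of solutions) of the 2D nonlinear Dirac equation within any compact set of $\mathbb{R}^2$.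
   Context: **Equation.** For a spinor $\psi=(\psi_1,\psi_2):\mathbb{R}\times\mathbb{R}^2\to\mathbb{C}^2$ and mass $m\in\mathbb{R}$, the 2D nonlinear Dirac equation is $$i(\partial_t\psi_1+\partial_x\psi_2)+\partial_y\psi_2+m\psi_1=W_1,\qquad i(\partial_t\psi_2+\partial_x\psi_1)-\partial_y\psi_1-m\psi_2=W_2,$$ where $(W_1,W_2)=(W_1,W_2)(\psi_1,\overline{\psi_1},\psi_2,\overline{\psi_2})$ is a polynomial-type nonlinearity. It is massless if $m=0$ and massive if $m\ne0$. **Gauge property (with vorticity $S$).** For all $\theta$, $$W(e^{iS\theta}\psi_1,e^{-iS\theta}\overline{\psi_1},ie^{i(S+1)\theta}\psi_2,(-i)e^{-i(S+1)\theta}\overline{\psi_2})=(e^{iS\theta}W_1,\ ie^{i(S+1)\theta}W_2)(\psi_1,\overline{\psi_1},\psi_2,\overline{\psi_2}).$$ **Radial reduction.** In polar coordinates $(r,\theta)$, solutions of the form $\psi=(\phi_1(t,r)e^{iS\theta},\,i\phi_2(t,r)e^{i(S+1)\theta})$, $\phi_1,\phi_2\in\mathbb{C}$, correspond to solutions of $$i\partial_t\phi_1=\left(\partial_r+\tfrac{S+1}{r}\right)\phi_2-m\phi_1+W_1,\qquad i\partial_t\phi_2=-\left(\partial_r-\tfrac{S}{r}\right)\phi_1+m\phi_2+W_2,$$ with $W_j=W_j(\phi_1,\overline{\phi_1},\phi_2,\overline{\phi_2})$. The integer $S$ is called the vorticity. ''Radial global solution'' means such a $\phi=(\phi_1,\phi_2)$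 defined for all times. **Notation.** With $\phi_j=\phi_{j1}+i\phi_{j2}$ (real and imaginary parts), $|\phi|^2=\phi_{11}^2+\phi_{12}^2+\phi_{21}^2+\phi_{22}^2$ and $|\nabla\phi|^2=(\partial_r\phi_{11})^2+(\partial_r\phi_{12})^2+(\partial_r\phi_{21})^2+(\partial_r\phi_{22})^2$. For radial functions, $\|f\|_{L^2}^2=\int_0^\infty |f(r)|^2\,r\,dr$. The weighted space is $$E(\delta)=\{\Psi\in H^1_{rad}:\ \|\Psi\|_{E(\delta)}:=\|\langle r\rangle^{\delta/2}\nabla\Psi\|_{L^2}+\|\langle r\rangle^{\delta/2}\Psi\|_{L^2}<\infty\},\qquad \langle r\rangle=(1+r^2)^{1/2},$$ and $\|\cdot\|_{E(\delta)\cap L^\infty}=\|\cdot\|_{E(\delta)}+\|\cdot\|_{L^\infty}$. $B(0,R)\subset\mathbb{R}^2$ is the ball of radius $R$ centered at $0$. Standing solitons are nonzero solutions $e^{-i\omega t}Q(r)$, $\omega\in\mathbb{R}$; breathers are nonzero time-periodic solutions. *)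

(* Defs.v *)
From HB Require Import structures.
From mathcomp Require Import all_boot all_order all_algebra.
From mathcomp Require Import all_classical all_reals all_analysis.
From mathcomp Require Import ess_sup_inf.
From mathcomp Require Import complex.
(* [mpoly] is not imported: its notations clash with those of the analysis
   library. *)
From mathcomp Require mpoly.

Set Implicit Arguments.
Unset Strict Implicit.
Unset Printing Implicit Defensive.

Import Order.TTheory GRing.Theory Num.Theory.
Import numFieldNormedType.Exports.

Local Open Scope classical_set_scope.
Local Open Scope ring_scope.

Notation spinor R := (R[i] * R[i])%type.

(* A radial function on the plane is given by its profile, a function of
   r > 0; the values of a profile at r <= 0 are never used.  Profiles are
   identified when they agree almost everywhere on ]0, +oo[. *)
Notation radial R := (R -> R[i] * R[i])%type.

Section Spinors.
Context {R : realType}.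

Definition cis (a : R) : R[i] := (cos a +i* sin a)%C.

Definition spinor_abs (z : spinor R) : R :=
  Num.sqrt (complex.Re z.1 ^+ 2 + complex.Im z.1 ^+ 2
            + complex.Re z.2 ^+ 2 + complex.Im z.2 ^+ 2).

(* A nonlinearity W_j is a polynomial in the four variables psi1, conj psi1,
   psi2, conj psi2. *)
Notation nonlinearity := (mpoly.mpoly 4 R[i]).

Definition eval4 (W : nonlinearity) (a b c d : R[i]) : R[i] :=
  mpoly.meval (fun k : 'I_4 => nth 0 [:: a; b; c; d] k) W.

Definition nl_eval (W : nonlinearity) (z : spinor R) : R[i] :=
  eval4 W z.1 (z.1^*)%C z.2 (z.2^*)%C.

Definition gauge_property (S : int) (W1 W2 : nonlinearity) : Prop :=
  forall (theta : R) (z : spinor R),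
    let e0 := cis (S%:~R * theta) in
    let e0' := cis (- (S%:~R * theta)) in
    let e1 := 'i%C * cis ((S + 1)%:~R * theta) in
    let e1' := (- 'i%C) * cis (- ((S + 1)%:~R * theta)) in
    eval4 W1 (e0 * z.1) (e0' * (z.1^*)%C) (e1 * z.2) (e1' * (z.2^*)%C)
      = e0 * nl_eval W1 z
    /\
    eval4 W2 (e0 * z.1) (e0' * (z.1^*)%C) (e1 * z.2) (e1' * (z.2^*)%C)
      = e1 * nl_eval W2 z.

Definition cderivable (f : R -> R[i]) (r : R) : Prop :=
  derivable (fun s => complex.Re (f s)) r 1
  /\ derivable (fun s => complex.Im (f s)) r 1.

Definition cderive (f : R -> R[i]) (r : R) : R[i] :=
  (derive1 (fun s => complex.Re (f s)) r
   +i* derive1 (fun s => complex.Im (f s)) r)%C.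

Definition nl_bound (C p : R) (W1 W2 : nonlinearity) : Prop :=
  forall z : spinor R, spinor_abs z < 1 ->
    Normc.normc (nl_eval W1 z) + Normc.normc (nl_eval W2 z)
      <= C * spinor_abs z `^ p.

(* The derivative with respect to r is that of r |-> W_j(phi(r)), for an
   arbitrary differentiable radial function phi. *)
Definition nl_derivative_bound (C p : R) (W1 W2 : nonlinearity) : Prop :=
  forall (phi : radial R) (r : R), 0 < r ->
    cderivable (fun s => (phi s).1) r -> cderivable (fun s => (phi s).2) r ->
    spinor_abs (phi r) < 1 ->
    Normc.normc (cderive (fun s => nl_eval W1 (phi s)) r)
    + Normc.normc (cderive (fun s => nl_eval W2 (phi s)) r)
      <= C * spinor_abs (phi r) `^ (p - 1)
         * spinor_abs (cderive (fun s => (phi s).1) r,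
                       cderive (fun s => (phi s).2) r).

Definition p_star (m : R) : R := if m == 0 then 3 else 5.

End Spinors.

Notation nonlinearity R := (mpoly.mpoly 4 R[i]).

Section FunctionSpaces.
Context {R : realType}.
Notation mu := (@lebesgue_measure R).

Definition test_function (eta : R -> R) : Prop :=
  [/\ forall x, derivable eta x 1,
      continuous (derive1 eta) &
      exists a b : R, 0 < a /\ forall x, x \notin `[a, b] -> eta x = 0].

Definition weak_derivative (f g : R -> R) : Prop :=
  [/\ locally_integrable `]0, +oo[ f,
      locally_integrable `]0, +oo[ g &
      forall eta, test_function eta ->
        (\int[mu]_(r in `]0%R, +oo[) (f r * derive1 eta r)%:E
         = - \int[mu]_(r in `]0%R, +oo[) (g r * eta r)%:E)%E].

Definition weakly_derivable (f : R -> R) : Prop :=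
  exists g, weak_derivative f g.

(* The weak derivative is unique up to a null set; [xget] selects a version
   of it. *)
Definition wderive (f : R -> R) : R -> R :=
  xget (fun=> 0) [set g | weak_derivative f g].

Definition cwderive (f : R -> R[i]) (r : R) : R[i] :=
  (wderive (fun s => complex.Re (f s)) r
   +i* wderive (fun s => complex.Im (f s)) r)%C.

Definition dr (Psi : radial R) : radial R := fun r =>
  (cwderive (fun s => (Psi s).1) r, cwderive (fun s => (Psi s).2) r).

(* The L^2 norm over the set of x in the plane with |x| in D; as usual for
   radial functions, the factor 2 pi is dropped from r dr dtheta. *)
Definition L2norm (D : set R) (g : R -> R) : \bar R :=
  ((\int[mu]_(r in D) (g r ^+ 2 * r)%:E) `^ 2^-1)%E.

Definition sL2norm (D : set R) (Psi : radial R) : \bar R :=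
  L2norm D (fun r => spinor_abs (Psi r)).

Definition componentwise (P : (R -> R) -> Prop) (Psi : radial R) : Prop :=
  [/\ P (fun r => complex.Re (Psi r).1), P (fun r => complex.Im (Psi r).1),
      P (fun r => complex.Re (Psi r).2) & P (fun r => complex.Im (Psi r).2)].

Definition in_L2 (Psi : radial R) : Prop :=
  componentwise (fun f : R -> R => measurable_fun (`]0, +oo[ : set R) f) Psi
  /\ (sL2norm `]0%R, +oo[ Psi < +oo)%E.

Definition in_H1rad (Psi : radial R) : Prop :=
  [/\ in_L2 Psi, componentwise weakly_derivable Psi & in_L2 (dr Psi)].

Definition japanese (r : R) : R := Num.sqrt (1 + r ^+ 2).

Definition Enorm (delta : R) (Psi : radial R) : \bar R :=
  (L2norm `]0%R, +oo[
     (fun r => (japanese r `^ (delta / 2) * spinor_abs (dr Psi r))%R)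
   + L2norm `]0%R, +oo[
     (fun r => (japanese r `^ (delta / 2) * spinor_abs (Psi r))%R))%E.

Definition in_E (delta : R) (Psi : radial R) : Prop :=
  in_H1rad Psi /\ (Enorm delta Psi < +oo)%E.

Definition Linfnorm (Psi : radial R) : \bar R :=
  ess_sup mu (EFin \o ((fun r => spinor_abs (Psi r)) \_ `]0%R, +oo[)).

Definition ELinfnorm (delta : R) (Psi : radial R) : \bar R :=
  (Enorm delta Psi + Linfnorm Psi)%E.

Definition L2_time_derivative (phi phit : R -> radial R) : Prop :=
  forall t : R,
    sL2norm `]0%R, +oo[
      (fun r => (((h^-1)%:C)%C * ((phi (t + h) r).1 - (phi t r).1)
                   - (phit t r).1,
                 ((h^-1)%:C)%C * ((phi (t + h) r).2 - (phi t r).2)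
                   - (phit t r).2))
    @[h --> 0^'] --> 0%E.

Definition C0_L2 (phi : R -> radial R) : Prop :=
  (forall t, in_L2 (phi t)) /\
  forall t : R,
    sL2norm `]0%R, +oo[ (fun r => phi s r - phi t r) @[s --> t] --> 0%E.

Definition C1_L2 (phi : R -> radial R) : Prop :=
  (forall t, in_L2 (phi t)) /\
  exists phit, L2_time_derivative phi phit /\ C0_L2 phit.

Definition C0_E (delta : R) (phi : R -> radial R) : Prop :=
  (forall t, in_E delta (phi t)) /\
  forall t : R,
    Enorm delta (fun r => phi s r - phi t r) @[s --> t] --> 0%E.

End FunctionSpaces.

Section Dirac.
Context {R : realType}.
Notation mu := (@lebesgue_measure R).

(* The radial system, for phi in C^1(R; L^2) with values in H^1_rad: at each
   time it is an equality between elements of L^2, with the time derivative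
   taken in L^2 and the weak derivative in r. *)
Definition radial_global_solution (m : R) (S : int) (W1 W2 : nonlinearity R)
    (phi : R -> radial R) : Prop :=
  exists phit : R -> radial R,
    [/\ forall t, in_L2 (phit t),
        L2_time_derivative phi phit &
        forall t : R, \forall r \ae mu, 0 < r ->
          'i%C * (phit t r).1
            = (dr (phi t) r).2 + (((S + 1)%:~R / r)%:C)%C * (phi t r).2
              - (m%:C)%C * (phi t r).1 + nl_eval W1 (phi t r)
          /\
          'i%C * (phit t r).2
            = - ((dr (phi t) r).1 - ((S%:~R / r)%:C)%C * (phi t r).1)
              + (m%:C)%C * (phi t r).2 + nl_eval W2 (phi t r)].

Definition standing_soliton_on (D : set R) (phi : R -> radial R) : Prop :=
  exists (omega : R) (Q : radial R),
    (forall t : R, \forall r \ae mu, D r ->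
       phi t r = (cis (- (omega * t)) * (Q r).1,
                  cis (- (omega * t)) * (Q r).2))
    /\ ~ (\forall r \ae mu, D r -> Q r = 0).

Definition breather_on (D : set R) (phi : R -> radial R) : Prop :=
  (exists2 T : R, 0 < T &
     forall t : R, \forall r \ae mu, D r -> phi (t + T) r = phi t r)
  /\ ~ (forall t : R, \forall r \ae mu, D r -> phi t r = 0).

End Dirac.

(* Main.v *)
(* Put u = sqrt r * phi: the radial system becomes u_t = H u + F with H a
   Dirac operator on the half-line whose potential is k / r, k = S + 1/2, and
   H^2 carries the repulsive potentials (k^2 -+ k) / r^2 >= 3 / (4 r^2) because
   S is neither 0 nor -1.  Let chi = (1 - (1 + r)^(-d)) / d and let A be the
   skew operator chi d/dr + chi' / 2.  Since <u_t, A u_t> = 0, the virial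
   functional J = <u_t, A u> satisfies J' = <u_t, [A, H] u> up to nonlinear
   terms, and <H u, [A, H] u> = - int (chi' u_r^2 + V u^2) with V >= c chi' / r^2.
   Radial functions in E(delta) decay like r^(-(1 + delta) / 2), so that |F| is
   bounded by a small multiple of chi' |u| and the nonlinear terms are absorbed
   (for m <> 0 the mass term costs an additional factor r, whence p >= 5).
   Thus J decreases at least at the rate of a weighted energy, while J is
   bounded; the weighted mass int (1 + r)^(-4) u^2 and its time derivative are
   controlled by that energy, which forces the mass to tend to 0.

   As u_t only lies in L^2, J is never differentiated directly: its increments
   are estimated through J_h(t) = <(u(t + h) - u(t)) / h, A u(t)>.  Functions in
   H^1 are replaced by their absolutely continuous representatives. *)

Require Import Defs.
From HB Require Import structures.
From mathcomp Require Import all_boot all_order all_algebra.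
From mathcomp Require Import all_classical all_reals all_analysis.
From mathcomp Require Import complex.
From mathcomp Require mpoly.
From mathcomp Require Import ess_sup_inf measurable_realfun ring lra.
Import Order.TTheory GRing.Theory Num.Theory.
Import numFieldNormedType.Exports.
Set Implicit Arguments.
Unset Strict Implicit.
Unset Printing Implicit Defensive.
Local Open Scope classical_set_scope.
Local Open Scope ring_scope.

(** The pairing is with u_t because the commutator of A and H is again a first-order operator,
    without a sign when paired with u; paired with H u it gives the quadratic form belonging to H^2,
    where the repulsive potentials appear. The mass terms disappear from the linear identities by
    symmetry alone, so [m] weighs only on the nonlinear terms. No boundary condition is assumed at
    the origin: the equation is solved for u / r, whose coefficients S + 1 and - S do not vanish, so
    u / r is in L^2, which also makes the boundary terms vanish in the integrations by parts. Two
    choices fix the constants: d = min(delta, 1/4), where d <= 1/4 lets chi''' use at most 45/64 of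
    the available 3/4 and leaves 3/64; then epsilon so small that the nonlinear terms take at most
    half of this. The hypotheses give one L^2 derivative that is continuous in time and one that
    satisfies the equation; they coincide, and coercivity of the first-order operators carries the
    continuity of u_t over to u_r and u / r, which makes the passage h -> 0 locally uniform in
    time. *)

Section LocalMonotonicity.
Context {R : realType}.
Implicit Types f : R -> R.

(** A supremum argument: the points x with [f x <= f a] include their supremum, and if it were below
    [b] they would extend beyond it. Only points [s <= x <= t] on either side of x are compared,
    which is all that information at the single point x can provide; no continuity of [f] is
    assumed. *)
Lemma locally_le_nonincreasing f (a b : R) : a <= b ->
  (forall x, a <= x <= b -> exists2 d, 0 < d &
     forall s t, a <= s -> t <= b -> x - d < s -> s <= x -> x <= t -> t < x + d ->
       f t <= f s) ->
  f b <= f a.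
Proof.
move=> ab loc.
pose A := [set x | a <= x <= b /\ f x <= f a].
have Aa : A a by split => //; rewrite lexx ab.
have Aub : ubound A b by move=> x [/andP[]].
have hA : has_sup A by split; [exists a | exists b].
set c := sup A.
have ac : a <= c by apply: ub_le_sup => //; exists b.
have cb : c <= b by apply: ge_sup => //; exists a.
have [|d d0 hd] := loc c; first by rewrite ac.
have [x [/andP[ax xb] fx] cdx] := sup_adherent d0 hA.
have xc : x <= c by apply: ub_le_sup => //; [exists b|split => //; rewrite ax].
have fc : f c <= f a.
  apply: le_trans fx; apply: hd => //.
  by rewrite ltrDl.
have [cb'|cb'] := ltP c b; last first.
  by have -> : b = c by apply/le_anti; rewrite cb' cb.
set y := Num.min b (c + d / 2).
have cy : c < y by rewrite lt_min cb'/= ltrDl divr_gt0.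
have yb : y <= b by rewrite ge_min lexx.
have Ay : A y.
  split; first by rewrite yb (le_trans ac) // ltW.
  apply: le_trans fc; apply: hd => //.
  - by rewrite ltrBlDr ltrDl.
  - exact: ltW.
  - rewrite gt_min; apply/orP; right.
    by rewrite ltrD2l ltr_pdivrMr // ltr_pMr // ltr1n.
have : y <= c by apply: ub_le_sup => //; exists b.
by rewrite leNgt cy.
Qed.

End LocalMonotonicity.

Notation itg A f := (lebesgue_measure.-integrable A (EFin \o f)).

(** * Integrals and absolutely continuous functions *)

Section Itg.
Context {R : realType}.
Notation mu := (@lebesgue_measure R).
Implicit Types (A B : set R) (f g h : R -> R) (a b c : R).

Lemma itg_meas A f : itg A f -> measurable_fun A f.
Proof. by move=> /integrableP[/measurable_realfun.measurable_EFinP]. Qed.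

Lemma itgD A f g : measurable A -> itg A f -> itg A g ->
  itg A (fun x => f x + g x).
Proof. by move=> mA If Ig; have := @integrableD _ _ _ mu A mA _ _ If Ig; exact: eq_integrable. Qed.

Lemma itgB A f g : measurable A -> itg A f -> itg A g ->
  itg A (fun x => f x - g x).
Proof. by move=> mA If Ig; have := @integrableB _ _ _ mu A mA _ _ If Ig; exact: eq_integrable. Qed.

Lemma itgZ A k f : measurable A -> itg A f -> itg A (fun x => k * f x).
Proof. by move=> mA If; have := @integrableZl _ _ _ mu A mA k _ If; exact: eq_integrable. Qed.

Lemma itg_norm A f : itg A f -> itg A (fun x => `|f x|).
Proof. by move=> If; apply: (integrable_norm If). Qed.

Lemma itg_le A f g : measurable A -> measurable_fun A f ->
  (forall x, A x -> `|f x| <= g x) -> itg A g -> itg A f.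
Proof.
move=> mA mf fg Ig; apply: (@le_integrable _ _ _ mu A mA) Ig.
  exact/measurable_realfun.measurable_EFinP.
by move=> x Ax /=; rewrite lee_fin (le_trans (fg x Ax)) // ler_norm.
Qed.

Lemma itg_sub A B f : measurable A -> measurable B -> B `<=` A ->
  itg A f -> itg B f.
Proof. by move=> mA mB BA; exact: (@integrableS _ _ _ mu A B _ mA mB BA). Qed.

Lemma itg_ext A f g : measurable A -> (forall x, A x -> f x = g x) ->
  itg A f -> itg A g.
Proof.
move=> mA fg; apply: (@eq_integrable _ _ _ mu A mA) => x /set_mem /fg /= -> //.
Qed.

Lemma itg0 A : measurable A -> itg A (fun=> 0 : R).
Proof. by move=> mA; have := integrable0 mu A; exact: eq_integrable. Qed.

Lemma itg_sum A (I : Type) (s : seq I) (P : pred I) (f : I -> R -> R) :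
  measurable A -> (forall i, itg A (f i)) ->
  itg A (fun x => \sum_(i <- s | P i) f i x).
Proof.
move=> mA If; elim: s => [|i s IH].
  by apply: (itg_ext _ _ (itg0 mA)) => // x _; rewrite big_nil.
case Pi : (P i); last by apply: itg_ext IH => // x _; rewrite big_cons Pi.
apply: (itg_ext _ _ (itgD mA (If i) IH)) => // x _.
by rewrite big_cons Pi.
Qed.

Lemma Rint_ext A f g : (forall x, A x -> f x = g x) ->
  \int[mu]_(x in A) f x = \int[mu]_(x in A) g x.
Proof. by move=> fg; apply: eq_Rintegral => x /set_mem /fg. Qed.

Lemma RintD A f g : measurable A -> itg A f -> itg A g ->
  \int[mu]_(x in A) (f x + g x)
    = \int[mu]_(x in A) f x + \int[mu]_(x in A) g x.
Proof. by move=> mA; exact: (@RintegralD _ _ _ mu A _ _ mA). Qed.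

Lemma RintB A f g : measurable A -> itg A f -> itg A g ->
  \int[mu]_(x in A) (f x - g x)
    = \int[mu]_(x in A) f x - \int[mu]_(x in A) g x.
Proof. by move=> mA; exact: (@RintegralB _ _ _ mu A _ _ mA). Qed.

Lemma RintZ A k f : measurable A -> itg A f ->
  \int[mu]_(x in A) (k * f x) = k * \int[mu]_(x in A) f x.
Proof. by move=> mA; exact: (@RintegralZl _ _ _ mu A f k mA). Qed.

Lemma Rint0 A : measurable A -> \int[mu]_(x in A) (0 : R) = 0.
Proof. by move=> mA; rewrite (@Rintegral_cst _ _ _ mu A mA) mul0r. Qed.

Lemma Rint_le A f g : measurable A -> itg A f -> itg A g ->
  (forall x, A x -> f x <= g x) ->
  \int[mu]_(x in A) f x <= \int[mu]_(x in A) g x.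
Proof. by move=> mA; exact: (@le_Rintegral _ _ _ mu A f g mA). Qed.

Lemma Rint_ge0 A f : (forall x, A x -> 0 <= f x) -> 0 <= \int[mu]_(x in A) f x.
Proof. by move=> f0; exact: Rintegral_ge0. Qed.

Lemma Rint_norm A f : measurable A -> itg A f ->
  `|\int[mu]_(x in A) f x| <= \int[mu]_(x in A) `|f x|.
Proof. by move=> mA; exact: (@le_normr_Rintegral _ _ _ mu A f mA). Qed.

Lemma Rint_set1 a f : \int[mu]_(x in `[a, a]) f x = 0.
Proof. by rewrite set_itv1; exact: Rintegral_set1. Qed.

Lemma Rint_sum A (I : Type) (s : seq I) (P : pred I) (f : I -> R -> R) :
  measurable A -> (forall i, itg A (f i)) ->
  \int[mu]_(x in A) (\sum_(i <- s | P i) f i x)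
    = \sum_(i <- s | P i) \int[mu]_(x in A) f i x.
Proof.
move=> mA If; elim: s => [|i s IH].
  by rewrite big_nil (@Rint_ext _ _ (fun=> 0)) ?Rint0 // => x _; rewrite big_nil.
rewrite big_cons -IH; case: ifP => Pi; last first.
  by apply: Rint_ext => x _; rewrite big_cons Pi.
rewrite -RintD //; last exact: itg_sum.
by apply: Rint_ext => x _; rewrite big_cons Pi.
Qed.

Lemma Rint_cat f a c b : a <= c -> c <= b -> itg `[a, b] f ->
  \int[mu]_(x in `[a, b]) f x
    = \int[mu]_(x in `[a, c]) f x + \int[mu]_(x in `[c, b]) f x.
Proof.
move=> ac cb If.
have := @Rintegral_itvB R f (BLeft a) (BRight b) c If.
rewrite !bnd_simp => /(_ ac cb).
rewrite Rintegral_itv_obnd_cbnd; first by move=> <-; rewrite addrCA subrr addr0.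
apply: itg_sub If => //; apply: subset_itvr; rewrite bnd_simp.
exact: ac.
Qed.

Lemma itg_itv_sub f a b c d : a <= c -> d <= b -> itg `[a, b] f ->
  itg `[c, d] f.
Proof.
move=> ac db; apply: itg_sub => //.
by move=> x /=; rewrite !in_itv/= => /andP[cx xd]; rewrite (le_trans ac cx) (le_trans xd).
Qed.

End Itg.

(** * Primitives on the open half-line: locally absolutely continuous functions *)

Section Primitives.
Context {R : realType}.
Notation mu := (@lebesgue_measure R).
Implicit Types (f g h k : R -> R) (a b c : R).

Lemma halfline_bigcup :
  (`]0, +oo[%classic : set R) = \bigcup_n `[n.+1%:R^-1, n.+1%:R]%classic.
Proof.
apply/seteqP; split => x /=; rewrite in_itv/= ?andbT.
  move=> x0.
  have [n hn] : exists n : nat, Num.max x x^-1 < n%:R.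
    by exists (Num.truncn (Num.max x x^-1)).+1; exact: truncnS_gt.
  move: hn; rewrite gt_max => /andP[xn xVn].
  have nS : (n%:R : R) <= n.+1%:R by rewrite ler_nat.
  exists n => //=; rewrite in_itv/= (ltW (lt_le_trans xn nS)) andbT.
  rewrite -[leRHS]invrK lef_pV2 ?posrE ?invr_gt0 //.
  exact/ltW/(lt_le_trans xVn).
by case=> n _ /=; rewrite in_itv/= => /andP[h _]; apply: lt_le_trans h; rewrite invr_gt0.
Qed.

(** Local absolute continuity on the open half-line, with derivative [g] almost everywhere.
    Integrability is part of the definition because the real-valued integral also returns a value
    for functions that are not integrable. Nothing is required at 0. *)
Definition primitive f g := forall a b, 0 < a -> a <= b ->
  itg `[a, b] g /\ f b - f a = \int[mu]_(x in `[a, b]) g x.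

Lemma primitive_itg f g a b : primitive f g -> 0 < a -> itg `[a, b] g.
Proof.
move=> fg a0; have [ab|ba] := leP a b; first exact: (fg a b a0 ab).1.
by rewrite set_itv_ge ?bnd_simp -?ltNge//; exact: integrable_set0.
Qed.

Lemma primitive_measurable_derivative f g : primitive f g ->
  measurable_fun (`]0, +oo[%classic : set R) g.
Proof.
move=> fg; rewrite halfline_bigcup.
apply/measurable_fun_bigcup => // n.
by apply: itg_meas; apply: primitive_itg fg _; rewrite invr_gt0.
Qed.

Lemma primitive_continuous f g x : primitive f g -> 0 < x ->
  {for x, continuous f}.
Proof.
move=> fg x0.
have xx : x / 2 < x by rewrite ltr_pdivrMr // ltr_pMr // ltr1n.
have x20 : 0 < x / 2 by rewrite divr_gt0.
have xl : x < x + 1 by rewrite ltrDl.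
have xab : x / 2 < x + 1 by rewrite (lt_trans xx).
have Ig := primitive_itg (x + 1) fg x20.
have /(continuous_within_itvP _ xab)[+ _ _] := parameterized_integral_continuous (ltW xab) Ig.
move=> /(_ x); rewrite in_itv/= xx xl => /(_ isT) cx.
have fE : forall y, x / 2 <= y -> f y = f (x / 2) + parameterized_integral mu (x / 2) y g.
  move=> y xy; have [_ E] := fg _ _ x20 xy.
  by rewrite /parameterized_integral -E addrC subrK.
have cE : (fun y => f (x / 2) + parameterized_integral mu (x / 2) y g) @ x -->
    f (x / 2) + parameterized_integral mu (x / 2) x g.
  by apply: cvgD => //; exact: cvg_cst.
rewrite /prop_for/continuous_at fE; last exact: ltW.
apply: (@cvg_trans _ ((fun y => f (x / 2) + parameterized_integral mu (x / 2) y g) @ x)).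
  apply: near_eq_cvg.
  near=> y; rewrite [f y]fE //; near: y.
  by apply: filterS (lt_nbhsr xx) => z /ltW.
exact: cE.
Unshelve. all: by end_near. Qed.

Lemma continuous_measurable_fun f :
  (forall x, 0 < x -> {for x, continuous f}) ->
  measurable_fun (`]0, +oo[%classic : set R) f.
Proof.
move=> cf; apply: open_continuous_measurable_fun.
  exact: interval_open.
by move=> x /set_mem /=; rewrite in_itv/= andbT => /cf.
Qed.

Lemma primitive_measurable f g : primitive f g ->
  measurable_fun (`]0, +oo[%classic : set R) f.
Proof. by move=> fg; apply: continuous_measurable_fun => x; exact: primitive_continuous fg. Qed.

Lemma primitive_bound f g a b y : primitive f g -> 0 < a -> a <= y -> y <= b ->
  `|f y| <= `|f a| + \int[mu]_(x in `[a, b]) `|g x|.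
Proof.
move=> fg a0 ay yb; have [Ig E] := fg a y a0 ay.
have Ig' : itg `[a, b] g by apply: (primitive_itg _ fg).
rewrite (_ : f y = f a + (f y - f a)); last by rewrite addrC subrK.
apply: (le_trans (ler_normD _ _)); rewrite lerD2l E.
apply: (le_trans (Rint_norm _ Ig)) => //.
rewrite (Rint_cat ay yb); last exact: itg_norm.
by rewrite lerDl; apply: Rint_ge0.
Qed.

Lemma primitive_itgM f g k a b : primitive f g -> 0 < a ->
  itg `[a, b] k -> itg `[a, b] (fun x => f x * k x).
Proof.
move=> fg a0 Ik.
set K := `|f a| + \int[mu]_(x in `[a, b]) `|g x|.
apply: (@itg_le _ _ _ (fun x => K * `|k x|)) => //.
- apply: measurable_funM; last exact: itg_meas Ik.
  apply: measurable_funS (primitive_measurable fg) => //.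
  move=> x /=; rewrite !in_itv/= andbT => /andP[ax _]; exact: lt_le_trans ax.
- move=> x /=; rewrite in_itv/= => /andP[ax xb].
  by rewrite normrM ler_wpM2r //; exact: primitive_bound fg _ _ _.
- by apply: itgZ => //; exact: itg_norm.
Qed.

Lemma primitive_ext f f1 g g1 : (forall x, 0 < x -> f x = f1 x) ->
  (forall x, 0 < x -> g x = g1 x) -> primitive f g -> primitive f1 g1.
Proof.
move=> ff gg fg a b a0 ab; have [Ig E] := fg a b a0 ab.
have sub : forall x, `[a, b]%classic x -> g x = g1 x.
  move=> x /=; rewrite in_itv/= => /andP[ax _]; apply: gg; exact: lt_le_trans ax.
split; first exact: itg_ext Ig.
by rewrite -!ff // ?(lt_le_trans a0) // E; apply: Rint_ext.
Qed.

Lemma primitiveD f g h k : primitive f g -> primitive h k ->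
  primitive (fun x => f x + h x) (fun x => g x + k x).
Proof.
move=> fg hk a b a0 ab; have [Ig E] := fg a b a0 ab; have [Ik E'] := hk a b a0 ab.
split; first exact: itgD.
by rewrite RintD // -E -E'; ring.
Qed.

Lemma primitiveZ (c : R) f g : primitive f g ->
  primitive (fun x => c * f x) (fun x => c * g x).
Proof.
move=> fg a b a0 ab; have [Ig E] := fg a b a0 ab.
split; first exact: itgZ.
by rewrite RintZ // -E; ring.
Qed.

Lemma primitiveN f g : primitive f g ->
  primitive (fun x => - f x) (fun x => - g x).
Proof.
move=> /(primitiveZ (-1)); apply: primitive_ext => x _; rewrite mulN1r //.
Qed.

Lemma primitiveB f g h k : primitive f g -> primitive h k ->
  primitive (fun x => f x - h x) (fun x => g x - k x).
Proof. by move=> fg hk; apply: primitiveD => //; exact: primitiveN. Qed.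

Lemma primitive_cst (c : R) : primitive (fun=> c) (fun=> 0).
Proof.
move=> a b a0 ab; split.
  exact: itg0.
by rewrite subrr Rint0 //.
Qed.

(** Only this inequality has to be proved: applied to [- f] it yields the opposite one. *)
Let primitiveM_le f g h k a b : primitive f g -> primitive h k -> 0 < a -> a <= b ->
  f b * h b - f a * h a <= \int[mu]_(x in `[a, b]) (h x * g x + f x * k x).
Proof.
move=> fg hk a0 ab.
have Ig y : itg `[a, y] g by exact: primitive_itg fg _.
have Ik y : itg `[a, y] k by exact: primitive_itg hk _.
have Ip y : itg `[a, y] (fun x => h x * g x + f x * k x).
  by apply: itgD => //; [exact: primitive_itgM hk _ _|exact: primitive_itgM fg _ _].
have IV y : itg `[a, y] (fun x => `|g x| + `|k x|).
  by apply: itgD => //; exact: itg_norm.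
set V := fun y => \int[mu]_(x in `[a, y]) (`|g x| + `|k x|).
set G := fun y => \int[mu]_(x in `[a, y]) (h x * g x + f x * k x).
(* The error allowed is a multiple of [V], the joint variation of the two functions. It is additive
   over intervals, so it can be controlled locally. *)
suff key : forall e, 0 < e -> (f b * h b - G b - e * V b) <= f a * h a.
  rewrite -/(G b); apply/ler_addgt0Pr => e e0.
  have [V0|V0] := eqVneq (V b) 0.
    by move: (key _ e0) (e0); rewrite V0; clear; lra.
  have Vp : 0 < V b.
    by rewrite lt_neqAle eq_sym V0 /=; apply: Rint_ge0 => x _; exact: addr_ge0.
  move: (key (e / V b) (divr_gt0 e0 Vp)) (e0).
  by rewrite divfK ?gt_eqF //; clear; lra.
move=> e e0.
have G0 : G a = 0 by rewrite /G Rint_set1.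
have V0 : V a = 0 by rewrite /V Rint_set1.
have -> : f a * h a = f a * h a - G a - e * V a by rewrite G0 V0; ring.
apply: (@locally_le_nonincreasing _ (fun y => f y * h y - G y - e * V y)) => // x /andP[ax xb].
have x0 : 0 < x by exact: lt_le_trans ax.
have e20 : 0 < e / 2 by rewrite divr_gt0.
have /cvgrPdist_lt/(_ _ e20)[d1 /= d10 H1] := primitive_continuous fg x0.
have /cvgrPdist_lt/(_ _ e20)[d2 /= d20 H2] := primitive_continuous hk x0.
exists (Num.min d1 d2); first by rewrite lt_min d10.
move=> s t as_ tb xs sx xt tx.
have st : s <= t by exact: le_trans xt.
have s0 : 0 < s by exact: lt_le_trans as_.
have [Igs Egs] := fg s t s0 st; have [Iks Eks] := hk s t s0 st.
have near_x y : s <= y -> y <= t -> `|x - y| < Num.min d1 d2.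
  by move=> sy yt; rewrite ltr_norml; apply/andP; split; move: xs sx tx xt sy yt; clear; lra.
have osc_f y : s <= y -> y <= t -> `|f s - f y| <= e.
  move=> sy yt.
  have := near_x y sy yt; rewrite lt_min => /andP[/H1 + _].
  have := near_x s (lexx _) st; rewrite lt_min => /andP[/H1 + _].
  rewrite !ltr_norml ler_norml; clear; move=> /andP[? ?] /andP[? ?]; apply/andP; split; lra.
have osc_h y : s <= y -> y <= t -> `|h t - h y| <= e.
  move=> sy yt.
  have := near_x y sy yt; rewrite lt_min => /andP[_ /H2 +].
  have := near_x t st (lexx _); rewrite lt_min => /andP[_ /H2 +].
  rewrite !ltr_norml ler_norml; clear; move=> /andP[? ?] /andP[? ?]; apply/andP; split; lra.
have EG : G t = G s + \int[mu]_(y in `[s, t]) (h y * g y + f y * k y).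
  exact: Rint_cat.
have EV : V t = V s + \int[mu]_(y in `[s, t]) (`|g y| + `|k y|).
  exact: Rint_cat.
have I1 : itg `[s, t] (fun y => h t * g y + f s * k y).
  by apply: itgD => //; apply: itgZ.
have I2 := itg_itv_sub as_ (lexx t) (Ip t).
have I3 := itg_itv_sub as_ (lexx t) (IV t).
(* Freezing one factor at [t] and the other at [s] makes this formula exact; the error comes only
   from replacing [h t] by [h y] and [f s] by [f y]. *)
have E1 : f t * h t - f s * h s = \int[mu]_(y in `[s, t]) (h t * g y + f s * k y).
  rewrite RintD ?RintZ //; try exact: itgZ.
  by rewrite -Egs -Eks; clear; ring.
suff : \int[mu]_(y in `[s, t]) (h t * g y + f s * k y) <=
  \int[mu]_(y in `[s, t]) (h y * g y + f y * k y)
   + e * \int[mu]_(y in `[s, t]) (`|g y| + `|k y|).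
  by rewrite EG EV; move: E1; clear; lra.
rewrite -RintZ // -RintD //; last exact: itgZ.
apply: Rint_le => //.
  by apply: itgD => //; exact: itgZ.
move=> y /=; rewrite in_itv/= => /andP[sy yt].
rewrite -lerBlDl.
have -> : h t * g y + f s * k y - (h y * g y + f y * k y)
          = (h t - h y) * g y + (f s - f y) * k y by ring.
rewrite mulrDr; apply: lerD.
  apply: (le_trans (ler_norm _)); rewrite normrM ler_wpM2r //; exact: osc_h.
apply: (le_trans (ler_norm _)); rewrite normrM ler_wpM2r //; exact: osc_f.
Qed.

(* On a short interval the two functions are almost constant, so the product
   rule holds up to a small multiple of the total variation. *)
Lemma primitiveM f g h k : primitive f g -> primitive h k ->
  primitive (fun x => f x * h x) (fun x => g x * h x + f x * k x).
Proof.
move=> fg hk a b a0 ab.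
have Ig : itg `[a, b] (fun x => h x * g x) by apply: primitive_itgM hk _ (primitive_itg _ fg _).
have Ik : itg `[a, b] (fun x => f x * k x) by apply: primitive_itgM fg _ (primitive_itg _ hk _).
have Ip := itgD (measurable_itv _) Ig Ik.
have E0 : \int[mu]_(x in `[a, b]) (g x * h x + f x * k x)
   = \int[mu]_(x in `[a, b]) (h x * g x + f x * k x).
  by apply: Rint_ext => x _; rewrite mulrC.
split; first by apply: (itg_ext _ _ Ip) => // x _ /=; rewrite mulrC.
rewrite E0; apply/eqP; rewrite eq_le primitiveM_le //=.
have := primitiveM_le (primitiveN fg) hk a0 ab.
rewrite (@Rint_ext _ _ _ (fun x => (-1) * (h x * g x + f x * k x))); last first.
  by move=> x _; ring.
rewrite RintZ //; lra.
Qed.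

Lemma primitive_C1 f : (forall x : R, 0 < x -> derivable f x 1) ->
  (forall x : R, 0 < x -> {for x, continuous (derive1 f)}) ->
  primitive f (derive1 f).
Proof.
move=> df cf a b a0 ab.
have wc : {within `[a, b], continuous (derive1 f)}.
  apply: continuous_in_subspaceT => x /set_mem /=; rewrite in_itv/= => /andP[ax _].
  apply: cf; exact: lt_le_trans ax.
have If : itg `[a, b] (derive1 f).
  by apply: continuous_compact_integrable => //; exact: segment_compact.
split => //.
move: ab; rewrite le_eqVlt => /predU1P[->|ab]; first by rewrite subrr Rint_set1.
rewrite /Rintegral (@continuous_FTC2 _ _ f a b) //.
have cff x : 0 < x -> {for x, continuous f}.
  by move=> x0; apply: differentiable_continuous; apply/derivable1_diffP/df.
split.
- by move=> x; rewrite in_itv/= => /andP[ax _]; apply: df; exact: lt_trans ax.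
- by apply: cvg_at_right_filter; exact: cff.
- by apply: cvg_at_left_filter; apply: cff; exact: lt_trans ab.
Qed.

Lemma primitive_is_derive f g : (forall x : R, 0 < x -> is_derive x 1 f (g x)) ->
  (forall x : R, 0 < x -> {for x, continuous g}) ->
  primitive f g.
Proof.
move=> df cg.
have E x : 0 < x -> (derive1 f) x = g x by move=> x0; rewrite derive1E; have [_ ->] := df x x0.
apply: (@primitive_ext f f (derive1 f)) => //.
apply: primitive_C1 => x x0; first by have [] := df x x0.
rewrite /prop_for/continuous_at E //; apply: cvg_trans (cg x x0).
apply: near_eq_cvg; near=> y; rewrite E //; near: y.
exact: lt_nbhsr.
Unshelve. all: by end_near. Qed.

End Primitives.

(** * Integrals over the half-line and vanishing boundary terms *)

Section HalfLine.
Context {R : realType}.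
Notation mu := (@lebesgue_measure R).
Local Notation D := (`]0, +oo[%classic : set R).
Implicit Types (f g h k F G : R -> R) (a b c e : R).

Lemma Rint_subset (A B : set R) f : measurable A -> measurable B -> A `<=` B ->
  itg B f -> (forall x, B x -> 0 <= f x) ->
  \int[mu]_(x in A) f x <= \int[mu]_(x in B) f x.
Proof.
move=> mA mB AB If f0.
have IA : itg A f by exact: itg_sub If.
apply: fine_le; [exact: (@integrable_fin_num _ _ _ mu A mA _ IA)|exact: (@integrable_fin_num _ _ _ mu B mB _ If)|].
apply: (@ge0_subset_integral _ _ _ mu A B mA mB) => //.
by apply/measurable_realfun.measurable_EFinP; exact: itg_meas If.
Qed.

Lemma Rint_exhaust G e : itg D G -> 0 < e -> exists n : nat,
  forall a b, 0 < a -> a <= n.+1%:R^-1 -> n.+1%:R <= b ->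
    `|\int[mu]_(x in D) G x - \int[mu]_(x in `[a, b]) G x| <= e.
Proof.
move=> IG e0; pose H : R -> R := fun x => `|G x|.
have IH : itg D H by exact: itg_norm.
have sub a b : 0 < a -> (`[a, b] `<=` D)%classic.
  by move=> a0 x /=; rewrite !in_itv/= andbT => /andP[ax _]; exact: lt_le_trans ax.
pose A (n : nat) : set R := `[n.+1%:R^-1, n.+1%:R]%classic.
have nd : nondecreasing_seq A.
  move=> n m nm; apply/subsetPset => x /=; rewrite /A /=; rewrite !in_itv/= => /andP[h1 h2].
  apply/andP; split.
    by apply: le_trans h1; rewrite lef_pV2 ?posrE // ler_nat ltnS.
  by apply: (le_trans h2); rewrite ler_nat ltnS.
have An0 n : (A n `<=` D)%classic by apply: sub; rewrite invr_gt0.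
have := @ge0_nondecreasing_set_cvg_integral _ (measurableTypeR R) _ A (EFin \o H) mu nd.
have -> : \bigcup_i A i = D by rewrite -halfline_bigcup.
move=> /(_ (fun i => measurable_itv _)).
have mH i : measurable_fun (A i) (EFin \o H).
  apply/measurable_realfun.measurable_EFinP; apply: measurable_funS (itg_meas IH) => //.
move=> /(_ mH) /(_ (fun _ _ _ => normr_ge0 _)).
rewrite -[X in _ --> X](fineK (@integrable_fin_num _ _ _ mu D (measurable_itv _) _ IH)).
move=> /fine_cvgP[_ /cvgrPdist_le/(_ _ e0)[N _ hN]].
exists N => a b a0 aN Nb.
have IA n : itg (A n) H.
  by apply: (itg_sub _ _ (An0 n) IH) => //; exact: measurable_itv.
have ab : a <= b.
  apply: (le_trans aN); apply: le_trans Nb.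
  by rewrite (le_trans (y := 1)) // ?invf_le1 ?ler1n.
have E1 (K : R -> R) : itg D K -> \int[mu]_(x in D) K x - \int[mu]_(x in `[a, b]) K x
    = \int[mu]_(x in D `\` `[a, b]%classic) K x.
  move=> IK.
  rewrite -{1}(setDUK (sub a b a0)) (@Rintegral_setU _ _ _ mu _ _ K) //.
  - by rewrite addrC addKr.
  - exact: measurableD.
  - by rewrite setDUK //; exact: sub.
  - by apply/disj_setPS => x [? []].
have mDab : measurable (D `\` `[a, b]%classic) by exact: measurableD.
have ID : itg (D `\` `[a, b]%classic) G by apply: itg_sub IG => // x [].
rewrite E1 //; apply: (le_trans (Rint_norm mDab ID)).
rewrite -E1 //.
have := hN N (leqnn N); rewrite /= => h.
apply: le_trans (le_trans (ler_norm _) h); rewrite lerB //.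
apply: Rint_subset => //; first exact: measurable_itv.
  by move=> x; rewrite /A /= !in_itv/= => /andP[h1 h2]; rewrite (le_trans aN) //= (le_trans h2).
  by apply: itg_sub IH => //; exact: sub.
by move=> x _; exact: normr_ge0.
Qed.

Lemma primitive_ln : primitive (@ln R) (fun x => x^-1).
Proof.
apply: primitive_is_derive => x x0 /=.
by apply: continuousV; rewrite ?gt_eqF //; exact: cvg_id.
Qed.

(* [1 / r] is not integrable near [0] nor near infinity. *)
Lemma small_value f e a b : itg D (fun x => f x / x) -> 0 < e -> 0 < a -> a <= b ->
  \int[mu]_(x in D) `|f x / x| < e * (ln b - ln a) ->
  exists x, a <= x <= b /\ `|f x| < e.
Proof.
move=> If e0 a0 ab; apply: contraPP => /forallNP H; apply/negP; rewrite -leNgt.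
have [Il ->] := primitive_ln a0 ab.
have sub : (`[a, b] `<=` D)%classic.
  by move=> x /=; rewrite !in_itv/= andbT => /andP[ax _]; exact: lt_le_trans ax.
rewrite -RintZ //.
apply: (@le_trans _ _ (\int[mu]_(x in `[a, b]) `|f x / x|)); last first.
  by apply: Rint_subset => //; exact: itg_norm.
apply: Rint_le => //; [exact: itgZ|by apply: itg_norm; apply: itg_sub If|].
move=> x xab; move: (xab) => /=; rewrite in_itv/= => axb.
have x0 : 0 < x by case/andP: axb => ax _; exact: lt_le_trans ax.
rewrite normrM (gtr0_norm (x := x^-1)) ?invr_gt0 //.
rewrite ler_pM2r ?invr_gt0 // leNgt; apply/negP => fx; exact: (H x).
Qed.

(** The boundary values need not be known to have limits. As [F x / x] is integrable while 1 / x is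
    not, neither at 0 nor at infinity, there are arbitrarily small and arbitrarily large points
    where [F] is small; integrating [G] between two such points gives almost 0. *)
Lemma Rint_primitive_eq0 F G : primitive F G -> itg D G ->
  itg D (fun x => F x / x) -> \int[mu]_(x in D) G x = 0.
Proof.
move=> FG IG IF; apply/eqP; rewrite -normr_le0; apply/ler_addgt0Pr => e e0; rewrite add0r.
have e30 : 0 < e / 3 by rewrite divr_gt0.
have [n hn] := Rint_exhaust IG e30.
set K := \int[mu]_(x in D) `|F x / x|.
(* The windows from N to N L and from 1 / (N L) to 1 / N both have logarithmic length ln L, chosen
   so that (e / 3) ln L exceeds the integral of |F x / x|. *)
set L := expR ((K + 1) / (e / 3)).
have lnL : ln L = (K + 1) / (e / 3) by rewrite expRK.
have L1 : 1 <= L.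
  by rewrite -expR0 ler_expR divr_ge0 ?(ltW e30) // addr_ge0 //; apply: Rint_ge0.
have L0 : 0 < L by exact: lt_le_trans L1.
set N : R := n.+1%:R.
have N0 : 0 < N by [].
have KL : K < e / 3 * ln L by rewrite lnL mulrC divfK ?gt_eqF // ltrDl.
have [b [/andP[Nb _] Fb]] : exists x, N <= x <= N * L /\ `|F x| < e / 3.
  apply: small_value => //; first by rewrite ler_peMr // ltW.
  by rewrite lnM ?posrE // addrC addKr.
have [a [/andP[La aN] Fa]] : exists x, N^-1 / L <= x <= N^-1 /\ `|F x| < e / 3.
  apply: small_value => //; first by rewrite divr_gt0 ?invr_gt0.
    by rewrite ler_pdivrMr // ler_peMr // invr_ge0 ltW.
  by rewrite lnM ?posrE ?invr_gt0 // lnV ?posrE // lnV ?posrE // opprD addNKr opprK.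
have a0 : 0 < a by apply: lt_le_trans La; rewrite divr_gt0 ?invr_gt0.
have ab : a <= b.
  apply: (le_trans aN); apply: le_trans Nb.
  by rewrite (le_trans (y := 1)) // ?invf_le1 ?ler1n.
have := hn a b a0 aN Nb; have [_ <-] := FG a b a0 ab.
move: Fa Fb; rewrite !ltr_norml !ler_norml; clear; lra.
Qed.

End HalfLine.

(** * Real square-integrable functions on the half-line *)

Section L2.
Context {R : realType}.
Notation mu := (@lebesgue_measure R).
Local Notation D := (`]0, +oo[%classic : set R).
Implicit Types (f g h k : R -> R) (a b c e : R).

(** The measure is dr without the planar factor r: that factor is absorbed by passing to sqrt r *
    phi. *)
Definition L2 f := measurable_fun D f /\ itg D (fun x => f x ^+ 2).

Definition ip f g : R := \int[mu]_(x in D) (f x * g x).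

Definition nrm f : R := Num.sqrt (\int[mu]_(x in D) (f x ^+ 2)).

Lemma L2_le f g c : measurable_fun D g -> (forall x, 0 < x -> `|g x| <= c * `|f x|) ->
  L2 f -> L2 g.
Proof.
move=> mg gf [mf If]; split => //.
apply: (@itg_le _ _ _ (fun x => c ^+ 2 * f x ^+ 2)) => //; last exact: itgZ.
  exact: measurable_funX.
move=> x /=; rewrite in_itv/= andbT => x0.
have gc : `|g x| <= `|c| * `|f x|.
  by apply: (le_trans (gf x x0)); rewrite ler_wpM2r // ler_norm.
rewrite normrX -[c ^+ 2]real_normK ?num_real // -[f x ^+ 2]real_normK ?num_real //.
by rewrite -exprMn lerXn2r ?nnegrE ?mulr_ge0.
Qed.

Lemma L2_itgM f g : L2 f -> L2 g -> itg D (fun x => f x * g x).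
Proof.
move=> [mf If] [mg Ig].
apply: (@itg_le _ _ _ (fun x => f x ^+ 2 + g x ^+ 2)) => //; last exact: itgD.
  exact: measurable_funM.
move=> x _; rewrite ler_norml; apply/andP; split; nra.
Qed.

Lemma L2D f g : L2 f -> L2 g -> L2 (fun x => f x + g x).
Proof.
move=> Lf Lg; have If := L2_itgM Lf Lg.
case: Lf Lg => [mf f2] [mg g2]; split; first exact: measurable_funD.
apply: (@itg_ext _ _ (fun x => f x ^+ 2 + (2 * (f x * g x) + g x ^+ 2))) => //.
  by move=> x _; ring.
by apply: itgD => //; apply: itgD => //; exact: itgZ.
Qed.

Lemma L2Z c f : L2 f -> L2 (fun x => c * f x).
Proof.
move=> Lf; apply: (L2_le (c := `|c|)) (Lf); first by case: Lf => mf _; exact: measurable_funM.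
by move=> x _; rewrite normrM.
Qed.

Lemma L2N f : L2 f -> L2 (fun x => - f x).
Proof.
move=> Lf; apply: (L2_le (c := 1)) (Lf); first by case: Lf => mf _; exact: measurableT_comp.
by move=> x _; rewrite normrN mul1r.
Qed.

Lemma L2B f g : L2 f -> L2 g -> L2 (fun x => f x - g x).
Proof. by move=> Lf Lg; apply: L2D => //; exact: L2N. Qed.

Lemma L2_ext f g : (forall x, 0 < x -> f x = g x) -> L2 f -> L2 g.
Proof.
move=> fg [mf If].
have fg' x : D x -> f x = g x by rewrite /= in_itv/= andbT => /fg.
split; first by apply: eq_measurable_fun mf => x /set_mem /fg'.
by apply: itg_ext If => // x /fg' ->.
Qed.

Lemma L2_0 : L2 (fun=> 0).
Proof.
split; first exact: measurable_cst.
by apply: (itg_ext _ _ (itg0 _)) => // x _; rewrite expr0n.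
Qed.

Lemma L2_sum (I : Type) (s : seq I) (P : pred I) (f : I -> R -> R) :
  (forall i, L2 (f i)) -> L2 (fun x => \sum_(i <- s | P i) f i x).
Proof.
move=> Lf; elim: s => [|i s IH]; first by apply: L2_ext L2_0 => x _; rewrite big_nil.
case Pi : (P i); last by apply: L2_ext IH => x _; rewrite big_cons Pi.
by apply: L2_ext (L2D (Lf i) IH) => x _; rewrite big_cons Pi.
Qed.

Lemma L2_norm f : L2 f -> L2 (fun x => `|f x|).
Proof.
move=> Lf; apply: (L2_le (c := 1)) (Lf); first by case: Lf => mf _; exact: measurableT_comp.
by move=> x _; rewrite normr_id mul1r.
Qed.

Lemma nrm_ge0 f : 0 <= nrm f.
Proof. exact: sqrtr_ge0. Qed.

Lemma nrm_sqr f : nrm f ^+ 2 = \int[mu]_(x in D) (f x ^+ 2).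
Proof. by rewrite sqr_sqrtr //; apply: Rint_ge0 => x _; exact: sqr_ge0. Qed.

Lemma nrm_ext f g : (forall x, 0 < x -> f x = g x) -> nrm f = nrm g.
Proof.
move=> fg; congr Num.sqrt; apply: Rint_ext => x /=.
by rewrite in_itv/= andbT => /fg ->.
Qed.

Lemma ipC f g : ip f g = ip g f.
Proof. by apply: Rint_ext => x _; rewrite mulrC. Qed.

Lemma ip_ext f g f1 g1 : (forall x, 0 < x -> f x * g x = f1 x * g1 x) -> ip f g = ip f1 g1.
Proof. by move=> fg; apply: Rint_ext => x /=; rewrite in_itv/= andbT => /fg. Qed.

Lemma ipDl f g h : L2 f -> L2 g -> L2 h ->
  ip (fun x => f x + g x) h = ip f h + ip g h.
Proof.
move=> Lf Lg Lh; rewrite /ip -RintD //; try exact: L2_itgM.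
by apply: Rint_ext => x _; rewrite mulrDl.
Qed.

Lemma ipZl c f h : L2 f -> L2 h -> ip (fun x => c * f x) h = c * ip f h.
Proof.
move=> Lf Lh; rewrite /ip -RintZ //; last exact: L2_itgM.
by apply: Rint_ext => x _; rewrite mulrA.
Qed.

Lemma ipNl f h : L2 f -> L2 h -> ip (fun x => - f x) h = - ip f h.
Proof.
move=> Lf Lh; rewrite -mulN1r -ipZl //.
by apply: ip_ext => x _; rewrite mulN1r.
Qed.

Lemma ipBl f g h : L2 f -> L2 g -> L2 h ->
  ip (fun x => f x - g x) h = ip f h - ip g h.
Proof. by move=> Lf Lg Lh; rewrite ipDl ?ipNl //; exact: L2N. Qed.

Lemma ipDr f g h : L2 f -> L2 g -> L2 h ->
  ip h (fun x => f x + g x) = ip h f + ip h g.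
Proof. by move=> Lf Lg Lh; rewrite !(ipC h) ipDl. Qed.

Lemma ipBr f g h : L2 f -> L2 g -> L2 h ->
  ip h (fun x => f x - g x) = ip h f - ip h g.
Proof. by move=> Lf Lg Lh; rewrite !(ipC h) ipBl. Qed.

Lemma ipZr c f h : L2 f -> L2 h -> ip h (fun x => c * f x) = c * ip h f.
Proof. by move=> Lf Lh; rewrite !(ipC h) ipZl. Qed.

Lemma ipff f : ip f f = nrm f ^+ 2.
Proof. by rewrite nrm_sqr; apply: Rint_ext => x _; rewrite expr2. Qed.

Lemma ip_le f g f1 g1 : L2 f -> L2 g -> L2 f1 -> L2 g1 ->
  (forall x, 0 < x -> f x * g x <= f1 x * g1 x) -> ip f g <= ip f1 g1.
Proof.
move=> Lf Lg Lf1 Lg1 H; apply: Rint_le => //; try exact: L2_itgM.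
by move=> x /=; rewrite in_itv/= andbT => /H.
Qed.

(** Cauchy-Schwarz, from the nonnegativity of the polynomial t -> |f + t g|^2. *)
Lemma ip_bound f g : L2 f -> L2 g -> `|ip f g| <= nrm f * nrm g.
Proof.
move=> Lf Lg.
have key t : 0 <= nrm f ^+ 2 + 2 * t * ip f g + t ^+ 2 * nrm g ^+ 2.
  have Lt := L2Z t Lg.
  have : 0 <= ip (fun x => f x + t * g x) (fun x => f x + t * g x).
    by rewrite ipff sqr_ge0.
  rewrite ipDl ?ipDr //; last exact: L2D.
  rewrite !ipZl ?ipZr // (ipC g f) !ipff; clear; nra.
rewrite -(@ler_pXn2r _ 2) ?nnegrE ?mulr_ge0 ?nrm_ge0 //.
rewrite real_normK ?num_real // exprMn.
(* If [g] has norm 0 the polynomial is affine in t; were its slope nonzero, it would take the value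
   -1 at the chosen t. *)
have [g0|g0] := eqVneq (nrm g ^+ 2) 0.
  rewrite g0 mulr0.
  have [-> //|i0] := eqVneq (ip f g) 0; first by rewrite expr0n.
  have := key (- (nrm f ^+ 2 + 1) / (2 * ip f g)).
  rewrite g0 mulr0 addr0 => h; exfalso; move: h.
  have -> : 2 * (- (nrm f ^+ 2 + 1) / (2 * ip f g)) * ip f g = - (nrm f ^+ 2 + 1).
    by field.
  clear; lra.
have gp : 0 < nrm g ^+ 2 by rewrite lt_neqAle eq_sym g0 sqr_ge0.
have := key (- ip f g / nrm g ^+ 2).
have -> : nrm f ^+ 2 + 2 * (- ip f g / nrm g ^+ 2) * ip f g +
      (- ip f g / nrm g ^+ 2) ^+ 2 * nrm g ^+ 2
   = (nrm f ^+ 2 * nrm g ^+ 2 - ip f g ^+ 2) / nrm g ^+ 2.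
  by field; apply: contra_neq g0 => ->; rewrite expr0n.
by rewrite pmulr_lge0 ?invr_gt0 // subr_ge0.
Qed.

Lemma nrmD f g : L2 f -> L2 g -> nrm (fun x => f x + g x) <= nrm f + nrm g.
Proof.
move=> Lf Lg; rewrite -(@ler_pXn2r _ 2) ?nnegrE ?addr_ge0 ?nrm_ge0 //.
have Lh := L2D Lf Lg.
rewrite -ipff ipDl // !ipDr // !ipff (ipC g f).
have := ip_bound Lf Lg; rewrite ler_norml; clear; nra.
Qed.

Lemma nrmZ c f : L2 f -> nrm (fun x => c * f x) = `|c| * nrm f.
Proof.
move=> Lf; apply/eqP; rewrite -(@eqrXn2 _ 2) ?mulr_ge0 ?nrm_ge0 //.
rewrite exprMn real_normK ?num_real // -!ipff ipZl ?ipZr //; last exact: L2Z.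
by apply/eqP; ring.
Qed.

Lemma nrm_le f g c : 0 <= c -> measurable_fun D g ->
  (forall x, 0 < x -> `|g x| <= c * `|f x|) -> L2 f -> nrm g <= c * nrm f.
Proof.
move=> c0 mg gf Lf; have Lg := L2_le mg gf Lf.
rewrite -(@ler_pXn2r _ 2) ?nnegrE ?mulr_ge0 ?nrm_ge0 //.
rewrite exprMn !nrm_sqr -RintZ; [|by []|exact: Lf.2].
apply: Rint_le => //; [exact: Lg.2|apply: itgZ => //; exact: Lf.2|].
move=> x /=; rewrite in_itv/= andbT => x0.
rewrite -(real_normK (num_real (g x))) -(real_normK (num_real (f x))) -exprMn.
by rewrite lerXn2r ?nnegrE ?mulr_ge0 // gf.
Qed.

Lemma nrmN f : nrm (fun x => - f x) = nrm f.
Proof. by congr Num.sqrt; apply: Rint_ext => x _; rewrite sqrrN. Qed.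

Lemma nrmBC f g : nrm (fun x => f x - g x) = nrm (fun x => g x - f x).
Proof. by rewrite -nrmN; apply: nrm_ext => x _; rewrite opprB. Qed.

Lemma nrmB_trans f g h : L2 f -> L2 g -> L2 h ->
  nrm (fun x => f x - h x) <= nrm (fun x => f x - g x) + nrm (fun x => g x - h x).
Proof.
move=> Lf Lg Lh; rewrite (@nrm_ext _ (fun x => (f x - g x) + (g x - h x))).
  by apply: nrmD; exact: L2B.
by move=> x _; rewrite addrA subrK.
Qed.

Lemma ipB_bound f g f0 g0 : L2 f -> L2 g -> L2 f0 -> L2 g0 ->
  `|ip f g - ip f0 g0| <= nrm (fun x => f x - f0 x) * nrm (fun x => g x - g0 x)
   + nrm (fun x => f x - f0 x) * nrm g0 + nrm f0 * nrm (fun x => g x - g0 x).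
Proof.
move=> Lf Lg Lf0 Lg0.
have L1 := L2B Lf Lf0; have L2' := L2B Lg Lg0.
have -> : ip f g - ip f0 g0 = ip (fun x => f x - f0 x) (fun x => g x - g0 x)
    + ip (fun x => f x - f0 x) g0 + ip f0 (fun x => g x - g0 x).
  by rewrite !ipBl ?ipBr //; ring.
apply: (le_trans (ler_normD _ _)); apply: lerD; last exact: ip_bound.
by apply: (le_trans (ler_normD _ _)); apply: lerD; exact: ip_bound.
Qed.

(** Stated for an arbitrary filter because it serves for times tending to t, for steps h tending to
    0, and for both at once. *)
Lemma ip_cvg (T : Type) (F : set_system T) (FF : Filter F) (f g : T -> R -> R) f0 g0 :
  (forall t, L2 (f t)) -> (forall t, L2 (g t)) -> L2 f0 -> L2 g0 ->
  nrm (fun x => f t x - f0 x) @[t --> F] --> 0 ->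
  nrm (fun x => g t x - g0 x) @[t --> F] --> 0 ->
  ip (f t) (g t) @[t --> F] --> ip f0 g0.
Proof.
move=> Lf Lg Lf0 Lg0 cf cg.
apply/subr_cvg0; apply/norm_cvg0P; apply: (squeeze_cvgr (f := fun=> 0) (h := fun t =>
   nrm (fun x => f t x - f0 x) * nrm (fun x => g t x - g0 x)
   + nrm (fun x => f t x - f0 x) * nrm g0 + nrm f0 * nrm (fun x => g t x - g0 x))).
- near=> t; rewrite normr_ge0 /=; exact: ipB_bound.
- exact: cvg_cst.
- have -> : 0 = 0 * 0 + 0 * nrm g0 + nrm f0 * 0 :> R by rewrite !(mulr0, mul0r, addr0).
  apply: cvgD; last by apply: cvgM => //; exact: cvg_cst.
  by apply: cvgD; apply: cvgM => //; exact: cvg_cst.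
Unshelve. all: by end_near. Qed.

End L2.

(** * Monotonicity from limits of difference quotients *)

Section Slopes.
Context {R : realType}.
Implicit Types (f g J M P : R -> R) (a b c e l s t x : R).

(** An ordinary two-sided derivative, written with [h^-1] in front so that it matches the difference
    quotients of L^2-valued functions literally. *)
Definition slope_limit f t l := h^-1 * (f (t + h) - f t) @[h --> 0^'] --> l.

(** For [s <= x <= t] the distances of [s] and [t] to [x] add up to [t - s], so the two errors at
    [x] combine into one proportional to [t - s]. *)
Lemma slope_limit_straddle f x l e : slope_limit f x l -> 0 < e ->
  exists2 d, 0 < d & forall s t, x - d < s -> s <= x -> x <= t -> t < x + d ->
    `|f t - f s - l * (t - s)| <= e * (t - s).
Proof.
move=> fl e0.
have /cvgrPdist_le/(_ _ e0)[d /= d0 hd] := fl.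
exists d => // s t xs sx xt tx.
have key y : `|y - x| < d -> `|f y - f x - l * (y - x)| <= e * `|y - x|.
  move=> yx; have [->|yx0] := eqVneq y x.
    by rewrite !subrr mulr0 subr0 normr0 mulr0.
  have h0 : y - x != 0 by rewrite subr_eq0.
  have := hd (y - x); rewrite /= sub0r normrN => /(_ yx h0).
  rewrite [x + _]addrC subrK => H.
  have -> : f y - f x - l * (y - x) = - (l - (y - x)^-1 * (f y - f x)) * (y - x).
    by field.
  by rewrite normrM normrN ler_wpM2r.
have Hs : `|s - x| < d by rewrite ltr_norml; move: xs sx d0; clear; lra.
have Ht : `|t - x| < d by rewrite ltr_norml; move: tx xt d0; clear; lra.
have := key s Hs; have := key t Ht.
rewrite (ger0_norm (x := t - x)) ?subr_ge0 // (ler0_norm (x := s - x)) ?subr_le0 //.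
rewrite !ler_norml; clear; lra.
Qed.

(** After subtraction of a line of slope [L + e] this is [locally_le_nonincreasing]. It applies to
    functions that are not known to be differentiable, such as the virial functional. *)
Lemma local_slope_bound f a b L : a <= b ->
  (forall x e, a <= x <= b -> 0 < e -> exists2 d, 0 < d &
     forall s t, a <= s -> t <= b -> x - d < s -> s <= x -> x <= t -> t < x + d ->
       f t - f s <= (L + e) * (t - s)) ->
  f b - f a <= L * (b - a).
Proof.
move=> ab H.
suff key e : 0 < e -> f b - f a <= (L + e) * (b - a).
  apply/ler_addgt0Pr => e e0.
  have [->|nab] := eqVneq a b; first by rewrite !subrr mulr0 add0r ltW.
  have ba : 0 < b - a by rewrite subr_gt0 lt_neqAle nab.
  have := key (e / (b - a)) (divr_gt0 e0 ba).
  by rewrite mulrDl divfK // gt_eqF.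
move=> e0.
suff : f b - (L + e) * b <= f a - (L + e) * a by clear; lra.
apply: (@locally_le_nonincreasing _ (fun x => f x - (L + e) * x)) => // x xab.
have [d d0 hd] := H x e xab e0.
exists d => // s t as_ tb xs sx xt tx.
by move: (hd s t as_ tb xs sx xt tx); clear; lra.
Qed.

Lemma slope_limit_bound f a b L : a <= b ->
  (forall x, a <= x <= b -> exists2 l, slope_limit f x l & l <= L) ->
  f b - f a <= L * (b - a).
Proof.
move=> ab H; apply: local_slope_bound => // x e xab e0.
have [l fl lL] := H x xab.
have [d d0 hd] := slope_limit_straddle fl e0.
exists d => // s t _ _ xs sx xt tx.
have := hd s t xs sx xt tx; rewrite ler_norml => /andP[_].
have ts : 0 <= t - s by move: sx xt; clear; lra.
have : l * (t - s) <= L * (t - s) by rewrite ler_wpM2r.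
clear; lra.
Qed.

Lemma slope_limitZ k f t l : slope_limit f t l -> slope_limit (fun s => k * f s) t (k * l).
Proof.
move=> fl; rewrite /slope_limit.
have -> : (fun h => h^-1 * (k * f (t + h) - k * f t)) = (fun h => k * (h^-1 * (f (t + h) - f t))).
  by apply/funext => h; ring.
by apply: cvgM => //; exact: cvg_cst.
Qed.

Lemma slope_limitD f g t l k : slope_limit f t l -> slope_limit g t k ->
  slope_limit (fun s => f s + g s) t (l + k).
Proof.
move=> fl gk; rewrite /slope_limit.
have -> : (fun h => h^-1 * (f (t + h) + g (t + h) - (f t + g t)))
   = (fun h => h^-1 * (f (t + h) - f t) + h^-1 * (g (t + h) - g t)).
  by apply/funext => h; ring.
exact: cvgD.
Qed.

Lemma slope_limit_sum (I : Type) (r : seq I) (f : I -> R -> R) (l : I -> R) t :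
  (forall i, slope_limit (f i) t (l i)) ->
  slope_limit (fun s => \sum_(i <- r) f i s) t (\sum_(i <- r) l i).
Proof.
move=> fl; elim: r => [|i r IH].
  rewrite big_nil /slope_limit.
  have -> : (fun h => h^-1 * (\sum_(i <- [::]) f i (t + h) - \sum_(i <- [::]) f i t)) = cst 0.
    by apply/funext => h; rewrite !big_nil subrr mulr0.
  exact: cvg_cst.
rewrite big_cons.
have -> : (fun s => \sum_(j <- i :: r) f j s) = (fun s => f i s + \sum_(j <- r) f j s).
  by apply/funext => s; rewrite big_cons.
exact: slope_limitD.
Qed.

(* [J + c M] and [J - c M] are both nonincreasing for small [c], so the
   oscillation of [M] is controlled by the decrease of [J], while [M] cannot
   stay away from [0] since [J] is bounded below. *)
Lemma virial_decay J M P M' c K B : 0 < c -> 0 < K ->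
  (forall t, 0 < t -> 0 <= M t <= P t) ->
  (forall t, 0 < t -> slope_limit M t (M' t)) ->
  (forall t, 0 < t -> `|M' t| <= K * P t) ->
  (forall t, 0 < t -> B <= J t) ->
  (forall x e, 0 < x -> 0 < e -> exists2 d, 0 < d & forall s t,
     x - d < s -> s <= t -> t < x + d -> J t - J s <= (- c * P x + e) * (t - s)) ->
  M t @[t --> +oo] --> 0.
Proof.
move=> c0 K0 MP dM M'K JB HJ.
have P0 x : 0 < x -> 0 <= P x by move=> /MP/andP[]; exact: le_trans.
(* With this [k] the variation of k M is at most c P per unit of time, which is what [J] loses. *)
set k := c / K; have k0 : 0 < k by rewrite divr_gt0.
have osc s t : 0 < s -> s <= t -> k * `|M t - M s| <= J s - J t.
  move=> s0 st.
  (* The values 1 and -1 of [sgn] give the two monotonicities. *)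
  have main sgn : `|sgn| <= 1 -> (J t + sgn * k * M t) - (J s + sgn * k * M s) <= 0 * (t - s).
    move=> sgn1; apply: (@local_slope_bound (fun x => J x + sgn * k * M x)) => // x e /andP[sx xt] e0.
    have x0 : 0 < x by exact: lt_le_trans sx.
    have e20 : 0 < e / 2 by rewrite divr_gt0.
    have ek0 : 0 < e / 2 / k by rewrite divr_gt0.
    have [d1 d10 H1] := HJ x (e / 2) x0 e20.
    have [d2 d20 H2] := slope_limit_straddle (dM x x0) ek0.
    exists (Num.min d1 d2); first by rewrite lt_min d10.
    move=> y z sy zt; rewrite ltrBlDl -ltrBlDr lt_min => /andP[y1 y2] yx xz.
    rewrite -ltrBlDl lt_min => /andP[z1 z2].
    have yz : y <= z by exact: le_trans xz.
    have xy1 : x - d1 < y by move: y1; clear; lra.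
    have xy2 : x - d2 < y by move: y2; clear; lra.
    have xz1 : z < x + d1 by move: z1; clear; lra.
    have xz2 : z < x + d2 by move: z2; clear; lra.
    have h1 := H1 y z xy1 yz xz1.
    have h2 := H2 y z xy2 yx xz xz2.
    have zy : 0 <= z - y by rewrite subr_ge0.
    have h3 : sgn * k * (M z - M y) <= (c * P x + e / 2) * (z - y).
      apply: (le_trans (ler_norm _)).
      rewrite normrM (normrM sgn) (gtr0_norm k0).
      apply: (@le_trans _ _ (k * `|M z - M y|)).
        by rewrite ler_wpM2r // -[leRHS]mul1r ler_wpM2r // ltW.
      have -> : (c * P x + e / 2) * (z - y) = k * (K * P x * (z - y) + e / 2 / k * (z - y)).
        by rewrite /k; field; rewrite (gt_eqF K0) (gt_eqF c0).
      rewrite ler_wpM2l ?(ltW k0) //.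
      have -> : M z - M y = M' x * (z - y) + (M z - M y - M' x * (z - y)) by ring.
      apply: (le_trans (ler_normD _ _)); apply: lerD => //.
      by rewrite normrM (ger0_norm zy) ler_wpM2r // M'K.
    move: h1 h3; clear; lra.
  have := main 1; have := main (-1); rewrite normrN normr1 mul0r => /(_ (lexx _)) h1 /(_ (lexx _)) h2.
  have [h|h] := leP 0 (M t - M s).
    by rewrite ger0_norm //; move: h2; clear; lra.
  by rewrite ltr0_norm //; move: h1; clear; lra.
pose A := [set J t | t in [set t : R | 0 < t]].
have hA : has_inf A.
  by split; [exists (J 1); exists 1 => //=|exists B => _ [t t0 <-]; exact: JB].
apply/cvgrPdist_le => e e0.
have e20 : 0 < e / 2 by rewrite divr_gt0.
have ke0 : 0 < k * (e / 2) by rewrite mulr_gt0.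
(* From [T] on, [J] can decrease by less than k e / 2, so [M] oscillates by at most e / 2. *)
have [_ [T T0 <-] JT] := inf_adherent ke0 hA.
have infJ t : 0 < t -> inf A <= J t by move=> t0; apply: ge_inf; [exact: hA.2|exists t].
have osc2 s t : T <= s -> s <= t -> `|M t - M s| <= e / 2.
  move=> Ts st; have s0 : 0 < s by exact: lt_le_trans Ts.
  have := osc s t s0 st; have := osc T s T0 Ts; have := infJ t (lt_le_trans s0 st).
  move=> h1 h2 h3.
  have p : 0 <= k * `|M s - M T| by rewrite mulr_ge0 // ltW.
  rewrite -(ler_pM2l k0); move: JT h1 h2 h3 p; clear; lra.
have [S TS MS] : exists2 S, T <= S & M S <= e / 2.
  apply: contrapT => nex.
  have Mbig s : T <= s -> e / 2 < M s.
    by move=> Ts; rewrite ltNge; apply/negP => h; apply: nex; exists s.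
  have dec t : T <= t -> J t - J T <= - c * (e / 2) * (t - T).
    move=> Tt; apply: local_slope_bound => // x e1 /andP[Tx xt] e10.
    have x0 : 0 < x by exact: lt_le_trans Tx.
    have [d d0 hd] := HJ x e1 x0 e10.
    exists d => // y z _ _ xy yx xz zx.
    have yz : y <= z by exact: le_trans xz.
    apply: (le_trans (hd y z xy yz zx)); rewrite ler_wpM2r ?subr_ge0 //.
    rewrite lerD2r !mulNr lerN2 ler_wpM2l ?(ltW c0) //.
    by apply: (le_trans (ltW (Mbig x Tx))); have /andP[] := MP x x0.
  have ce0 : 0 < c * (e / 2) by rewrite mulr_gt0.
  (* If [M] stayed above e / 2, then [J] would be at most B - 1 at this time. *)
  pose t1 := T + (`|J T - B| + 1) / (c * (e / 2)).
  have Tt1 : T <= t1 by rewrite lerDl divr_ge0 ?(ltW ce0) // addr_ge0.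
  have := dec t1 Tt1; have := JB t1 (lt_le_trans T0 Tt1).
  have -> : - c * (e / 2) * (t1 - T) = - (`|J T - B| + 1).
    by rewrite /t1; field; rewrite (gt_eqF c0) (gt_eqF e0).
  have := ler_norm (J T - B); clear; lra.
exists S; split; first exact: num_real.
move=> t St.
have := osc2 S t TS (ltW St); have /andP[M0 _] := MP t (lt_trans (lt_le_trans T0 TS) St).
rewrite sub0r normrN (ger0_norm M0) ler_norml; move: MS; clear; lra.
Qed.

End Slopes.

(** * The virial identity *)

Section Weights.
Context {R : realType}.
Variable d : R.
Hypothesis d0 : 0 < d.
Implicit Types (r : R).

(** [wgt], [wgt1] and [wgt2] are chi', chi'' and chi'''. The same family with parameter 3 in place
    of [d] provides the weight (1 + r)^(-4) of the local mass. *)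
Definition wgt r := (1 + r) `^ (- (1 + d)).
Definition wgt1 r := - (1 + d) * (1 + r) `^ (- (2 + d)).
Definition wgt2 r := (1 + d) * (2 + d) * (1 + r) `^ (- (3 + d)).
Definition chi r := (1 - (1 + r) `^ (- d)) / d.

Let is_derive_pow a r : 0 < r ->
  is_derive r 1 (fun r => (1 + r) `^ a) (a * (1 + r) `^ (a - 1)).
Proof.
move=> r0.
have h : 0 < 1 + r by rewrite addr_gt0.
have D1 : is_derive (1 + r) 1 (@powR R ^~ a) (a * (1 + r) `^ (a - 1)) := is_derive1_powR a h.
have D2 : is_derive r 1 (cst (1 : R) + id) (0 + 1) by exact: is_deriveD.
have D1' : is_derive ((cst (1 : R) + id) r) 1 (@powR R ^~ a) (a * (1 + r) `^ (a - 1)).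
  exact: D1.
by have := is_derive1_comp D1' D2; rewrite add0r mulr1.
Qed.

Let cont_pow a c r : 0 < r -> {for r, continuous (fun r => c * (1 + r) `^ a)}.
Proof.
move=> r0; have [D _] := is_derive_pow a r0.
have C : {for r, continuous (fun r => (1 + r) `^ a)}.
  by apply: differentiable_continuous; apply/derivable1_diffP.
by apply: cvgM => //; exact: cvg_cst.
Qed.

Let primitive_pow a : primitive (fun r => (1 + r) `^ a) (fun r => a * (1 + r) `^ (a - 1)).
Proof. by apply: primitive_is_derive => r r0; [exact: is_derive_pow|exact: cont_pow]. Qed.

Lemma primitive_chi : primitive chi wgt.
Proof.
have := primitiveZ (d^-1) (primitiveB (primitive_cst 1) (primitive_pow (- d))).
apply: primitive_ext => r r0; first by rewrite /chi mulrC.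
by rewrite /wgt opprD [- 1 - d]addrC; field; rewrite gt_eqF.
Qed.

Lemma primitive_wgt : primitive wgt wgt1.
Proof.
apply: primitive_ext (primitive_pow (- (1 + d))) => r r0 //.
by rewrite /wgt1; congr (_ * _ `^ _); ring.
Qed.

Lemma primitive_wgt1 : primitive wgt1 wgt2.
Proof.
apply: primitive_ext (primitiveZ (- (1 + d)) (primitive_pow (- (2 + d)))) => r r0 //.
rewrite /wgt2 mulrA; congr (_ * _ `^ _); ring.
Qed.

Lemma wgt_gt0 r : 0 < r -> 0 < wgt r.
Proof. by move=> r0; apply: powR_gt0; rewrite addr_gt0. Qed.

Let pow_step a r : 0 < r -> (1 + r) `^ a = (1 + r) `^ (a - 1) * (1 + r).
Proof.
move=> r0; have h : 0 < 1 + r by rewrite addr_gt0.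
have := @powRD _ (1 + r) (a - 1) 1; rewrite (gt_eqF h) implybT => /(_ isT).
by rewrite subrK powRr1 // ltW.
Qed.

Let pow_ln r : 0 < r -> (1 + r) `^ (- d) = expR (- (d * ln (1 + r))).
Proof. by move=> r0; rewrite /powR gt_eqF ?addr_gt0 // mulNr. Qed.

Lemma wgt1E r : 0 < r -> wgt1 r = - (1 + d) * wgt r / (1 + r).
Proof.
move=> r0; have h : 0 < 1 + r by rewrite addr_gt0.
rewrite /wgt1 /wgt (pow_step (- (1 + d)) r0).
have -> : - (1 + d) - 1 = - (2 + d) by ring.
by field; rewrite gt_eqF.
Qed.

Lemma wgt2E r : 0 < r -> wgt2 r = (1 + d) * (2 + d) * wgt r / (1 + r) ^+ 2.
Proof.
move=> r0; have h : 0 < 1 + r by rewrite addr_gt0.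
rewrite /wgt2 /wgt (pow_step (- (1 + d)) r0) (pow_step (- (1 + d) - 1) r0).
have -> : - (1 + d) - 1 - 1 = - (3 + d) by ring.
by field; rewrite gt_eqF.
Qed.

Lemma wgt_mulE r : 0 < r -> wgt r * (1 + r) = (1 + r) `^ (- d).
Proof.
move=> r0; rewrite (pow_step (- d) r0) /wgt; congr (_ `^ _ * _); ring.
Qed.

Lemma wgt_mul_le r : 0 < r -> wgt r * (1 + r) <= 1.
Proof.
move=> r0; rewrite wgt_mulE // pow_ln // expR_le1 oppr_le0 mulr_ge0 ?(ltW d0) //.
by rewrite ln_ge0 // lerDl ltW.
Qed.

Lemma wgt_le1 r : 0 < r -> wgt r <= 1.
Proof.
move=> r0; apply: le_trans (wgt_mul_le r0).
by rewrite ler_peMr ?(ltW (wgt_gt0 r0)) // lerDl ltW.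
Qed.

Lemma wgt_r_le1 r : 0 < r -> r * wgt r <= 1.
Proof.
move=> r0; apply: le_trans (wgt_mul_le r0).
by rewrite mulrC ler_wpM2l ?(ltW (wgt_gt0 r0)) // lerDr.
Qed.

(** chi vanishes at 0 and is concave, so it lies above r chi'. The proof rests on 1 + x <= exp x and
    on the lower bound r / (1 + r) for ln (1 + r). *)
Lemma chi_ge r : 0 < r -> r * wgt r <= chi r.
Proof.
move=> r0; have h : 0 < 1 + r by rewrite addr_gt0.
have ln_ge : r / (1 + r) <= ln (1 + r).
  have : ln (1 + r)^-1 <= (1 + r)^-1 - 1.
    have : -1 < (1 + r)^-1 - 1 by rewrite ltrBrDl subrr invr_gt0.
    by move=> /le_ln1Dx; rewrite addrC subrK.
  rewrite lnV ?posrE // lerNl opprB; apply: le_trans.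
  by rewrite le_eqVlt; apply/orP; left; apply/eqP; field; rewrite gt_eqF.
have pE : wgt r = (1 + r) `^ (- d) / (1 + r).
  by rewrite -wgt_mulE // mulfK ?gt_eqF.
rewrite /chi ler_pdivlMr // pE.
have q0 : 0 < (1 + r) `^ (- d) by exact: powR_gt0.
have : 1 + d * ln (1 + r) <= ((1 + r) `^ (- d))^-1.
  by rewrite pow_ln // -expRN opprK; exact: expR_ge1Dx.
set q := (1 + r) `^ (- d) in q0 *.
rewrite -(ler_pM2l q0) mulfV ?gt_eqF // => H.
have : d * (r / (1 + r)) <= d * ln (1 + r) by rewrite ler_wpM2l // ltW.
rewrite -(ler_pM2l q0) => H2.
have -> : r * (q / (1 + r)) * d = q * (d * (r / (1 + r))) by ring.
move: H H2; rewrite mulrDr mulr1; lra.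
Qed.

Lemma chi_gt0 r : 0 < r -> 0 < chi r.
Proof. by move=> r0; apply: lt_le_trans (chi_ge r0); rewrite mulr_gt0 // wgt_gt0. Qed.

Lemma chi_le r : 0 < r -> chi r <= r.
Proof.
move=> r0; rewrite /chi ler_pdivrMr // lerBlDr -lerBlDl pow_ln //.
apply: le_trans (expR_ge1Dx _); rewrite lerD2l lerN2 mulrC ler_wpM2r ?(ltW d0) //.
by apply: le_ln1Dx; rewrite (lt_trans _ r0) // ltrN10.
Qed.

Lemma chi_le_cst r : 0 < r -> chi r <= d^-1.
Proof.
by move=> r0; rewrite /chi ler_pdivrMr // mulVf ?gt_eqF // gerBl powR_ge0.
Qed.

Lemma wgt1_bound r : 0 < r -> d <= 1 -> r * `|wgt1 r| <= 2 * wgt r.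
Proof.
move=> r0 d1; have h : 0 < 1 + r by rewrite addr_gt0.
rewrite wgt1E // !normrM normrN (gtr0_norm (wgt_gt0 r0)).
rewrite (gtr0_norm (x := (1 + r)^-1)) ?invr_gt0 // gtr0_norm ?addr_gt0 //.
rewrite mulrA ler_pdivrMr //.
have := wgt_gt0 r0; set w := wgt r => w0.
rewrite -subr_ge0.
have -> : 2 * w * (1 + r) - r * ((1 + d) * w) = (2 + r * (1 - d)) * w by ring.
apply: mulr_ge0; last exact: ltW.
by apply: addr_ge0 => //; apply: mulr_ge0; [exact: ltW|rewrite subr_ge0].
Qed.

(** The number 45/16 is (1 + d)(2 + d) at d = 1/4. *)
Lemma wgt2_le r : 0 < r -> d <= 1 / 4 -> wgt2 r <= 45 / 16 * (wgt r / r ^+ 2).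
Proof.
move=> r0 d4; have h : 0 < 1 + r by rewrite addr_gt0.
rewrite wgt2E // [leRHS]mulrA; apply: ler_pM.
- by rewrite mulr_ge0 ?ltW ?wgt_gt0 // mulr_gt0 // addr_gt0.
- by rewrite invr_ge0 exprn_ge0 // ltW.
- rewrite ler_pM2r ?wgt_gt0 //.
  have dd : d * d <= 1 / 4 * d by rewrite ler_wpM2r // ltW.
  have -> : (1 + d) * (2 + d) = 2 + 3 * d + d * d by ring.
  by move: dd d4; lra.
- by rewrite lef_pV2 ?posrE ?exprn_gt0 // lerXn2r ?nnegrE ?ltW // ltrDr.
Qed.

Lemma wgt2_norm_le r : 0 < r -> d <= 1 / 4 -> `|wgt2 r| <= 3 * r^-1 ^+ 2.
Proof.
move=> r0 d4; have h : 0 < 1 + r by rewrite addr_gt0.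
rewrite ger0_norm; last first.
  by rewrite wgt2E // mulr_ge0 // ?invr_ge0 ?exprn_ge0 ?mulr_ge0 ?addr_ge0 // ltW // wgt_gt0.
apply: (le_trans (wgt2_le r0 d4)); rewrite exprVn ler_pM //.
- by rewrite divr_ge0 ?exprn_ge0 // ltW // wgt_gt0.
- by rewrite ler_pdivrMr // -natrM ler_nat.
- by rewrite ler_piMl ?invr_ge0 ?exprn_ge0 ?(ltW r0) // wgt_le1.
Qed.

(* The constant [3/4] is the smallest value of [S^2 - 1/4] for [S != 0]. *)
Lemma potential_bound r : 0 < r -> d <= 1 / 4 ->
  3 / 64 * wgt r / r ^+ 2 <= 3 / 4 * chi r / r ^+ 3 - wgt2 r / 4.
Proof.
move=> r0 d4; have h : 0 < 1 + r by rewrite addr_gt0.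
(* The margin: 3/4 minus a quarter of 45/16 is 3/64. *)
have h1 := wgt2_le r0 d4.
have h2 : wgt r / r ^+ 2 <= chi r / r ^+ 3.
  rewrite ler_pdivlMr ?exprn_gt0 //.
  have -> : wgt r / r ^+ 2 * r ^+ 3 = r * wgt r by field; rewrite gt_eqF.
  exact: chi_ge.
have -> : 3 / 64 * wgt r / r ^+ 2 = 3 / 64 * (wgt r / r ^+ 2) by ring.
have -> : 3 / 4 * chi r / r ^+ 3 = 3 / 4 * (chi r / r ^+ 3) by ring.
set W := wgt r / r ^+ 2 in h1 h2 *; set X := chi r / r ^+ 3 in h2 *.
move: h1 h2; lra.
Qed.

End Weights.

(** * Functions with f' and f / r in L^2, and integration by parts *)

Section Sobolev.
Context {R : realType}.
Notation mu := (@lebesgue_measure R).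
Local Notation D := (`]0, +oo[%classic : set R).
Implicit Types (f g p : R -> R) (r k K : R).

(** A common domain for the operators d/dr + k / r. The condition on [f r / r] does the work of a
    boundary condition at 0. *)
Definition sob f fx := [/\ primitive f fx, L2 f, L2 fx & L2 (fun r => f r / r)].

Lemma sobZ k f fx : sob f fx -> sob (fun r => k * f r) (fun r => k * fx r).
Proof.
case=> Pf Lf Lfx Lfr; split; [exact: primitiveZ|exact: L2Z|exact: L2Z|].
by apply: L2_ext (L2Z k Lfr) => r _; rewrite mulrA.
Qed.

Lemma sobB f fx g gx : sob f fx -> sob g gx ->
  sob (fun r => f r - g r) (fun r => fx r - gx r).
Proof.
case=> Pf Lf Lfx Lfr [Pg Lg Lgx Lgr].
split; [exact: primitiveB|exact: L2B|exact: L2B|].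
by apply: L2_ext (L2B Lfr Lgr) => r _; rewrite mulrBl.
Qed.

Lemma L2_bounded_mul p f K : measurable_fun D p -> (forall r, 0 < r -> `|p r| <= K) ->
  L2 f -> L2 (fun r => p r * f r).
Proof.
move=> mp pK Lf; apply: (L2_le (c := K)) (Lf).
  by apply: measurable_funM => //; case: Lf.
by move=> r r0; rewrite normrM ler_wpM2r // pK.
Qed.

Lemma measurable_inv : measurable_fun D (fun r : R => r^-1).
Proof.
have C r : 0 < r -> {for r, continuous (fun r : R => r^-1)}.
  by move=> r0; apply: continuousV; rewrite ?gt_eqF //; exact: cvg_id.
exact: continuous_measurable_fun C.
Qed.

(** The integrand is (p f g)'. The multiplier may be as singular as 1 / r at the origin, and its
    derivative as 1 / r^2, because each of [f] and [g] can absorb one factor 1 / r. *)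
Lemma sob_ibp p p1 f fx g gx K : primitive p p1 ->
  (forall r, 0 < r -> `|p r| <= K * (1 + r^-1)) ->
  (forall r, 0 < r -> `|p1 r| <= K * (1 + r^-1) ^+ 2) ->
  sob f fx -> sob g gx ->
  itg D (fun r => p1 r * (f r * g r) + p r * (fx r * g r + f r * gx r)) /\
  \int[mu]_(r in D) (p1 r * (f r * g r) + p r * (fx r * g r + f r * gx r)) = 0.
Proof.
move=> Pp pK p1K [Pf Lf Lfx Lfr] [Pg Lg Lgx Lgr].
have mp := primitive_measurable Pp; have mp1 := primitive_measurable_derivative Pp.
have [mf _] := Lf; have [mg _] := Lg; have [mfx _] := Lfx; have [mgx _] := Lgx.
pose hat (f : R -> R) := fun r => `|f r| + `|f r / r|.
have Lhf : L2 (hat f) by apply: L2D; exact: L2_norm.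
have Lhg : L2 (hat g) by apply: L2D; exact: L2_norm.
have hatE (h : R -> R) r : 0 < r -> hat h r = (1 + r^-1) * `|h r|.
  move=> r0; rewrite /hat normrM (gtr0_norm (x := r^-1)) ?invr_gt0 //; ring.
have D0 r : D r -> 0 < r by rewrite /= in_itv/= andbT.
have vp r : 0 < r -> 0 <= 1 + r^-1 by move=> r0; rewrite addr_ge0 // invr_ge0 ltW.
have I1 : itg D (fun r => p1 r * (f r * g r)).
  apply: (@itg_le _ _ _ (fun r => K * (hat f r * hat g r))) => //.
  - by do 2 apply: measurable_funM => //.
  - move=> r /D0 r0; rewrite !hatE // !normrM.
    have -> : K * ((1 + r^-1) * `|f r| * ((1 + r^-1) * `|g r|))
            = K * (1 + r^-1) ^+ 2 * (`|f r| * `|g r|) by ring.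
    by rewrite ler_wpM2r ?mulr_ge0 // p1K.
  - by apply: itgZ => //; exact: L2_itgM.
have aux (a b ha hb : R -> R) : L2 a -> L2 b -> L2 ha -> L2 hb ->
    (forall r, 0 < r -> (1 + r^-1) * (`|a r| * `|b r|) <= ha r * hb r) ->
    itg D (fun r => p r * (a r * b r)).
  move=> La Lb Lha Lhb H; have K0 : 0 <= K.
    have := le_trans (normr_ge0 _) (pK 1 ltr01); rewrite invr1 -mulr2n pmulr_lge0 //.
  apply: (@itg_le _ _ _ (fun r => K * (ha r * hb r))) => //.
  - by do 2 (apply: measurable_funM => //); [case: La|case: Lb].
  - move=> r /D0 r0; rewrite !normrM.
    apply: (@le_trans _ _ (K * ((1 + r^-1) * (`|a r| * `|b r|)))).
      by rewrite [leRHS]mulrA ler_wpM2r ?mulr_ge0 // pK.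
    by rewrite ler_wpM2l // H.
  - by apply: itgZ => //; exact: L2_itgM.
have I2 : itg D (fun r => p r * (fx r * g r)).
  apply: (aux _ _ (fun r => `|fx r|) (hat g)) => //; first exact: L2_norm.
  by move=> r r0; rewrite hatE // mulrCA.
have I3 : itg D (fun r => p r * (f r * gx r)).
  apply: (aux _ _ (hat f) (fun r => `|gx r|)) => //; first exact: L2_norm.
  by move=> r r0; rewrite hatE // mulrA.
(* This is the integrability of p f g / r, on which the vanishing of the boundary terms rests. *)
have I4 : itg D (fun r => p r * (f r * (g r / r))).
  apply: (aux _ _ (hat f) (fun r => `|g r / r|)) => //; first exact: L2_norm.
  by move=> r r0; rewrite hatE // mulrA.
have IG : itg D (fun r => p1 r * (f r * g r) + p r * (fx r * g r + f r * gx r)).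
  apply: (@itg_ext _ _ (fun r => p1 r * (f r * g r) + (p r * (fx r * g r) + p r * (f r * gx r)))) => //.
    by move=> r _; ring.
  by apply: itgD => //; exact: itgD.
split => //.
apply: (@Rint_primitive_eq0 _ (fun r => p r * (f r * g r))) => //.
  by apply: primitive_ext (primitiveM Pp (primitiveM Pf Pg)) => r _.
by apply: (itg_ext _ _ I4) => // r _; ring.
Qed.

Lemma primitive_inv k : primitive (fun r => k / r) (fun r => - k / r ^+ 2).
Proof.
apply: primitive_is_derive => r r0.
  have D1 : is_derive r 1 (fun r : R => r^-1) (- (r ^- 2)).
    have r0' : r != 0 by rewrite gt_eqF.
    have := @is_deriveV R id r 1 1 r0' (is_derive_id r 1).
    by rewrite /GRing.scale /= mulr1.
  have := is_deriveM (is_derive_cst k r 1) D1.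
  rewrite /GRing.scale /= mulr0 addr0 mulrN mulNr.
  exact.
have C2 : {for r, continuous (fun r : R => r ^+ 2)} by exact: exprn_continuous.
apply: cvgM; first exact: cvg_cst.
by apply: cvgV => //; rewrite expf_neq0 // gt_eqF.
Qed.

Lemma L2_potential k f fx : sob f fx -> L2 (fun r => k / r * f r).
Proof. by case=> _ _ _ Lfr; apply: L2_ext (L2Z k Lfr) => r _; ring. Qed.

(** In the expanded square the cross term (k / r)(f^2)' integrates to the integral of k f^2 / r^2,
    which makes the potential (k^2 + k) / r^2. *)
Lemma nrm_sob_coercive k f fx : 3 / 4 <= k ^+ 2 + k -> sob f fx ->
  nrm fx ^+ 2 + 3 / 4 * nrm (fun r => f r / r) ^+ 2
   <= nrm (fun r => fx r + k / r * f r) ^+ 2.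
Proof.
move=> k34 Sf; have [Pf Lf Lfx Lfr] := Sf.
have Lk := L2_potential k Sf.
have b1 r : 0 < r -> `|k / r| <= `|k| * (1 + r^-1).
  move=> r0; rewrite normrM (gtr0_norm (x := r^-1)) ?invr_gt0 // ler_wpM2l // lerDr //.
have b2 r : 0 < r -> `|- k / r ^+ 2| <= `|k| * (1 + r^-1) ^+ 2.
  move=> r0; have ri : 0 < r^-1 by rewrite invr_gt0.
  rewrite normrM normrN -exprVn (gtr0_norm (x := r^-1 ^+ 2)) ?exprn_gt0 //.
  by rewrite ler_wpM2l // lerXn2r ?nnegrE ?addr_ge0 ?ltW // ltrDr.
have [IZ Z] := sob_ibp (primitive_inv k) b1 b2 Sf Sf.
rewrite !nrm_sqr.
have I1 := Lfx.2; have I2 := Lfr.2.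
have I3 := (L2D Lfx Lk).2.
rewrite -RintZ // -RintD //; last exact: itgZ.
rewrite -[leLHS]addr0 -[X in _ + X <= _]Z -RintD //; last by apply: itgD => //; exact: itgZ.
apply: Rint_le => //; first by apply: itgD => //; apply: itgD => //; exact: itgZ.
move=> r /=; rewrite in_itv/= andbT => r0.
rewrite -subr_ge0.
have -> : (fx r + k / r * f r) ^+ 2 - (fx r ^+ 2 + 3 / 4 * (f r / r) ^+ 2 +
    (- k / r ^+ 2 * (f r * f r) + k / r * (fx r * f r + f r * fx r)))
   = (k ^+ 2 + k - 3 / 4) * (f r / r) ^+ 2.
  by field; rewrite gt_eqF.
by rewrite mulr_ge0 ?sqr_ge0 // subr_ge0.
Qed.

End Sobolev.

Section Elementary.
Context {R : realFieldType}.
Implicit Types x : R.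

Lemma le_1DX x : 0 <= x -> 1 <= 1 + x /\ x <= 1 + x /\ 1 <= (1 + x) ^+ 2 /\
  x <= (1 + x) ^+ 2 /\ x ^+ 2 <= (1 + x) ^+ 2.
Proof. by move=> x0; do ![split]; nra. Qed.

End Elementary.

(** * Commutators of the multiplier with the first-order operators *)

Section VirialIdentities.
Context {R : realType}.
Notation mu := (@lebesgue_measure R).
Local Notation D := (`]0, +oo[%classic : set R).
Variable d : R.
Hypothesis d0 : 0 < d.
Hypothesis d4 : d <= 1 / 4.
Implicit Types (f g fx gx p : R -> R) (r k : R).

Let d1 : d <= 1.
Proof. by apply: (le_trans d4); rewrite ler_pdivrMr // mul1r ler1n. Qed.

(* [mult] is the skew operator chi d/dr + chi'/2, and [comm k] its commutator
   with d/dr - k / r. *)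
Definition mult f fx r := chi d r * fx r + wgt d r * f r / 2.

Definition comm k f fx r :=
  - (wgt d r * fx r + wgt1 d r * f r / 2 - k / r ^+ 2 * chi d r * f r).

Definition dens f fx r := wgt d r * (fx r ^+ 2 + (f r / r) ^+ 2).

Lemma chi_norm_le r : 0 < r -> `|chi d r| <= r.
Proof. by move=> r0; rewrite gtr0_norm ?chi_gt0 // chi_le. Qed.

Lemma wgt_norm_le1 r : 0 < r -> `|wgt d r| <= 1.
Proof. by move=> r0; rewrite gtr0_norm ?wgt_gt0 // wgt_le1. Qed.

Lemma wgt1_norm_le r : 0 < r -> `|wgt1 d r| <= 2 / r.
Proof.
move=> r0; rewrite ler_pdivlMr // mulrC; apply: (le_trans (wgt1_bound d0 r0 d1)).
by rewrite -[leRHS]mulr1 ler_wpM2l // wgt_le1.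
Qed.

Let mchi := primitive_measurable (primitive_chi d0).
Let mwgt := primitive_measurable (primitive_wgt d).
Let mwgt1 := primitive_measurable (primitive_wgt1 d).

Lemma L2_mult f fx : sob f fx -> L2 (mult f fx).
Proof.
case=> _ Lf Lfx _; apply: L2D.
  apply: (L2_bounded_mul mchi (K := d^-1)) => // r r0.
  by rewrite gtr0_norm ?chi_gt0 // chi_le_cst.
apply: L2_ext (L2Z 2^-1 (L2_bounded_mul mwgt wgt_norm_le1 Lf)) => r _; ring.
Qed.

Lemma L2_comm k f fx : sob f fx -> L2 (comm k f fx).
Proof.
case=> _ Lf Lfx Lfr; apply: L2N; apply: L2B; first apply: L2D.
- exact: (L2_bounded_mul mwgt wgt_norm_le1 Lfx).
- have m1 : measurable_fun D (fun r => r * wgt1 d r) by apply: measurable_funM => //.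
  have b1 r : 0 < r -> `|r * wgt1 d r| <= 2.
    move=> r0; rewrite normrM (gtr0_norm r0); apply: (le_trans (wgt1_bound d0 r0 d1)).
    by rewrite -[leRHS]mulr1 ler_wpM2l // wgt_le1.
  apply: L2_ext (L2Z 2^-1 (L2_bounded_mul m1 b1 Lfr)) => r r0.
  by field; rewrite gt_eqF.
- have m1 : measurable_fun D (fun r => chi d r / r) by apply: measurable_funM => //; exact: measurable_inv.
  have b1 r : 0 < r -> `|chi d r / r| <= 1.
    move=> r0; rewrite normrM (gtr0_norm (x := r^-1)) ?invr_gt0 // ler_pdivrMr // mul1r.
    exact: chi_norm_le.
  apply: L2_ext (L2Z k (L2_bounded_mul m1 b1 Lfr)) => r r0.
  by field; rewrite gt_eqF.
Qed.

Lemma itg_dens f fx : sob f fx -> itg D (dens f fx).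
Proof.
case=> _ _ Lfx Lfr.
have I := itgD (measurable_itv _) Lfx.2 Lfr.2.
apply: (itg_le _ _ _ I) => //.
  by apply: measurable_funM => //; exact: itg_meas I.
move=> r /=; rewrite in_itv/= andbT => r0.
rewrite normrM (ger0_norm (x := _ + _)) ?addr_ge0 ?sqr_ge0 //.
by rewrite -[leRHS]mul1r ler_wpM2r ?addr_ge0 ?sqr_ge0 // wgt_norm_le1.
Qed.

Let ibp_chi f fx g gx : sob f fx -> sob g gx ->
  itg D (fun r => wgt d r * (f r * g r) + chi d r * (fx r * g r + f r * gx r)) /\
  \int[mu]_(r in D) (wgt d r * (f r * g r) + chi d r * (fx r * g r + f r * gx r)) = 0.
Proof.
have di : 0 < d^-1 by rewrite invr_gt0.
have xr r : 0 < r -> 0 <= r^-1 by move=> r0; rewrite invr_ge0 ltW.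
apply: (sob_ibp (K := d^-1 + 1) (primitive_chi d0)) => r r0.
  have [h1 _] := le_1DX (xr r r0).
  rewrite gtr0_norm ?chi_gt0 //; apply: (le_trans (chi_le_cst d0 r0)).
  by rewrite -[leLHS]mulr1 ler_pM // ?(ltW di) // lerDl.
have [_ [_ [h1 _]]] := le_1DX (xr r r0).
apply: (le_trans (wgt_norm_le1 r0)).
by rewrite -[leLHS]mulr1 ler_pM // lerDr ltW.
Qed.

Let ibp_wgt f fx g gx : sob f fx -> sob g gx ->
  itg D (fun r => wgt1 d r * (f r * g r) + wgt d r * (fx r * g r + f r * gx r)) /\
  \int[mu]_(r in D) (wgt1 d r * (f r * g r) + wgt d r * (fx r * g r + f r * gx r)) = 0.
Proof.
have xr r : 0 < r -> 0 <= r^-1 by move=> r0; rewrite invr_ge0 ltW.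
apply: (sob_ibp (K := 2) (primitive_wgt d)) => r r0.
  have [h1 _] := le_1DX (xr r r0).
  by apply: (le_trans (wgt_norm_le1 r0)); rewrite -[leLHS]mulr1 ler_pM // ler1n.
have [_ [_ [_ [h1 _]]]] := le_1DX (xr r r0).
by apply: (le_trans (wgt1_norm_le r0)); rewrite ler_wpM2l.
Qed.

Let ibp_kchi k f fx g gx : sob f fx -> sob g gx ->
  itg D (fun r => k * (wgt d r / r - chi d r / r ^+ 2) * (f r * g r)
      + k * (chi d r / r) * (fx r * g r + f r * gx r)) /\
  \int[mu]_(r in D) (k * (wgt d r / r - chi d r / r ^+ 2) * (f r * g r)
      + k * (chi d r / r) * (fx r * g r + f r * gx r)) = 0.
Proof.
have P : primitive (fun r => k * (chi d r / r)) (fun r => k * (wgt d r / r - chi d r / r ^+ 2)).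
  have := primitiveZ k (primitiveM (primitive_chi d0) (primitive_inv 1)).
  apply: primitive_ext => r r0; first by rewrite mul1r.
  by field; rewrite gt_eqF.
have xr r : 0 < r -> 0 <= r^-1 by move=> r0; rewrite invr_ge0 ltW.
have c1 r : 0 < r -> `|chi d r / r| <= 1.
  move=> r0; rewrite normrM (gtr0_norm (x := r^-1)) ?invr_gt0 //.
  by rewrite ler_pdivrMr // mul1r chi_norm_le.
apply: (sob_ibp (K := `|k| * 2) P) => r r0.
  have [h1 _] := le_1DX (xr r r0).
  rewrite normrM -[leRHS]mulrA ler_wpM2l //; apply: (le_trans (c1 r r0)).
  by rewrite -[leLHS]mulr1 ler_pM // ler1n.
have [_ [_ [_ [h1 _]]]] := le_1DX (xr r r0).
rewrite normrM -[leRHS]mulrA ler_wpM2l //.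
apply: (@le_trans _ _ (2 * r^-1)); last by rewrite ler_wpM2l.
have -> : wgt d r / r - chi d r / r ^+ 2 = (wgt d r - chi d r / r) / r.
  by field; rewrite gt_eqF.
rewrite normrM (ger0_norm (xr r r0)) ler_wpM2r ?(xr r r0) //.
apply: (le_trans (ler_normB _ _)).
by have -> : 2 = 1 + 1 :> R by []; apply: lerD; [exact: wgt_norm_le1|exact: c1].
Qed.

Lemma mult_skew f fx g gx : sob f fx -> sob g gx ->
  ip (mult f fx) g + ip f (mult g gx) = 0.
Proof.
move=> Sf Sg; have [I Z] := ibp_chi Sf Sg.
have Lf := L2_mult Sf; have Lg := L2_mult Sg.
have [_ Lf0 _ _] := Sf; have [_ Lg0 _ _] := Sg.
rewrite /ip -RintD //; try exact: L2_itgM.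
by rewrite -[RHS]Z; apply: Rint_ext => r _; rewrite /mult; field.
Qed.

(** The commutator in weak form: formally both sides pair [f] with [A, d/dr - k / r] g. Moving d/dr
    over to [f] avoids a second derivative of [g], which need not exist. *)
Lemma mult_bilinear k f fx g gx : sob f fx -> sob g gx ->
  ip (fun r => fx r + k / r * f r) (mult g gx)
   - ip (mult f fx) (fun r => gx r - k / r * g r) = ip f (comm k g gx).
Proof.
move=> Sf Sg; have [I1 Z1] := ibp_wgt Sf Sg; have [I2 Z2] := ibp_kchi k Sf Sg.
have Lf := L2_mult Sf; have Lg := L2_mult Sg; have Lc := L2_comm k Sg.
have [_ Lf0 Lfx _] := Sf; have [_ Lg0 Lgx _] := Sg.
have L1 := L2D Lfx (L2_potential k Sf); have L2 := L2B Lgx (L2_potential k Sg).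
apply/eqP; rewrite -subr_eq0; apply/eqP.
rewrite /ip -!RintB //; try exact: L2_itgM; last by apply: itgB => //; exact: L2_itgM.
(* The difference of the two sides is the integral of (chi' f g)' / 2 + (k chi f g / r)'. *)
rewrite (_ : \int[mu]_(r in D) _ = \int[mu]_(r in D)
  (2^-1 * (wgt1 d r * (f r * g r) + wgt d r * (fx r * g r + f r * gx r)) +
   (k * (wgt d r / r - chi d r / r ^+ 2) * (f r * g r)
      + k * (chi d r / r) * (fx r * g r + f r * gx r)))).
  by rewrite RintD // ?RintZ // ?Z1 ?Z2 ?mulr0 ?addr0 //; exact: itgZ.
apply: Rint_ext => r /=; rewrite in_itv/= andbT => r0.
by rewrite /mult /comm; field; rewrite gt_eqF.
Qed.

(** The terms in [k] cancel and the integrand becomes -(chi' f g)'. This is what removes the mass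
    from the coercivity estimate. *)
Lemma comm_mass k f fx g gx : sob f fx -> sob g gx ->
  ip f (comm k g gx) + ip g (comm (- k) f fx) = 0.
Proof.
move=> Sf Sg; have [I Z] := ibp_wgt Sf Sg.
have Lf := L2_comm (- k) Sf; have Lg := L2_comm k Sg.
have [_ Lf0 _ _] := Sf; have [_ Lg0 _ _] := Sg.
rewrite /ip -RintD //; try exact: L2_itgM.
rewrite (_ : \int[mu]_(r in D) _ = \int[mu]_(r in D)
  (-1 * (wgt1 d r * (f r * g r) + wgt d r * (fx r * g r + f r * gx r)))).
  by rewrite RintZ // Z mulr0.
by apply: Rint_ext => r /=; rewrite in_itv/= andbT => r0; rewrite /comm; field; rewrite gt_eqF.
Qed.

(** Adding an exact derivative removes the cross term and leaves -(chi' gx^2 + V g^2) with V = (k^2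
    - k) chi / r^3 - chi''' / 4, to which [potential_bound] applies. *)
Lemma comm_coercive k g gx : 3 / 4 <= k ^+ 2 - k -> sob g gx ->
  ip (fun r => gx r - k / r * g r) (comm k g gx)
   <= - (3 / 64) * \int[mu]_(r in D) dens g gx r.
Proof.
move=> k34 Sg; have [Pg Lg Lgx Lgr] := Sg.
have Lc := L2_comm k Sg; have L1 := L2B Lgx (L2_potential k Sg).
have Id := itg_dens Sg.
(* Minus the coefficient of [g * gx] in the product on the left, so that adding half of (p g^2)'
   leaves squares only. *)
pose p r := wgt1 d r / 2 - k / r ^+ 2 * chi d r - k / r * wgt d r.
pose p1 r := wgt2 d r / 2 + 2 * k / r ^+ 3 * chi d r - k / r * wgt1 d r.
have PP : primitive p p1.
  have P0 : primitive (fun r => k / r ^+ 2) (fun r => - (2 * k) / r ^+ 3).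
    apply: primitive_ext (primitiveM (primitive_inv k) (primitive_inv 1)) => r r0;
      by field; rewrite gt_eqF.
  have := primitiveB (primitiveB (primitiveZ 2^-1 (primitive_wgt1 d))
     (primitiveM P0 (primitive_chi d0))) (primitiveM (primitive_inv k) (primitive_wgt d)).
  apply: primitive_ext => r r0; rewrite /p /p1; by field; rewrite gt_eqF.
have xr r : 0 < r -> 0 <= r^-1 by move=> r0; rewrite invr_ge0 ltW.
have c1 r : 0 < r -> `|chi d r / r| <= 1.
  move=> r0; rewrite normrM (gtr0_norm (x := r^-1)) ?invr_gt0 //.
  by rewrite ler_pdivrMr // mul1r chi_norm_le.
pose K := 4 * `|k| + 6.
have K0 : 0 <= K by rewrite addr_ge0 // mulr_ge0.
have pK r : 0 < r -> `|p r| <= K * (1 + r^-1).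
  move=> r0; have [_ [h1 _]] := le_1DX (xr r r0).
  apply: (@le_trans _ _ (K * r^-1)); last by rewrite ler_wpM2l.
  rewrite /p (_ : k / r ^+ 2 * chi d r = k * (chi d r / r) / r); last by field; rewrite gt_eqF.
  rewrite (_ : k / r * wgt d r = k * wgt d r / r); last by field; rewrite gt_eqF.
  apply: (le_trans (ler_normB _ _)); apply: (le_trans (lerD (ler_normB _ _) (lexx _))).
  have a1 : `|wgt1 d r / 2| <= r^-1.
    rewrite normrM (gtr0_norm (x := 2^-1)) ?invr_gt0 // ler_pdivrMr // mulrC.
    exact: wgt1_norm_le.
  have a2 : `|k * (chi d r / r) / r| <= `|k| * r^-1.
    rewrite 2!normrM (ger0_norm (xr r r0)) ler_wpM2r ?(xr r r0) //.
    by rewrite -[leRHS]mulr1 ler_wpM2l // c1.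
  have a3 : `|k * wgt d r / r| <= `|k| * r^-1.
    rewrite 2!normrM (ger0_norm (xr r r0)) ler_wpM2r ?(xr r r0) //.
    by rewrite -[leRHS]mulr1 ler_wpM2l // wgt_norm_le1.
  apply: (le_trans (lerD (lerD a1 a2) a3)).
  have : 0 <= `|k| * r^-1 by rewrite mulr_ge0 // xr.
  by have := xr r r0; rewrite /K; lra.
have p1K r : 0 < r -> `|p1 r| <= K * (1 + r^-1) ^+ 2.
  move=> r0; have [_ [_ [_ [_ h1]]]] := le_1DX (xr r r0).
  apply: (@le_trans _ _ (K * r^-1 ^+ 2)); last by rewrite ler_wpM2l.
  have x2 : 0 <= r^-1 ^+ 2 by rewrite sqr_ge0.
  rewrite /p1 (_ : 2 * k / r ^+ 3 * chi d r = 2 * k * (chi d r / r) * r^-1 ^+ 2);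
    last by field; rewrite gt_eqF.
  rewrite (_ : k / r * wgt1 d r = k * (r * wgt1 d r) * r^-1 ^+ 2); last by field; rewrite gt_eqF.
  apply: (le_trans (ler_normB _ _)); apply: (le_trans (lerD (ler_normD _ _) (lexx _))).
  have a1 : `|wgt2 d r / 2| <= 3 / 2 * r^-1 ^+ 2.
    rewrite normrM (gtr0_norm (x := 2^-1)) ?invr_gt0 // mulrAC ler_wpM2r ?invr_ge0 //.
    exact: wgt2_norm_le.
  have a2 : `|2 * k * (chi d r / r) * r^-1 ^+ 2| <= 2 * `|k| * r^-1 ^+ 2.
    rewrite normrM (ger0_norm x2) ler_wpM2r // normrM (normrM 2) (ger0_norm (x := 2)) //.
    by rewrite -[leRHS]mulr1 ler_wpM2l ?mulr_ge0 ?normr_ge0 // c1.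
  have a3 : `|k * (r * wgt1 d r) * r^-1 ^+ 2| <= 2 * `|k| * r^-1 ^+ 2.
    rewrite normrM (ger0_norm x2) ler_wpM2r // normrM mulrC ler_wpM2r //.
    rewrite normrM (gtr0_norm r0); apply: (le_trans (wgt1_bound d0 r0 d1)).
    by rewrite -[leRHS]mulr1 ler_wpM2l // wgt_le1.
  apply: (le_trans (lerD (lerD a1 a2) a3)).
  have : 0 <= `|k| * r^-1 ^+ 2 by rewrite mulr_ge0.
  by rewrite /K; lra.
have [IZ Z] := sob_ibp PP pK p1K Sg Sg.
rewrite -RintZ // -[leRHS]addr0 -[X in _ <= _ + X](mulr0 (- 2^-1)) -[X in _ <= _ + _ * X]Z.
rewrite -RintZ // -RintD //; try exact: itgZ.
apply: Rint_le => //; first exact: L2_itgM.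
  by apply: itgD => //; exact: itgZ.
move=> r /=; rewrite in_itv/= andbT => r0.
have pot := potential_bound d0 r0 d4.
have w0 := wgt_gt0 d r0.
have c0 := chi_gt0 d0 r0.
have h1 : 3 / 64 * (wgt d r * (g r / r) ^+ 2) <=
   ((k ^+ 2 - k) * (chi d r / r ^+ 3) - wgt2 d r / 4) * g r ^+ 2.
  rewrite (_ : 3 / 64 * _ = 3 / 64 * wgt d r / r ^+ 2 * g r ^+ 2); last by field; rewrite gt_eqF.
  rewrite ler_wpM2r ?sqr_ge0 //; apply: (le_trans pot); rewrite lerD2r -mulrA.
  by rewrite ler_wpM2r // ltW // divr_gt0 // exprn_gt0.
have h2 : 3 / 64 * (wgt d r * gx r ^+ 2) <= wgt d r * gx r ^+ 2.
  have : 0 <= wgt d r * gx r ^+ 2 by rewrite mulr_ge0 ?sqr_ge0 ?(ltW w0).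
  by set X := wgt d r * gx r ^+ 2; lra.
rewrite /dens -subr_ge0.
rewrite (_ : _ - _ = (wgt d r * gx r ^+ 2 - 3 / 64 * (wgt d r * gx r ^+ 2)) +
   (((k ^+ 2 - k) * (chi d r / r ^+ 3) - wgt2 d r / 4) * g r ^+ 2
     - 3 / 64 * (wgt d r * (g r / r) ^+ 2))).
  by rewrite addr_ge0 // subr_ge0.
by rewrite /comm /p /p1; field; rewrite gt_eqF.
Qed.

End VirialIdentities.

(** * The radial Dirac operator in four real components *)

Section Components.
Context {R : realType}.
Notation mu := (@lebesgue_measure R).
Local Notation D := (`]0, +oo[%classic : set R).

(* The real components of the spinor: writing [(u1, u2)] for
   [sqrt r * (phi1, phi2)], the indices [(false, false)], [(false, true)],
   [(true, false)], [(true, true)] stand for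
   [Re u1], [Im u2], [- Im u1], [Re u2]. *)
Definition comp := (bool * bool)%type.
(** [sg] exchanges the components linked by the radial derivative, [ta] those linked by the mass.
    With the minus sign in -Im u1 every derivative enters with coefficient 1; the remaining signs
    are kept in [kap] and [ep]. *)
Definition sg (i : comp) : comp := (i.1, ~~ i.2).
Definition ta (i : comp) : comp := (~~ i.1, i.2).
Definition kap (k : R) (i : comp) : R := if i.2 then - k else k.
Definition ep (i : comp) : R := if i.1 (+) i.2 then -1 else 1.

Lemma sgK : involutive sg. Proof. by case=> a b; rewrite /sg /= negbK. Qed.
Lemma taK : involutive ta. Proof. by case=> a b; rewrite /ta /= negbK. Qed.
Lemma kap_sg k i : kap k (sg i) = - kap k i.
Proof. by case: i => a []; rewrite /kap /= ?opprK. Qed.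
Lemma kap_ta k i : kap k (ta i) = kap k i. Proof. by []. Qed.
Lemma ep_ta i : ep (ta i) = - ep i.
Proof. by case: i => [[] []]; rewrite /ep /= ?opprK. Qed.
Lemma ep_norm i : `|ep i| = 1.
Proof. by case: i => [[] []]; rewrite /ep /= ?normrN normr1. Qed.

Lemma sum_sg (f : comp -> R) : \sum_i f i = \sum_i f (sg i).
Proof. by rewrite (reindex_inj (can_inj sgK)). Qed.
Lemma sum_ta (f : comp -> R) : \sum_i f i = \sum_i f (ta i).
Proof. by rewrite (reindex_inj (can_inj taK)). Qed.

(** Because (1 + r)^(d - 3) <= (1 + r)^(-2) <= r^(-2). The local weight thus lies below the weight
    of u^2 in the energy density. *)
Lemma loc_le (d r : R) : d <= 1 -> 0 < r -> wgt 3 r <= wgt d r / r ^+ 2.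
Proof.
move=> d1 r0; have h : 0 < 1 + r by rewrite addr_gt0.
have -> : wgt 3 r = wgt d r * (1 + r) `^ (d - 3).
  rewrite /wgt -powRD; last by rewrite (gt_eqF h) implybT.
  by congr (_ `^ _); ring.
rewrite ler_pM2l ?wgt_gt0 //.
apply: (@le_trans _ _ ((1 + r) `^ (- 2%:R))).
  by apply: ler_powR; [rewrite lerDl ltW|lra].
rewrite powR_invn ?(ltW h) // lef_pV2 ?posrE ?exprn_gt0 //.
by rewrite lerXn2r ?nnegrE ?ltW // ltrDr.
Qed.

Variables (d k m : R).
Hypothesis d0 : 0 < d.
Hypothesis d4 : d <= 1 / 4.
Hypothesis k1 : 3 / 4 <= k ^+ 2 - k.
Hypothesis k2 : 3 / 4 <= k ^+ 2 + k.

Implicit Types (v vx z zx : comp -> R -> R) (i j : comp) (r : R).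

Definition dirac v vx i r :=
  vx (sg i) r + kap k i / r * v (sg i) r + m * ep i * v (ta i) r.

Lemma L2_dirac v vx i : (forall j, sob (v j) (vx j)) -> L2 (dirac v vx i).
Proof.
move=> Sv; have [_ _ Lx _] := Sv (sg i); have [_ Lt _ _] := Sv (ta i).
apply: L2D; last exact: L2Z.
exact: (L2D Lx (L2_potential _ (Sv (sg i)))).
Qed.

Lemma ip_dirac v vx i (w : R -> R) : (forall j, sob (v j) (vx j)) -> L2 w ->
  ip (dirac v vx i) w = ip (fun r => vx (sg i) r + kap k i / r * v (sg i) r) w
    + m * ep i * ip (v (ta i)) w.
Proof.
move=> Sv Lw; have [_ _ Lx _] := Sv (sg i); have [_ Lt _ _] := Sv (ta i).
have L1 := L2D Lx (L2_potential (kap k i) (Sv (sg i))).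
by rewrite /dirac ipDl ?ipZl //; exact: L2Z.
Qed.

Let kapD i : 3 / 4 <= kap k i ^+ 2 + kap k i.
Proof. by rewrite /kap; case: i.2; rewrite ?sqrrN. Qed.
Let kapB i : 3 / 4 <= kap k i ^+ 2 - kap k i.
Proof. by rewrite /kap; case: i.2; rewrite ?sqrrN ?opprK. Qed.

(** As [dirac] is formally skew, both sides express the pairing of [v] with [A, dirac] z. The mass
    terms cancel because [mult] is skew and [ep] is odd under [ta]. Two different arguments are
    allowed since the identity is applied at the times t + h and t. *)
Lemma dirac_mult_antisym v vx z zx : (forall j, sob (v j) (vx j)) ->
  (forall j, sob (z j) (zx j)) ->
  \sum_i (ip (dirac v vx i) (mult d (z i) (zx i))
          - ip (mult d (v i) (vx i)) (dirac z zx i))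
  = \sum_i ip (v (sg i)) (comm d (kap k i) (z i) (zx i)).
Proof.
move=> Sv Sz.
have Lv j : L2 (v j) by case: (Sv j).
have Lz j : L2 (z j) by case: (Sz j).
have Lvx j : L2 (vx j) by case: (Sv j).
have Lzx j : L2 (zx j) by case: (Sz j).
have Lmv j := L2_mult d0 (Sv j); have Lmz j := L2_mult d0 (Sz j).
have Lv1 i := L2D (Lvx (sg i)) (L2_potential (kap k i) (Sv (sg i))).
have Lz1 i := L2D (Lzx (sg i)) (L2_potential (kap k i) (Sz (sg i))).
have E i : ip (dirac v vx i) (mult d (z i) (zx i)) - ip (mult d (v i) (vx i)) (dirac z zx i)
  = (ip (fun r => vx (sg i) r + kap k i / r * v (sg i) r) (mult d (z i) (zx i))
     - ip (mult d (v i) (vx i)) (fun r => zx (sg i) r + kap k i / r * z (sg i) r))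
    + m * ep i * (ip (v (ta i)) (mult d (z i) (zx i)) - ip (mult d (v i) (vx i)) (z (ta i))).
  rewrite ip_dirac // (ipC (mult d (v i) (vx i)) (dirac z zx i)) ip_dirac //.
  rewrite !(ipC _ (mult d (v i) (vx i))); ring.
rewrite (eq_bigr _ (fun i _ => E i)) big_split /= sumrB.
rewrite [X in _ + X](_ : _ = 0) ?addr0; last first.
  rewrite (eq_bigr (fun i => m * (ep i * ip (v (ta i)) (mult d (z i) (zx i))) +
     m * (ep i * ip (v i) (mult d (z (ta i)) (zx (ta i)))))); last first.
    move=> i _; have := mult_skew d0 (Sv i) (Sz (ta i)) => /eqP.
    by rewrite addr_eq0 => /eqP ->; ring.
  rewrite big_split /= [X in _ + X]sum_ta -big_split /= big1 // => i _.
  by rewrite ep_ta taK; ring.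
rewrite [X in _ - X]sum_sg -sumrB; apply: eq_bigr => i _.
rewrite sgK kap_sg -(mult_bilinear d0 d4 (kap k i) (Sv (sg i)) (Sz i)); congr (_ - _).
by apply: ip_ext => r _; rewrite !mulNr.
Qed.

(** The part without mass is [comm_coercive] for each component. The mass terms are paired by
    exchanging [i] with [ta (sg i)], and each pair cancels by [comm_mass]. *)
Lemma dirac_comm_coercive v vx : (forall j, sob (v j) (vx j)) ->
  \sum_i ip (dirac v vx (sg i)) (comm d (kap k i) (v i) (vx i))
  <= - (3 / 64) * \sum_i \int[mu]_(r in D) dens d (v i) (vx i) r.
Proof.
move=> Sv.
have Lv j : L2 (v j) by case: (Sv j).
have Lvx j : L2 (vx j) by case: (Sv j).
have Lc i := L2_comm d0 d4 (kap k i) (Sv i).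
have L1 i := L2B (Lvx i) (L2_potential (kap k i) (Sv i)).
have E i : ip (dirac v vx (sg i)) (comm d (kap k i) (v i) (vx i))
  = ip (fun r => vx i r - kap k i / r * v i r) (comm d (kap k i) (v i) (vx i))
    + m * (ep (sg i) * ip (v (ta (sg i))) (comm d (kap k i) (v i) (vx i))).
  rewrite mulrA -ipZl // -ipDl //; last exact: L2Z.
  by apply: ip_ext => r _; rewrite /dirac sgK kap_sg !mulNr.
rewrite (eq_bigr _ (fun i _ => E i)) big_split /= -mulr_sumr.
rewrite [X in m * X](_ : _ = 0); last first.
  set S := \sum_i _.
  have inj : injective (fun i => ta (sg i)) by move=> i j /(can_inj taK)/(can_inj sgK).
  have S2 : S = \sum_i (ep (sg i) * ip (v i) (comm d (- kap k i) (v (ta (sg i))) (vx (ta (sg i))))).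
    rewrite /S (reindex_inj inj) /=; apply: eq_bigr => i _.
    have -> : ta (sg (ta (sg i))) = i by case: i => [[] []].
    have -> : ep (sg (ta (sg i))) = ep (sg i) by case: i => [[] []].
    by rewrite kap_ta kap_sg.
  have : S + S = 0.
    rewrite {2}S2 /S -big_split /= big1 // => i _.
    by rewrite -mulrDr (comm_mass d0 d4) // mulr0.
  by move=> /eqP; rewrite -mulr2n mulrn_eq0 => /eqP.
rewrite mulr0 addr0 mulr_sumr; apply: ler_sum => i _.
exact: comm_coercive.
Qed.

Lemma dirac_graph_coercive v vx i : sob (v i) (vx i) ->
  nrm (vx i) ^+ 2 + 3 / 4 * nrm (fun r => v i r / r) ^+ 2
   <= nrm (fun r => vx i r + kap k (sg i) / r * v i r) ^+ 2.
Proof. exact: nrm_sob_coercive. Qed.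

Lemma loc_flux (f fx g gx : R -> R) : sob f fx -> sob g gx ->
  ip (fun r => wgt 3 r * f r) gx + ip (fun r => wgt 3 r * g r) fx
  = - ip (fun r => wgt1 3 r * f r) g.
Proof.
move=> Sf Sg; have [Pf Lf Lfx _] := Sf; have [Pg Lg Lgx _] := Sg.
have p3 : 0 < 3 :> R by [].
have xr r : 0 < r -> 0 <= r^-1 by move=> r0; rewrite invr_ge0 ltW.
have b0 r : 0 < r -> `|wgt 3 r| <= 1 by move=> r0; rewrite gtr0_norm ?wgt_gt0 // wgt_le1.
have b1 r : 0 < r -> `|wgt1 3 r| <= 4.
  move=> r0; have h : 0 < 1 + r by rewrite addr_gt0.
  rewrite wgt1E // !normrM normrN (gtr0_norm (x := (1 + r)^-1)) ?invr_gt0 //.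
  rewrite ler_pdivrMr // -[leRHS]mulr1 -mulrA; apply: ler_pM => //.
    by rewrite ger0_norm ?addr_ge0 //; lra.
  by apply: (le_trans (b0 r r0)); rewrite mulr1 lerDl ltW.
have [IZ Z] : itg D (fun r => wgt1 3 r * (f r * g r) + wgt 3 r * (fx r * g r + f r * gx r)) /\
  \int[mu]_(r in D) (wgt1 3 r * (f r * g r) + wgt 3 r * (fx r * g r + f r * gx r)) = 0.
  apply: (sob_ibp (K := 4) (primitive_wgt 3)) => // r r0.
    have [h1 _] := le_1DX (xr r r0).
    by apply: (le_trans (b0 r r0)); rewrite -[leLHS]mulr1 ler_pM // ler1n.
  have [_ [_ [h1 _]]] := le_1DX (xr r r0).
  by apply: (le_trans (b1 r r0)); rewrite -[leLHS]mulr1 ler_pM // ler1n.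
have Lw h : L2 h -> L2 (fun r => wgt 3 r * h r).
  exact: (L2_bounded_mul (primitive_measurable (primitive_wgt 3)) b0).
have Lw1 h : L2 h -> L2 (fun r => wgt1 3 r * h r).
  exact: (L2_bounded_mul (primitive_measurable (primitive_wgt1 3)) b1).
apply/eqP; rewrite -addr_eq0; apply/eqP; rewrite /ip.
have I1 := L2_itgM (Lw _ Lf) Lgx; have I2 := L2_itgM (Lw _ Lg) Lfx.
have I3 := L2_itgM (Lw1 _ Lf) Lg.
rewrite -RintD // -RintD //; last exact: itgD.
by rewrite -[RHS]Z; apply: Rint_ext => r _; ring.
Qed.

(** The terms with k / r and with [m] cancel under [sg] and [ta], since [kap] and [ep] are odd, and
    integration by parts leaves only the derivative of the weight. The linear rate of change of the
    local mass therefore contains no derivative of [v]. *)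
Lemma dirac_flux v vx : (forall j, sob (v j) (vx j)) ->
  2 * \sum_i ip (fun r => wgt 3 r * v i r) (dirac v vx i)
  = - \sum_i ip (fun r => wgt1 3 r * v i r) (v (sg i)).
Proof.
move=> Sv.
have Lv j : L2 (v j) by case: (Sv j).
have Lvx j : L2 (vx j) by case: (Sv j).
have p3 : 0 < 3 :> R by [].
have b0 r : 0 < r -> `|wgt 3 r| <= 1 by move=> r0; rewrite gtr0_norm ?wgt_gt0 // wgt_le1.
have Lw j : L2 (fun r => wgt 3 r * v j r).
  exact: (L2_bounded_mul (primitive_measurable (primitive_wgt 3)) b0).
have Lp i := L2_potential (kap k i) (Sv (sg i)).
have anti (f : comp -> R) (s : comp -> comp) : injective s -> (forall i, f (s i) = - f i) ->
    \sum_i f i = 0.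
  move=> inj H; set S := \sum_i _.
  have : S + S = 0.
    by rewrite {2}/S (reindex_inj inj) /= -big_split /= big1 // => i _; rewrite H subrr.
  by move=> /eqP; rewrite -mulr2n mulrn_eq0 => /eqP.
have E i : ip (fun r => wgt 3 r * v i r) (dirac v vx i) =
   ip (fun r => wgt 3 r * v i r) (vx (sg i)) +
   ip (fun r => wgt 3 r * v i r) (fun r => kap k i / r * v (sg i) r)
   + m * (ep i * ip (fun r => wgt 3 r * v i r) (v (ta i))).
  rewrite ipC ip_dirac // ipDl // !(ipC _ (fun r => wgt 3 r * v i r)).
  by rewrite mulrA.
rewrite (eq_bigr _ (fun i _ => E i)) !big_split /= -mulr_sumr.
rewrite [X in _ + m * X](anti _ ta); last 2 first.
- exact: (can_inj taK).
- move=> i; rewrite ep_ta taK mulNr; congr (- (_ * _)).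
  by apply: ip_ext => r _; ring.
rewrite mulr0 addr0 [X in _ + X](anti _ sg); last 2 first.
- exact: (can_inj sgK).
- move=> i; rewrite kap_sg sgK -ipNl //; apply: ip_ext => r _; ring.
rewrite addr0 mulr_natl mulr2n {2}sum_sg -big_split /= -sumrN.
by apply: eq_bigr => i _; rewrite sgK loc_flux.
Qed.

End Components.

(** * Sums of L^2 functions and a mean value inequality in L^2 *)

Section NormTools.
Context {R : realType}.
Notation mu := (@lebesgue_measure R).
Local Notation D := (`]0, +oo[%classic : set R).
Implicit Types (f g : R -> R) (r : R).

Lemma nrm_norm f : nrm (fun r => `|f r|) = nrm f.
Proof. by congr Num.sqrt; apply: Rint_ext => r _; rewrite real_normK ?num_real. Qed.

Lemma nrm_sum (I : Type) (s : seq I) (f : I -> R -> R) : (forall i, L2 (f i)) ->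
  nrm (fun r => \sum_(i <- s) f i r) <= \sum_(i <- s) nrm (f i).
Proof.
move=> Lf; elim: s => [|i s IH].
  rewrite big_nil (@nrm_ext _ _ (fun r => 0 * 0)) => [|r _]; last by rewrite big_nil mulr0.
  by rewrite (@nrmZ _ 0 (fun=> 0)) ?normr0 ?mul0r //; exact: L2_0.
rewrite big_cons (@nrm_ext _ _ (fun r => f i r + \sum_(j <- s) f j r)); last first.
  by move=> r _; rewrite big_cons.
apply: (le_trans (nrmD _ _)) => //; first exact: L2_sum.
by rewrite lerD2l.
Qed.

Lemma ip_sumr (I : Type) (s : seq I) (f : I -> R -> R) g : L2 g -> (forall i, L2 (f i)) ->
  ip g (fun r => \sum_(i <- s) f i r) = \sum_(i <- s) ip g (f i).
Proof.
move=> Lg Lf; elim: s => [|i s IH].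
  rewrite big_nil -[RHS](mul0r (ip (fun=> 0) g)) -ipZl //; last exact: L2_0.
  by rewrite ipC; apply: ip_ext => r _; rewrite big_nil mulr0 mul0r.
rewrite big_cons -IH -ipDr //; last exact: L2_sum.
by apply: ip_ext => r _; rewrite big_cons.
Qed.

Lemma sum_comp (V : zmodType) (f : comp -> V) :
  \sum_i f i = f (false, false) + f (false, true) + f (true, false) + f (true, true).
Proof.
rewrite (eq_bigr (fun p => (fun a b => f (a, b)) p.1 p.2)) => [|[a b] _ //].
rewrite -(pair_bigA _ (fun a b => f (a, b))) /= !big_bool /=.
by rewrite addrC [f (false, true) + _]addrC [f (true, true) + _]addrC addrA.
Qed.

Lemma sum_comp_sqr (f : comp -> R) : (\sum_i f i) ^+ 2 <= 4 * \sum_i f i ^+ 2.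
Proof.
rewrite !sum_comp; set a := f _; set b := f _; set c := f _; set e := f _.
rewrite -subr_ge0 (_ : _ - _ = (a - b) ^+ 2 + (a - c) ^+ 2 + (a - e) ^+ 2 + (b - c) ^+ 2
  + (b - e) ^+ 2 + (c - e) ^+ 2); last by ring.
by rewrite !addr_ge0 // sqr_ge0.
Qed.

Lemma le_sum_comp (f : comp -> R) i : (forall j, 0 <= f j) -> f i <= \sum_j f j.
Proof. by move=> f0; rewrite (bigD1 i) //= lerDl sumr_ge0. Qed.

Lemma slope_ip (f : R -> R -> R) t f' g : (forall s, L2 (f s)) -> L2 f' -> L2 g ->
  nrm (fun r => h^-1 * (f (t + h) r - f t r) - f' r) @[h --> 0^'] --> 0 ->
  slope_limit (fun s => ip (f s) g) t (ip f' g).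
Proof.
move=> Lf Lf' Lg H.
have Lq h : L2 (fun r => h^-1 * (f (t + h) r - f t r)) by apply: L2Z; exact: L2B.
rewrite /slope_limit.
rewrite (_ : (fun h => _) = (fun h => ip (fun r => h^-1 * (f (t + h) r - f t r)) g)).
  apply: ip_cvg => //.
  rewrite (_ : (fun=> _) = (fun=> 0)); first exact: cvg_cst.
  apply/funext => h; rewrite (@nrm_ext _ _ (fun r => 0 * g r)) ?nrmZ ?normr0 ?mul0r //.
  by move=> r _; rewrite subrr mul0r.
apply/funext => h; rewrite ipZl ?ipBl //; exact: L2B.
Qed.

(** The function [w] whose norm is to be bounded is itself the test function. This reduces the claim
    to the scalar function t -> ip (f t) w - t * ip f0 w, whose slope is at most e |w|. *)
Lemma slope_nrm_le (f f1 : R -> R -> R) f0 a b e : a < b -> 0 <= e ->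
  (forall s, L2 (f s)) -> (forall s, L2 (f1 s)) -> L2 f0 ->
  (forall t, a <= t <= b ->
     nrm (fun r => h^-1 * (f (t + h) r - f t r) - f1 t r) @[h --> 0^'] --> 0) ->
  (forall t, a <= t <= b -> nrm (fun r => f1 t r - f0 r) <= e) ->
  nrm (fun r => (b - a)^-1 * (f b r - f a r) - f0 r) <= e.
Proof.
move=> ab e0 Lf Lf1 Lf0 df He.
set w := fun r => _; have ba : 0 < b - a by rewrite subr_gt0.
have Lw : L2 w by apply: L2B => //; apply: L2Z; exact: L2B.
have H : (ip (f b) w - b * ip f0 w) - (ip (f a) w - a * ip f0 w) <= (e * nrm w) * (b - a).
  apply: (@slope_limit_bound _ (fun t => ip (f t) w - t * ip f0 w)); first exact: ltW.
  move=> t tab.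
  exists (ip (f1 t) w - ip f0 w).
    apply: slope_limitD; first exact: slope_ip (df t tab).
    rewrite /slope_limit; apply: (@cvg_trans _ ((fun=> - ip f0 w) @ 0^')).
      apply: near_eq_cvg; near=> h.
      have h0 : h != 0 by near: h; exact: nbhs_dnbhs_neq.
      by field.
    exact: cvg_cst.
  rewrite -ipBl //; apply: (le_trans (ler_norm _)).
  apply: (le_trans (ip_bound _ _)) => //; first exact: L2B.
  by rewrite ler_wpM2r ?nrm_ge0 // He.
have E : (ip (f b) w - b * ip f0 w) - (ip (f a) w - a * ip f0 w) = nrm w ^+ 2 * (b - a).
  rewrite -ipff /w ipBl ?ipZl ?ipBl //; try exact: L2B; last by apply: L2Z; exact: L2B.
  by field; rewrite gt_eqF.
rewrite E ler_pM2r // expr2 in H.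
have [w0|w0] := eqVneq (nrm w) 0; first by rewrite w0.
by rewrite ler_pM2r // lt_neqAle eq_sym w0 nrm_ge0 in H.
Unshelve. all: by end_near. Qed.

Lemma nrm_cvg_le (T : Type) (G : set_system T) (FG : Filter G) (f : T -> R -> R) (b : T -> R) :
  (\forall t \near G, nrm (f t) <= b t) -> b t @[t --> G] --> 0 ->
  nrm (f t) @[t --> G] --> 0.
Proof.
move=> fb b0; apply: (squeeze_cvgr (f := fun=> 0) (h := b)) => //; last exact: cvg_cst.
by apply: filterS fb => t ->; rewrite nrm_ge0.
Qed.

End NormTools.

(** * Decay of the local mass for an abstract half-line system *)

Section Core.
Context {R : realType}.
Notation mu := (@lebesgue_measure R).
Local Notation D := (`]0, +oo[%classic : set R).
Variables (d k m eta : R).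
Hypothesis d0 : 0 < d.
Hypothesis d4 : d <= 1 / 4.
Hypothesis k1 : 3 / 4 <= k ^+ 2 - k.
Hypothesis k2 : 3 / 4 <= k ^+ 2 + k.

Let d1 : d <= 1.
Proof. by apply: (le_trans d4); rewrite ler_pdivrMr // mul1r ler1n. Qed.

(** [theta] bounds the nonlinearity relative to [u]. [thetaw] is what is required against
    first-order quantities; [thetam] supplies the additional factor r where m u appears, and is
    trivial for m = 0. *)
Variable theta : R -> R.
Hypothesis mtheta : measurable_fun D theta.
Hypothesis theta0 : forall r, 0 < r -> 0 <= theta r.
Hypothesis thetaw : forall r, 0 < r -> theta r <= eta * wgt d r.
Hypothesis thetam : forall r, 0 < r -> `|m| * theta r <= eta * wgt d r / r.
Hypothesis eta0 : 0 <= eta.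
Hypothesis eta1 : eta <= 1.

Variables u ux F Fx : R -> comp -> R -> R.
Hypothesis Su : forall t i, sob (u t i) (ux t i).
Hypothesis SF : forall t i, sob (F t i) (Fx t i).
Hypothesis FB : forall s t i r, 0 < r ->
  `|F s i r - F t i r| <= theta r * \sum_j `|u s j r - u t j r|.
Hypothesis F0 : forall t i r, 0 < r -> `|F t i r| <= theta r * \sum_j `|u t j r|.
Hypothesis Fx0 : forall t i r, 0 < r ->
  `|Fx t i r| <= theta r * \sum_j (`|ux t j r| + `|u t j r / r|).

(** The right-hand side of the equation, available for every t and r; [du] states that at positive
    times it is the time derivative of [u] in L^2. *)
Definition ut t i r := dirac k m (u t) (ux t) i r + F t i r.

Hypothesis du : forall t i, 0 < t ->
  nrm (fun r => h^-1 * (u (t + h) i r - u t i r) - ut t i r) @[h --> 0^'] --> 0.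
Hypothesis cut : forall t i, 0 < t ->
  nrm (fun r => ut s i r - ut t i r) @[s --> t] --> 0.

Let Lu t i : L2 (u t i). Proof. by case: (Su t i). Qed.
Let Lux t i : L2 (ux t i). Proof. by case: (Su t i). Qed.
Let Lur t i : L2 (fun r => u t i r / r). Proof. by case: (Su t i). Qed.
Let LF t i : L2 (F t i). Proof. by case: (SF t i). Qed.
Let Lut t i : L2 (ut t i).
Proof. by apply: L2D => //; exact: L2_dirac. Qed.

Let rw1 r : 0 < r -> theta r <= 1.
Proof.
move=> r0; apply: (le_trans (thetaw r0)); rewrite -[leRHS]mulr1.
by apply: ler_pM => //; [exact/ltW/wgt_gt0|exact: wgt_le1].
Qed.

Let thetar r : 0 < r -> r * theta r <= eta.
Proof.
move=> r0; apply: (@le_trans _ _ (r * (eta * wgt d r))); first by rewrite ler_pM2l // thetaw.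
by rewrite mulrCA -[leRHS]mulr1 ler_wpM2l // wgt_r_le1.
Qed.

(** A convergent difference quotient is bounded near h = 0, which bounds the increment by a multiple
    of |s - t|. *)
Let cont_u t i : 0 < t -> nrm (fun r => u s i r - u t i r) @[s --> t] --> 0.
Proof.
move=> t0; have /cvgrPdist_le/(_ _ ltr01)[dl /= dl0 H] := du i t0.
set C := 1 + nrm (ut t i).
apply: (@nrm_cvg_le _ _ _ _ _ (fun s => `|s - t| * C)).
  exists dl => // s /= st; rewrite distrC in st.
  have [->|st0] := eqVneq s t.
    rewrite subrr normr0 mul0r (@nrm_ext _ _ (fun r => 0 * u t i r)); last first.
      by move=> r _; rewrite subrr mul0r.
    by rewrite nrmZ // normr0 mul0r.
  have h0 : s - t != 0 by rewrite subr_eq0.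
  have := H (s - t); rewrite /= !sub0r !normrN => /(_ st h0).
  rewrite ger0_norm ?nrm_ge0 // (_ : t + (s - t) = s); last by rewrite addrC subrK.
  move=> Hq.
  have Lq : L2 (fun r => (s - t)^-1 * (u s i r - u t i r)) by apply: L2Z; exact: L2B.
  rewrite (@nrm_ext _ _ (fun r => (s - t) * ((s - t)^-1 * (u s i r - u t i r)))); last first.
    by move=> r _; rewrite mulrA divff // mul1r.
  rewrite nrmZ // ler_wpM2l //.
  rewrite (@nrm_ext _ _ (fun r => ((s - t)^-1 * (u s i r - u t i r) - ut t i r) + ut t i r)); last first.
    by move=> r _; rewrite subrK.
  apply: (le_trans (nrmD _ _)) => //; first exact: L2B.
  by rewrite lerD2r.
rewrite -[X in _ --> X](mul0r C); apply: cvgM; last exact: cvg_cst.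
apply/norm_cvg0P; rewrite -[X in _ --> X](subrr t).
by apply: cvgB; [exact: cvg_id|exact: cvg_cst].
Qed.

Let sum_cvg0 (t : R) (f : comp -> R -> R) : (forall i, f i s @[s --> t] --> (0 : R)) ->
  \sum_i f i s @[s --> t] --> (0 : R).
Proof.
move=> H; rewrite (_ : (fun s => _) = (fun s => f (false, false) s + f (false, true) s +
  f (true, false) s + f (true, true) s)); last by apply/funext => s; rewrite sum_comp.
rewrite -[X in _ --> X](_ : 0 + 0 + 0 + 0 = 0); last by rewrite !addr0.
by do ![apply: cvgD => //].
Qed.

Let cont_F t i : 0 < t -> nrm (fun r => F s i r - F t i r) @[s --> t] --> 0.
Proof.
move=> t0; apply: (@nrm_cvg_le _ _ _ _ _ (fun s => \sum_j nrm (fun r => u s j r - u t j r))).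
  apply: nearW => s.
  have Ln j : L2 (fun r => `|u s j r - u t j r|) by apply: L2_norm; exact: L2B.
  have E j : nrm (fun r => u s j r - u t j r) = nrm (fun r => `|u s j r - u t j r|).
    by rewrite nrm_norm.
  rewrite (eq_bigr _ (fun j _ => E j)); apply: le_trans (nrm_sum _ Ln).
  rewrite -[leRHS]mul1r; apply: nrm_le => //.
  - by have [] := L2B (LF s i) (LF t i).
  - move=> r r0; rewrite mul1r (ger0_norm (x := \sum_j _)) ?sumr_ge0 //.
    apply: (le_trans (FB _ _ _ r0)); rewrite -[leRHS]mul1r.
    by rewrite ler_wpM2r ?sumr_ge0 // rw1.
  - exact: L2_sum.
by apply: sum_cvg0 => j; exact: cont_u.
Qed.

(** The part of [dirac] that acts on the single component [i]. By the equation it is [ut] minus mass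
    and nonlinear terms, whose continuity in time is known. *)
Let graph t i r := ux t i r + kap k (sg i) / r * u t i r.

Let graphE t i r : graph t i r =
  ut t (sg i) r - m * ep (sg i) * u t (ta (sg i)) r - F t (sg i) r.
Proof. by rewrite /graph /ut /dirac sgK; ring. Qed.

Let cont_graph t i : 0 < t -> nrm (fun r => graph s i r - graph t i r) @[s --> t] --> 0.
Proof.
move=> t0; apply: (@nrm_cvg_le _ _ _ _ _ (fun s => nrm (fun r => ut s (sg i) r - ut t (sg i) r)
   + `|m| * nrm (fun r => u s (ta (sg i)) r - u t (ta (sg i)) r)
   + nrm (fun r => F s (sg i) r - F t (sg i) r))).
  apply: nearW => s.
  have L1 := L2B (Lut s (sg i)) (Lut t (sg i)).
  have L2' := L2B (Lu s (ta (sg i))) (Lu t (ta (sg i))).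
  have L3 := L2B (LF s (sg i)) (LF t (sg i)).
  rewrite (@nrm_ext _ _ (fun r => (ut s (sg i) r - ut t (sg i) r)
     + (- (m * ep (sg i))) * (u s (ta (sg i)) r - u t (ta (sg i)) r)
     + (-1) * (F s (sg i) r - F t (sg i) r))); last first.
    by move=> r _; rewrite !graphE; ring.
  apply: (le_trans (nrmD _ _)); [by apply: L2D => //; exact: L2Z|exact: L2Z|].
  rewrite nrmZ // normrN normr1 mul1r lerD2r.
  apply: (le_trans (nrmD _ _)) => //; first exact: L2Z.
  by rewrite nrmZ // normrN normrM ep_norm mulr1.
rewrite -[X in _ --> X](_ : 0 + `|m| * 0 + 0 = 0); last by rewrite mulr0 !addr0.
apply: cvgD; last exact: cont_F.
apply: cvgD; first exact: cut.
by apply: cvgM; [exact: cvg_cst|exact: cont_u].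
Qed.

(** Coercivity of d/dr + kap / r turns the continuity of [graph] into that of [ux] and of u / r
    separately. *)
Let cont_X t i : 0 < t -> nrm (fun r => ux s i r - ux t i r) @[s --> t] --> 0 /\
  nrm (fun r => u s i r / r - u t i r / r) @[s --> t] --> 0.
Proof.
move=> t0.
have key s : nrm (fun r => ux s i r - ux t i r) ^+ 2 +
   3 / 4 * nrm (fun r => u s i r / r - u t i r / r) ^+ 2
   <= nrm (fun r => graph s i r - graph t i r) ^+ 2.
  have S := sobB (Su s i) (Su t i).
  have := dirac_graph_coercive k1 k2 (v := fun j r => u s j r - u t j r)
    (vx := fun j r => ux s j r - ux t j r) S.
  rewrite (@nrm_ext _ (fun r => (u s i r - u t i r) / r) (fun r => u s i r / r - u t i r / r)); last first.
    by move=> r _; rewrite mulrBl.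
  rewrite (@nrm_ext _ (fun r => _ + _ * _) (fun r => graph s i r - graph t i r)) // => r _.
  by rewrite /graph; ring.
split.
  apply: nrm_cvg_le (cont_graph i t0); apply: nearW => s.
  rewrite -(@ler_pXn2r _ 2) ?nnegrE ?nrm_ge0 //; apply: le_trans (key s).
  by rewrite lerDl mulr_ge0 ?divr_ge0 ?sqr_ge0.
apply: (@nrm_cvg_le _ _ _ _ _ (fun s => 2 * nrm (fun r => graph s i r - graph t i r))).
  apply: nearW => s.
  rewrite -(@ler_pXn2r _ 2) ?nnegrE ?mulr_ge0 ?nrm_ge0 // exprMn.
  have := key s.
  have := sqr_ge0 (nrm (fun r => ux s i r - ux t i r)).
  have := sqr_ge0 (nrm (fun r => u s i r / r - u t i r / r)).
  set a := nrm _ ^+ 2; set b := nrm _ ^+ 2; set c := nrm _ ^+ 2; lra.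
rewrite -[X in _ --> X](mulr0 2); apply: cvgM; [exact: cvg_cst|exact: cont_graph].
Qed.

Local Notation A t i := (mult d (u t i) (ux t i)).
Local Notation C t i := (comm d (kap k i) (u t i) (ux t i)).

Let LA t i : L2 (A t i). Proof. exact: L2_mult. Qed.
Let LC t i : L2 (C t i). Proof. exact: L2_comm. Qed.

(** A common pointwise majorant: u, A u, the commutator and [F] are all estimated by [N] times
    weights and powers of r. *)
Let N t r := \sum_j (`|ux t j r| + `|u t j r / r|).

Let LN t : L2 (N t).
Proof. by apply: L2_sum => j; apply: L2D; exact: L2_norm. Qed.

Let N_ge0 t r : 0 <= N t r.
Proof. by apply: sumr_ge0 => j _; rewrite addr_ge0. Qed.

Let thetaN t r := theta r * N t r.

Let LthetaN t : L2 (thetaN t).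
Proof.
apply: (L2_bounded_mul mtheta (K := 1)) => // r r0.
by rewrite ger0_norm ?theta0 // rw1.
Qed.

Let nrm_mult (f fx : R -> R) : sob f fx -> nrm (mult d f fx) <= d^-1 * nrm fx + nrm f.
Proof.
case=> _ Lf Lfx _.
have mc := primitive_measurable (primitive_chi d0).
have mw := primitive_measurable (primitive_wgt d).
have Xc r : 0 < r -> `|chi d r| <= d^-1 by move=> r0; rewrite gtr0_norm ?chi_gt0 // chi_le_cst.
have b2 r : 0 < r -> `|wgt d r / 2| <= 1.
  move=> r0; rewrite normrM (gtr0_norm (x := 2^-1)) // ler_pdivrMr //.
  by apply: (le_trans (wgt_norm_le1 d0 r0)); rewrite mul1r ler1n.
have mw2 : measurable_fun D (fun r => wgt d r / 2) by exact: measurable_funM.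
have L1 := L2_bounded_mul mc Xc Lfx; have L2' := L2_bounded_mul mw2 b2 Lf.
rewrite (@nrm_ext _ _ (fun r => chi d r * fx r + wgt d r / 2 * f r)); last first.
  by move=> r _; rewrite /mult; ring.
apply: (le_trans (nrmD L1 L2')); apply: lerD.
  apply: nrm_le => //; [by rewrite invr_ge0 ltW|by case: L1|].
  by move=> r r0; rewrite normrM ler_wpM2r // Xc.
rewrite -[leRHS]mul1r; apply: nrm_le => //; first by case: L2'.
by move=> r r0; rewrite normrM ler_wpM2r // b2.
Qed.

Let kap_norm i : `|kap k i| = `|k|.
Proof. by rewrite /kap; case: i.2; rewrite ?normrN. Qed.

Let nrm_comm i (f fx : R -> R) : sob f fx ->
  nrm (comm d (kap k i) f fx) <= nrm fx + (1 + `|k|) * nrm (fun r => f r / r).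
Proof.
move=> Sf; have [_ Lf Lfx Lfr] := Sf; have Lc := L2_comm d0 d4 (kap k i) Sf.
have La := L2_norm Lfx; have Lb := L2Z (1 + `|k|) (L2_norm Lfr).
apply: (@le_trans _ _ (nrm (fun r => `|fx r| + (1 + `|k|) * `|f r / r|))).
  rewrite -[leRHS]mul1r; apply: nrm_le; rewrite ?ler01 //.
  - by case: Lc.
  - move=> r r0; rewrite mul1r [leRHS]ger0_norm ?addr_ge0 ?mulr_ge0 ?addr_ge0 //.
    rewrite /comm normrN; apply: (le_trans (ler_normB _ _)).
    rewrite mulrDl mul1r addrA; apply: lerD; last first.
      rewrite (_ : _ * chi d r * f r = kap k i * ((chi d r / r) * (f r / r))); last first.
        by field; rewrite gt_eqF.
      rewrite normrM kap_norm ler_wpM2l // normrM -[leRHS]mul1r ler_wpM2r //.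
      rewrite normrM (gtr0_norm (x := r^-1)) ?invr_gt0 // ler_pdivrMr // mul1r.
      exact: chi_norm_le.
    apply: (le_trans (ler_normD _ _)); apply: lerD.
      by rewrite normrM -[leRHS]mul1r ler_wpM2r // (wgt_norm_le1 d0).
    rewrite (_ : wgt1 d r * f r / 2 = (r * wgt1 d r / 2) * (f r / r)); last first.
      by field; rewrite gt_eqF.
    rewrite normrM -[leRHS]mul1r ler_wpM2r // normrM (gtr0_norm (x := 2^-1)) //.
    rewrite ler_pdivrMr // mul1r normrM (gtr0_norm r0).
    apply: (le_trans (wgt1_bound d0 r0 d1)).
    by rewrite -[leRHS]mulr1 ler_wpM2l // wgt_le1.
  - exact: L2D.
apply: (le_trans (nrmD La Lb)).
by rewrite (nrmZ _ (L2_norm Lfr)) !nrm_norm (ger0_norm (x := 1 + `|k|)) ?addr_ge0.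
Qed.

Let multB s t i r : A s i r - A t i r =
  mult d (fun r => u s i r - u t i r) (fun r => ux s i r - ux t i r) r.
Proof. by rewrite /mult; ring. Qed.

Let commB s t i r : C s i r - C t i r =
  comm d (kap k i) (fun r => u s i r - u t i r) (fun r => ux s i r - ux t i r) r.
Proof. by rewrite /comm; ring. Qed.

Let cvgZ0 (T : Type) (G : set_system T) (FG : Filter G) c (f : T -> R) :
  f x @[x --> G] --> 0 -> c * f x @[x --> G] --> 0.
Proof. by move=> H; rewrite -[X in _ --> X](mulr0 c); apply: cvgM => //; exact: cvg_cst. Qed.

Let cvgD0 (T : Type) (G : set_system T) (FG : Filter G) (f g : T -> R) :
  f x @[x --> G] --> 0 -> g x @[x --> G] --> 0 -> f x + g x @[x --> G] --> 0.
Proof. by move=> H1 H2; rewrite -[X in _ --> X](addr0 0); exact: cvgD. Qed.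

Let cont_A t i : 0 < t -> nrm (fun r => A s i r - A t i r) @[s --> t] --> 0.
Proof.
move=> t0; have [cx cr] := cont_X i t0; have c0 := cont_u i t0.
apply: (@nrm_cvg_le _ _ _ _ _ (fun s => d^-1 * nrm (fun r => ux s i r - ux t i r)
   + nrm (fun r => u s i r - u t i r))).
  apply: nearW => s; apply: le_trans (nrm_mult (sobB (Su s i) (Su t i))).
  by rewrite le_eqVlt; apply/orP; left; apply/eqP; apply: nrm_ext => r _; exact: multB.
by apply: cvgD0 => //; exact: cvgZ0.
Qed.

Let cont_C t i : 0 < t -> nrm (fun r => C s i r - C t i r) @[s --> t] --> 0.
Proof.
move=> t0; have [cx cr] := cont_X i t0.
apply: (@nrm_cvg_le _ _ _ _ _ (fun s => nrm (fun r => ux s i r - ux t i r)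
   + (1 + `|k|) * nrm (fun r => u s i r / r - u t i r / r))).
  apply: nearW => s.
  rewrite (_ : nrm (fun r => u s i r / r - u t i r / r) = nrm (fun r => (u s i r - u t i r) / r));
    last by apply: nrm_ext => r _; rewrite mulrBl.
  apply: le_trans (nrm_comm i (sobB (Su s i) (Su t i))).
  by rewrite le_eqVlt; apply/orP; left; apply/eqP; apply: nrm_ext => r _; exact: commB.
by apply: cvgD0 => //; exact: cvgZ0.
Qed.

Let cont_thetaN t : 0 < t -> nrm (fun r => thetaN s r - thetaN t r) @[s --> t] --> 0.
Proof.
move=> t0.
apply: (@nrm_cvg_le _ _ _ _ _ (fun s => \sum_j (nrm (fun r => ux s j r - ux t j r)
   + nrm (fun r => u s j r / r - u t j r / r)))).
  apply: nearW => s.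
  have L1 j := L2_norm (L2B (Lux s j) (Lux t j)).
  have L2' j := L2_norm (L2B (Lur s j) (Lur t j)).
  apply: (@le_trans _ _ (\sum_j nrm (fun r => `|ux s j r - ux t j r| + `|u s j r / r - u t j r / r|))).
    apply: le_trans (nrm_sum _ (fun j => L2D (L1 j) (L2' j))).
    rewrite -[leRHS]mul1r; apply: nrm_le => //.
    - by have [] := L2B (LthetaN s) (LthetaN t).
    - move=> r r0; rewrite mul1r (ger0_norm (x := \sum_j _)); last first.
        by apply: sumr_ge0 => j _; rewrite addr_ge0.
      rewrite /thetaN -mulrBr normrM -[leRHS]mul1r; apply: ler_pM => //.
        by rewrite ger0_norm ?theta0 // rw1.
      rewrite /N -sumrB; apply: (le_trans (ler_norm_sum _ _ _)); apply: ler_sum => j _.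
      rewrite opprD addrACA; apply: (le_trans (ler_normD _ _)).
      by apply: lerD; exact: ler_dist_dist.
    - by apply: L2_sum => j; exact: L2D.
  apply: ler_sum => j _; apply: (le_trans (nrmD (L1 j) (L2' j))).
  by rewrite !nrm_norm.
apply: (sum_cvg0 (f := fun j s => _)) => j; have [cx cr] := cont_X j t0.
exact: cvgD0.
Qed.

Let q t h i r := h^-1 * (u (t + h) i r - u t i r).

Let Lq t h i : L2 (q t h i). Proof. by apply: L2Z; exact: L2B. Qed.

(** The limit is joint in base time and step, because the slope of [Kt h] has to be controlled at
    all times near [t0] for all small h at once. It is [slope_nrm_le] on the interval from t to t +
    h, where [ut] is close to its value at [t0]. *)
Let q_lim t0 i : 0 < t0 ->
  nrm (fun r => q x.1 x.2 i r - ut t0 i r) @[x --> filter_prod (nbhs t0) (0^'+)] --> 0.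
Proof.
move=> t00; apply/cvgrPdist_le => e e0.
have /cvgrPdist_le/(_ _ e0)[dl /= dl0 H] := cut i t00.
(* Half of [dl] for the time and half for the step keep the whole interval within [dl] of [t0]; the
   bound t0 / 2 keeps it at positive times. *)
pose dm := Num.min (dl / 2) (t0 / 2).
have dm0 : 0 < dm by rewrite lt_min !divr_gt0.
exists (ball t0 dm, [set h | 0 < h < dm]) => /=.
  split; first exact: nbhsx_ballx.
  near=> h; apply/andP; split; first by near: h; exact: nbhs_right_gt.
  by near: h; exact: nbhs_right_lt.
move=> [t h] [/= tt0 /andP[h0 hd]].
rewrite sub0r normrN ger0_norm ?nrm_ge0 //.
have := tt0; rewrite /ball /= lt_min ltr_norml => /andP[/andP[a1 a2] ].
rewrite ltr_norml => /andP[a3 a4].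
have := hd; rewrite lt_min => /andP[h1 h2].
have := @slope_nrm_le R (fun t => u t i) (fun t => ut t i) (ut t0 i) t (t + h) e.
rewrite [t + h - t]addrAC subrr add0r; apply => //.
- by rewrite ltrDl.
- exact: ltW.
- move=> s /andP[ts sth]; apply: du; apply: lt_le_trans ts.
  by move: a3 a4 t00; lra.
- move=> s /andP[ts sth].
  have := H s; rewrite /= sub0r normrN (ger0_norm (x := nrm _)) ?nrm_ge0 //; apply.
  by rewrite ltr_norml; apply/andP; split; move: ts sth a1 a2 h1; lra.
Unshelve. all: by end_near. Qed.

Let shift_cvg (t : R) : (fun e => t + e) @ (0 : R)^' --> t.
Proof.
rewrite -[X in _ --> X](addr0 t); apply: cvgD; first exact: cvg_cst.
exact: cvg_within.
Qed.

(** By skewness A can be moved to u (s + h). The time difference then always falls on [u], whose L^2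
    derivative exists, and never on [ux]. *)
Let slope_pair t h i : 0 < t -> 0 < h ->
  slope_limit (fun s => ip (u (s + h) i) (A s i)) t
    (ip (ut (t + h) i) (A t i) - ip (A (t + h) i) (ut t i)).
Proof.
move=> t0 h0; have th0 : 0 < t + h by exact: addr_gt0.
rewrite /slope_limit.
rewrite (_ : (fun e => _) = (fun e => ip (q (t + h) e i) (A (t + e) i) - ip (A (t + h) i) (q t e i))).
  apply: cvgB.
    apply: ip_cvg => //; first exact: du.
    apply: (cvg_comp (fun e => t + e) (fun s => nrm (fun r => A s i r - A t i r))); last exact: cont_A.
    exact: shift_cvg.
  apply: ip_cvg => //; last exact: du.
  rewrite (_ : (fun=> _) = (fun=> 0)); first exact: cvg_cst.
  apply/funext => e; rewrite (@nrm_ext _ _ (fun r => 0 * A (t + h) i r)) ?nrmZ ?normr0 ?mul0r //.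
  by move=> r _; rewrite subrr mul0r.
apply/funext => e.
have sk s : ip (u (t + h) i) (A s i) = - ip (A (t + h) i) (u s i).
  by apply/eqP; rewrite eq_sym eqr_oppLR -addr_eq0 addrC; apply/eqP; rewrite addrC; exact: (mult_skew d0 (Su _ _) (Su _ _)).
rewrite /q ipZl ?ipBl //; last exact: L2B.
rewrite ipZr ?ipBr //; last exact: L2B.
by rewrite !sk addrAC; ring.
Qed.

(** This is J_h: as u and A u are orthogonal at equal times, u (t) may be subtracted from u (t + h)
    without changing the value. *)
Let Kt h t := h^-1 * \sum_i ip (u (t + h) i) (A t i).
Let Kder h t := h^-1 * \sum_i (ip (ut (t + h) i) (A t i) - ip (A (t + h) i) (ut t i)).

Let slope_K t h : 0 < t -> 0 < h -> slope_limit (Kt h) t (Kder h t).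
Proof.
move=> t0 h0; apply: slope_limitZ; apply: slope_limit_sum => i; exact: slope_pair.
Qed.

(** 4 + 1 copies of 1 / d + 1: the Lipschitz bound of [F] contains the sum over j and is summed over
    four components, whereas the bound of A applied to [F] is diagonal. *)
Let c1 := 5 * (d^-1 + 1).

Let rwu r (x : R) : 0 < r -> wgt d r * `|x| <= `|x / r|.
Proof.
move=> r0; rewrite normrM (gtr0_norm (x := r^-1)) ?invr_gt0 // ler_pdivlMr //.
rewrite mulrAC -[leRHS]mul1r ler_wpM2r // mulrC; exact: wgt_r_le1.
Qed.

Let N_ge t i r : `|ux t i r| + `|u t i r / r| <= N t r.
Proof. by apply: (@le_sum_comp _ (fun j => `|ux t j r| + `|u t j r / r|)) => j; rewrite addr_ge0. Qed.

Let sum_u_le t r : 0 < r -> \sum_j `|u t j r| <= r * N t r.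
Proof.
move=> r0; rewrite /N mulr_sumr; apply: ler_sum => j _.
rewrite mulrDr normrM (gtr0_norm (x := r^-1)) ?invr_gt0 //.
have -> : r * (`|u t j r| / r) = `|u t j r| by field; rewrite gt_eqF.
by rewrite lerDr mulr_ge0 // ltW.
Qed.

Let A_le t i r : 0 < r -> `|A t i r| <= (d^-1 + 1) * N t r.
Proof.
move=> r0; apply: (@le_trans _ _ ((d^-1 + 1) * (`|ux t i r| + `|u t i r / r|))); last first.
  by rewrite ler_wpM2l ?N_ge // addr_ge0 // invr_ge0 ltW.
rewrite mulrDr; apply: (le_trans (ler_normD _ _)); apply: lerD.
  rewrite normrM ler_wpM2r // gtr0_norm ?chi_gt0 //; apply: (le_trans (chi_le_cst d0 r0)).
  by rewrite lerDl.
rewrite normrM normrM (gtr0_norm (wgt_gt0 d r0)) (gtr0_norm (x := 2^-1)) //.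
rewrite ler_pdivrMr //; apply: (le_trans (rwu (u t i r) r0)).
rewrite -[leLHS]mul1r -mulrA [`|_| * 2]mulrC mulrA ler_wpM2r //.
have : 0 < d^-1 by rewrite invr_gt0.
lra.
Qed.

Let multF_le t i r : 0 < r -> `|mult d (F t i) (Fx t i) r| <= (d^-1 + 1) * thetaN t r.
Proof.
move=> r0; rewrite mulrDl mul1r; apply: (le_trans (ler_normD _ _)); apply: lerD.
  rewrite normrM; apply: ler_pM => //; last exact: Fx0.
  by rewrite gtr0_norm ?chi_gt0 // chi_le_cst.
rewrite normrM normrM (gtr0_norm (wgt_gt0 d r0)) (gtr0_norm (x := 2^-1)) //.
apply: (@le_trans _ _ (wgt d r * `|F t i r|)).
  by rewrite ler_piMr ?mulr_ge0 ?(ltW (wgt_gt0 d r0)) // invf_le1 // ler1n.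
apply: (@le_trans _ _ (wgt d r * (theta r * (r * N t r)))).
  rewrite ler_wpM2l ?(ltW (wgt_gt0 d r0)) //; apply: (le_trans (F0 _ _ r0)).
  by rewrite ler_wpM2l ?theta0 // sum_u_le.
have -> : wgt d r * (theta r * (r * N t r)) = (r * wgt d r) * (thetaN t r) by rewrite /thetaN; ring.
by rewrite -[leRHS]mul1r ler_wpM2r ?mulr_ge0 ?theta0 // wgt_r_le1.
Qed.

Let Lnq t h j : L2 (fun r => `|q t h j r|). Proof. exact: L2_norm. Qed.

(** The linear part reduces to the commutator. In the nonlinear part A is moved onto [F] by
    skewness, so that every term contains the quotient [q] and no difference of [ux] is left. *)
Let Kder_le t h : 0 < t -> 0 < h ->
  Kder h t <= \sum_i ip (q t h (sg i)) (C t i) + c1 * \sum_j ip (fun r => `|q t h j r|) (thetaN t).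
Proof.
move=> t0 h0.
have Ld s i : L2 (dirac k m (u s) (ux s) i) by exact: L2_dirac.
have Sq i : sob (q t h i) (fun r => h^-1 * (ux (t + h) i r - ux t i r)).
  exact: (sobZ h^-1 (sobB (Su (t + h) i) (Su t i))).
have LmF i := L2_mult d0 (SF t i).
have X0 : 0 <= d^-1 + 1 by rewrite addr_ge0 // invr_ge0 ltW.
pose S2 := \sum_i (ip (F (t + h) i) (A t i) - ip (A (t + h) i) (F t i)).
have E : Kder h t = \sum_i ip (q t h (sg i)) (C t i) + h^-1 * S2.
  rewrite /Kder (_ : \sum_i _ = \sum_i (ip (dirac k m (u (t + h)) (ux (t + h)) i) (A t i)
      - ip (A (t + h) i) (dirac k m (u t) (ux t) i)) + S2); last first.
    rewrite /S2 -big_split /=; apply: eq_bigr => i _.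
    by rewrite /ut ipDl // ipDr //; ring.
  rewrite mulrDr; congr (_ + _).
  rewrite (dirac_mult_antisym k m d0 d4) //.
  (* The commutator pairing vanishes at equal times; subtracting it replaces u (t + h) by h times
     the quotient. *)
  have Z : \sum_i ip (u t (sg i)) (C t i) = 0.
    rewrite -(dirac_mult_antisym k m d0 d4 (Su t) (Su t)) big1 // => i _.
    by rewrite ipC subrr.
  rewrite -[X in h^-1 * X]subr0 -[X in h^-1 * (_ - X)]Z -sumrB mulr_sumr; apply: eq_bigr => i _.
  by rewrite /q ipZl ?ipBl //; exact: L2B.
rewrite E lerD2l.
(* The first term is the increment of [F] against A u; what remains is the increment of A u against
   [F t], where A is moved to [F]. *)
have T1 i : ip (F (t + h) i) (A t i) - ip (A (t + h) i) (F t i) =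
   ip (fun r => F (t + h) i r - F t i r) (A t i) + h * ip (q t h i) (mult d (F t i) (Fx t i)).
  have sk := mult_skew d0 (Sq i) (SF t i).
  have -> : ip (q t h i) (mult d (F t i) (Fx t i)) =
     - ip (mult d (q t h i) (fun r => h^-1 * (ux (t + h) i r - ux t i r))) (F t i).
    by apply/eqP; rewrite -addr_eq0 addrC; apply/eqP.
  have -> : ip (mult d (q t h i) (fun r => h^-1 * (ux (t + h) i r - ux t i r))) (F t i)
      = h^-1 * (ip (A (t + h) i) (F t i) - ip (A t i) (F t i)).
    rewrite -ipBl // -ipZl //; last exact: L2B.
    by apply: ip_ext => r _; rewrite /mult /q; ring.
  rewrite ipBl // (ipC (A t i) (F t i)); field; by rewrite gt_eqF.
have B1 i : ip (fun r => F (t + h) i r - F t i r) (A t i) <=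
   h * ((d^-1 + 1) * \sum_j ip (fun r => `|q t h j r|) (thetaN t)).
  have Ls : L2 (fun r => \sum_j `|q t h j r|) by exact: L2_sum.
  rewrite (_ : h * _ = ip (fun r => h * (d^-1 + 1) * \sum_j `|q t h j r|) (thetaN t)); last first.
    by rewrite ipZl // ipC ip_sumr // mulrA; congr (_ * _); apply: eq_bigr => j _; rewrite ipC.
  apply: ip_le => //; [exact: L2B|exact: L2Z|].
  move=> r r0; apply: (le_trans (ler_norm _)); rewrite normrM.
  apply: (@le_trans _ _ ((theta r * \sum_j `|u (t + h) j r - u t j r|) * ((d^-1 + 1) * N t r))).
    by apply: ler_pM => //; [exact: FB|exact: A_le].
  have -> : \sum_j `|u (t + h) j r - u t j r| = h * \sum_j `|q t h j r|.
    rewrite mulr_sumr; apply: eq_bigr => j _; rewrite /q normrM gtr0_norm ?invr_gt0 //.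
    by rewrite mulrA divff ?mul1r // gt_eqF.
  by rewrite le_eqVlt; apply/orP; left; apply/eqP; rewrite /thetaN; ring.
have B2 i : ip (q t h i) (mult d (F t i) (Fx t i)) <=
   (d^-1 + 1) * ip (fun r => `|q t h i r|) (thetaN t).
  rewrite -ipZr //; apply: ip_le => //; first exact: L2Z.
  move=> r r0; apply: (le_trans (ler_norm _)); rewrite normrM ler_wpM2l //; exact: multF_le.
rewrite mulrC ler_pdivrMr // /S2 (eq_bigr _ (fun i _ => T1 i)) big_split /=.
apply: (@le_trans _ _ (\sum_(i : comp) h * ((d^-1 + 1) * \sum_j ip (fun r => `|q t h j r|) (thetaN t))
   + \sum_i h * ((d^-1 + 1) * ip (fun r => `|q t h i r|) (thetaN t)))).
  by apply: lerD; apply: ler_sum => i _ //; rewrite ler_pM2l.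
rewrite -!mulr_sumr !sum_comp /c1; lra.
Qed.

Definition energy t := \sum_i \int[mu]_(r in D) dens d (u t i) (ux t i) r.

Definition virial t := \sum_i ip (ut t i) (A t i).

Let energy_ge0 t : 0 <= energy t.
Proof.
apply: sumr_ge0 => i _; apply: Rint_ge0 => r /=; rewrite in_itv/= andbT => r0.
by rewrite /dens mulr_ge0 ?addr_ge0 ?sqr_ge0 // ltW // wgt_gt0.
Qed.

(** The factor 8 is 4 * 2: four components in the square of [N], and two summands in each. *)
Let ip_le_energy t (a b : R -> R) c : 0 <= c -> L2 a -> L2 b ->
  (forall r, 0 < r -> a r * b r <= c * (wgt d r * N t r ^+ 2)) ->
  ip a b <= c * (8 * energy t).
Proof.
move=> c0 La Lb H.
have Id i := itg_dens d0 (Su t i).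
rewrite /energy -Rint_sum // -RintZ //; last exact: itg_sum.
rewrite -RintZ //; last by apply: itgZ => //; exact: itg_sum.
apply: Rint_le => //; first exact: L2_itgM.
  by do 2 apply: itgZ => //; exact: itg_sum.
move=> r /=; rewrite in_itv/= andbT => r0; apply: (le_trans (H r r0)).
rewrite ler_wpM2l // /dens -mulr_sumr [leRHS]mulrCA ler_wpM2l ?(ltW (wgt_gt0 d r0)) //.
apply: (le_trans (sum_comp_sqr _)).
rewrite (_ : 8 = 4 * 2); last by rewrite -natrM.
rewrite -mulrA ler_wpM2l // mulr_sumr; apply: ler_sum => j _.
rewrite -(real_normK (num_real (ux t j r))) -(real_normK (num_real (u t j r / r))).
rewrite -subr_ge0 (_ : _ - _ = (`|ux t j r| - `|u t j r / r|) ^+ 2) ?sqr_ge0 //; ring.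
Qed.

Let X0 : 0 <= d^-1. Proof. by rewrite invr_ge0 ltW. Qed.
Let c10 : 0 <= c1. Proof. by rewrite mulr_ge0 // addr_ge0. Qed.

(** Since r chi', r^2 chi'' and chi are bounded, the commutator can afford a factor r. It
    compensates the one lost in bounding [F] by theta r N. *)
Let C_le t i r : 0 < r -> r * `|C t i r| <= (2 + `|k| * d^-1) * N t r.
Proof.
move=> r0; apply: (@le_trans _ _ ((2 + `|k| * d^-1) * (`|ux t i r| + `|u t i r / r|))); last first.
  by rewrite ler_wpM2l ?N_ge // addr_ge0 // mulr_ge0.
rewrite /comm normrN.
apply: (@le_trans _ _ (r * (`|wgt d r * ux t i r| + `|wgt1 d r * u t i r / 2|
   + `|kap k i / r ^+ 2 * chi d r * u t i r|))).
  by rewrite ler_wpM2l ?(ltW r0) //; apply: (le_trans (ler_normB _ _)); rewrite lerD2r ler_normD.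
have h1 : r * `|wgt d r * ux t i r| <= `|ux t i r|.
  rewrite normrM mulrA -[leRHS]mul1r ler_wpM2r // gtr0_norm ?wgt_gt0 //; exact: wgt_r_le1.
have h2 : r * `|wgt1 d r * u t i r / 2| <= `|u t i r / r|.
  rewrite (_ : wgt1 d r * u t i r / 2 = (r * wgt1 d r / 2) * (u t i r / r)); last first.
    by field; rewrite gt_eqF.
  rewrite normrM mulrA -[leRHS]mul1r ler_wpM2r // normrM (gtr0_norm (x := 2^-1)) //.
  rewrite mulrA ler_pdivrMr // mul1r normrM (gtr0_norm r0).
  apply: (@le_trans _ _ (r * (2 * wgt d r))); first by rewrite ler_pM2l // wgt1_bound.
  by rewrite mulrCA -[leRHS]mulr1 ler_wpM2l // wgt_r_le1.
have h3 : r * `|kap k i / r ^+ 2 * chi d r * u t i r| <= `|k| * d^-1 * `|u t i r / r|.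
  rewrite (_ : kap k i / r ^+ 2 * chi d r * u t i r = (kap k i * chi d r / r) * (u t i r / r)); last first.
    by field; rewrite gt_eqF.
  rewrite normrM mulrA ler_wpM2r // normrM (gtr0_norm (x := r^-1)) ?invr_gt0 //.
  rewrite mulrC divfK ?gt_eqF // normrM kap_norm ler_wpM2l // gtr0_norm ?chi_gt0 //.
  exact: chi_le_cst.
rewrite !mulrDr !mulrDl.
have a1 : 0 <= `|ux t i r| by [].
have a2 : 0 <= `|u t i r / r| by [].
have a3 : 0 <= `|k| * d^-1 * `|ux t i r| by rewrite !mulr_ge0.
move: h1 h2 h3 a1 a2 a3; lra.
Qed.

Let F_le t i r : 0 < r -> `|F t i r| <= theta r * (r * N t r).
Proof. by move=> r0; apply: (le_trans (F0 _ _ r0)); rewrite ler_wpM2l ?theta0 // sum_u_le. Qed.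

(** The mass term of [ut] contains u itself, which is only bounded by r N; this is where [thetam] is
    used. *)
Let ut_le t i r : 0 < r -> `|ut t i r| * thetaN t r <=
  eta * (3 + `|k|) * (wgt d r * N t r ^+ 2).
Proof.
move=> r0.
have w0 := ltW (wgt_gt0 d r0).
have h1 : `|ut t i r| <= (1 + `|k|) * N t r + `|m| * `|u t (ta i) r| + `|F t i r|.
  apply: (le_trans (ler_normD _ _)); rewrite lerD2r; apply: (le_trans (ler_normD _ _)).
  apply: lerD; last by rewrite normrM normrM ep_norm mulr1.
  apply: (@le_trans _ _ ((1 + `|k|) * (`|ux t (sg i) r| + `|u t (sg i) r / r|))); last first.
    by rewrite ler_wpM2l ?N_ge // addr_ge0.
  apply: (le_trans (ler_normD _ _)).
  rewrite (_ : kap k i / r * u t (sg i) r = kap k i * (u t (sg i) r / r)); last by ring.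
  rewrite normrM kap_norm mulrDl !mulrDr !mul1r.
  have a1 : 0 <= `|k| * `|ux t (sg i) r| by rewrite mulr_ge0.
  have a2 : 0 <= `|u t (sg i) r / r| by [].
  move: a1 a2; lra.
apply: (@le_trans _ _ (((1 + `|k|) * N t r + `|m| * `|u t (ta i) r| + `|F t i r|) * thetaN t r)).
  by rewrite ler_wpM2r // mulr_ge0 ?theta0.
rewrite !mulrDl /thetaN.
have t1 : (1 + `|k|) * N t r * (theta r * N t r) <= eta * (1 + `|k|) * (wgt d r * N t r ^+ 2).
  rewrite (_ : _ * N t r * _ = theta r * ((1 + `|k|) * N t r ^+ 2)); last by ring.
  rewrite (_ : eta * _ * _ = eta * wgt d r * ((1 + `|k|) * N t r ^+ 2)); last by ring.
  by rewrite ler_wpM2r ?thetaw // mulr_ge0 ?sqr_ge0 // addr_ge0.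
have t2 : `|m| * `|u t (ta i) r| * (theta r * N t r) <= eta * (wgt d r * N t r ^+ 2).
  rewrite (_ : _ * _ * _ = `|m| * theta r * (`|u t (ta i) r| * N t r)); last by ring.
  apply: (@le_trans _ _ ((eta * wgt d r / r) * ((r * N t r) * N t r))).
    apply: ler_pM; rewrite ?mulr_ge0 ?theta0 ?thetam //.
    rewrite ler_wpM2r //; apply: le_trans (sum_u_le _ r0).
    by apply: (@le_sum_comp _ (fun j => `|u t j r|)).
  by rewrite le_eqVlt; apply/orP; left; apply/eqP; field; rewrite gt_eqF.
have t3 : `|F t i r| * (theta r * N t r) <= eta * (wgt d r * N t r ^+ 2).
  apply: (@le_trans _ _ (theta r * (r * N t r) * (theta r * N t r))).
    by rewrite ler_wpM2r ?F_le // mulr_ge0 ?theta0.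
  rewrite (_ : _ * _ * _ = (r * theta r) * theta r * N t r ^+ 2); last by ring.
  rewrite mulrA ler_wpM2r ?sqr_ge0 //.
  apply: (@le_trans _ _ (1 * theta r)); last by rewrite mul1r thetaw.
  by rewrite ler_wpM2r ?theta0 //; exact: (le_trans (thetar r0)).
move: t1 t2 t3; set Y := wgt d r * N t r ^+ 2.
have -> : eta * (3 + `|k|) * Y = eta * (1 + `|k|) * Y + eta * Y + eta * Y by ring.
lra.
Qed.

(** 32 = 4 * 8: the sum over four components and the factor of [ip_le_energy]. The bracket collects
    the constant of [C_le] and, multiplied by [c1], that of [ut_le]. *)
Definition Kst := 32 * (2 + `|k| * d^-1 + c1 * (3 + `|k|)).

Let limit_le t : 0 < t ->
  \sum_i ip (ut t (sg i)) (C t i) + c1 * \sum_j ip (fun r => `|ut t j r|) (thetaN t)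
  <= - (3 / 64 - eta * Kst) * energy t.
Proof.
move=> t0.
have Ld i : L2 (dirac k m (u t) (ux t) i) by exact: L2_dirac.
have E1 : \sum_i ip (ut t (sg i)) (C t i) =
   \sum_i ip (dirac k m (u t) (ux t) (sg i)) (C t i) + \sum_i ip (F t (sg i)) (C t i).
  by rewrite -big_split /=; apply: eq_bigr => i _; rewrite ipDl.
have h1 := dirac_comm_coercive m d0 d4 k1 k2 (Su t).
have h2 i : ip (F t (sg i)) (C t i) <= eta * (2 + `|k| * d^-1) * (8 * energy t).
  apply: ip_le_energy => //; first by rewrite mulr_ge0 // addr_ge0 // mulr_ge0.
  move=> r r0; apply: (le_trans (ler_norm _)); rewrite normrM.
  apply: (@le_trans _ _ (theta r * (r * N t r) * `|C t i r|)); first by rewrite ler_wpM2r // F_le.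
  rewrite (_ : _ * _ * _ = theta r * N t r * (r * `|C t i r|)); last by ring.
  apply: (@le_trans _ _ ((eta * wgt d r * N t r) * ((2 + `|k| * d^-1) * N t r))).
    apply: ler_pM; rewrite ?mulr_ge0 ?theta0 ?C_le ?(ltW r0) //.
    by rewrite ler_wpM2r ?thetaw.
  by rewrite le_eqVlt; apply/orP; left; apply/eqP; ring.
have h3 j : ip (fun r => `|ut t j r|) (thetaN t) <= eta * (3 + `|k|) * (8 * energy t).
  apply: ip_le_energy => //; [by rewrite mulr_ge0 // addr_ge0|exact: L2_norm|].
  by move=> r r0; exact: ut_le.
have h2' : \sum_i ip (F t (sg i)) (C t i) <= 4 * (eta * (2 + `|k| * d^-1) * (8 * energy t)).
  apply: (le_trans (ler_sum _ (fun i _ => h2 i))); rewrite sum_comp; lra.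
have h3' : \sum_j ip (fun r => `|ut t j r|) (thetaN t) <= 4 * (eta * (3 + `|k|) * (8 * energy t)).
  apply: (le_trans (ler_sum _ (fun i _ => h3 i))); rewrite sum_comp; lra.
have h3'' : c1 * \sum_j ip (fun r => `|ut t j r|) (thetaN t) <=
    c1 * (4 * (eta * (3 + `|k|) * (8 * energy t))) by rewrite ler_wpM2l.
rewrite E1 /Kst.
have -> : - (3 / 64 - eta * (32 * (2 + `|k| * d^-1 + c1 * (3 + `|k|)))) * energy t =
  - (3 / 64) * energy t + 4 * (eta * (2 + `|k| * d^-1) * (8 * energy t))
   + c1 * (4 * (eta * (3 + `|k|) * (8 * energy t))) by ring.
by apply: lerD => //; exact: lerD.
Qed.

Let cvg_K t : 0 < t -> Kt h t @[h --> (0 : R)^'+] --> virial t.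
Proof.
move=> t0.
have skew i : ip (u t i) (A t i) = 0.
  have := mult_skew d0 (Su t i) (Su t i); rewrite ipC => /eqP.
  by rewrite -mulr2n mulrn_eq0 => /eqP.
rewrite (_ : (fun h => _) = (fun h => \sum_i ip (q t h i) (A t i))); last first.
  apply/funext => h; rewrite /Kt mulr_sumr; apply: eq_bigr => i _.
  by rewrite /q ipZl ?ipBl ?skew ?subr0 //; exact: L2B.
have H i : ip (q t h i) (A t i) @[h --> (0 : R)^'+] --> ip (ut t i) (A t i).
  apply: ip_cvg => //; first exact/cvg_dnbhs_at_right/du.
  rewrite (_ : (fun=> _) = (fun=> 0)); first exact: cvg_cst.
  apply/funext => e; rewrite (@nrm_ext _ _ (fun r => 0 * A t i r)) ?nrmZ ?normr0 ?mul0r //.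
  by move=> r _; rewrite subrr mul0r.
rewrite /virial sum_comp (_ : (fun h => _) = (fun h => ip (q t h (false, false)) (A t (false, false))
  + ip (q t h (false, true)) (A t (false, true)) + ip (q t h (true, false)) (A t (true, false))
  + ip (q t h (true, true)) (A t (true, true)))); last by apply/funext => h; rewrite sum_comp.
by do ![apply: cvgD => //].
Qed.

(** Increments of the virial are limits of increments of [Kt h], whose slope is bounded by
    [Kder_le]. As that bound converges jointly in time and step, it exceeds its limit at [x] by less
    than [e] for all times near [x] and all small h. *)
Let virial_slope x e : 0 < x -> 0 < e -> exists2 dl, 0 < dl & forall s t,
  x - dl < s -> s <= t -> t < x + dl ->
  virial t - virial s <= (- (3 / 64 - eta * Kst) * energy x + e) * (t - s).
Proof.
move=> x0 e0.
pose G := filter_prod (nbhs x) ((0 : R)^'+).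
have comp1 (f : R -> R) (l : R) : f s @[s --> x] --> l -> f z.1 @[z --> G] --> l.
  by move=> H; apply: (cvg_comp fst f _ H); exact: cvg_fst.
have H1 i : ip (q z.1 z.2 (sg i)) (C z.1 i) @[z --> G] --> ip (ut x (sg i)) (C x i).
  apply: (@ip_cvg _ _ G _ (fun z => q z.1 z.2 (sg i)) (fun z => C z.1 i)) => //; first exact: q_lim.
  by apply: (comp1 (fun s => nrm (fun r => C s i r - C x i r))); exact: cont_C.
have H2 j : ip (fun r => `|q z.1 z.2 j r|) (thetaN z.1) @[z --> G]
    --> ip (fun r => `|ut x j r|) (thetaN x).
  apply: (@ip_cvg _ _ G _ (fun z r => `|q z.1 z.2 j r|) (fun z => thetaN z.1)) => //.
  - exact: L2_norm.
  - apply: nrm_cvg_le (q_lim j x0); apply: nearW => z.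
    have Lz := L2B (Lq z.1 z.2 j) (Lut x j).
    rewrite -[leRHS]mul1r; apply: nrm_le => //.
      by have [] := L2B (L2_norm (Lq z.1 z.2 j)) (L2_norm (Lut x j)).
    by move=> r _; rewrite mul1r; exact: ler_dist_dist.
  - by apply: (comp1 (fun s => nrm (fun r => thetaN s r - thetaN x r))); exact: cont_thetaN.
have sumG (f : comp -> R * R -> R) (l : comp -> R) : (forall i, f i z @[z --> G] --> l i) ->
    \sum_i f i z @[z --> G] --> \sum_i l i.
  move=> H; rewrite (_ : (fun z => _) = (fun z => f (false, false) z + f (false, true) z
     + f (true, false) z + f (true, true) z)); last by apply/funext => s; rewrite sum_comp.
  by rewrite sum_comp; do ![apply: cvgD => //].
have HH : \sum_i ip (q z.1 z.2 (sg i)) (C z.1 i)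
     + c1 * \sum_j ip (fun r => `|q z.1 z.2 j r|) (thetaN z.1) @[z --> G] -->
   \sum_i ip (ut x (sg i)) (C x i) + c1 * \sum_j ip (fun r => `|ut x j r|) (thetaN x).
  apply: cvgD; first exact: (sumG (fun i z => ip (q z.1 z.2 (sg i)) (C z.1 i))).
  apply: cvgM; first exact: cvg_cst.
  exact: (sumG (fun j z => ip (fun r => `|q z.1 z.2 j r|) (thetaN z.1))).
set L := - _ * _.
have Lt : \sum_i ip (ut x (sg i)) (C x i) + c1 * \sum_j ip (fun r => `|ut x j r|) (thetaN x) < L + e.
  by apply: (le_lt_trans (limit_le x0)); rewrite ltrDl.
have /(_ _ _ Lt) := @cvgr_le R _ G _ _ _ HH.
move=> [[P1 P2] /= [[a /= a0 Pa] [b /= b0 Pb]] HP].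
pose dl := Num.min a x.
exists dl; first by rewrite lt_min a0.
move=> s t xs st tx.
have near_x z : s <= z -> z <= t -> 0 < z /\ P1 z.
  move=> sz zt.
  have la : dl <= a by rewrite ge_min lexx.
  have lx : dl <= x by rewrite ge_min lexx orbT.
  split; first by move: xs sz lx; lra.
  by apply: Pa => /=; rewrite ltr_norml; apply/andP; split; move: xs tx sz zt la; lra.
have [s0 _] := near_x s (lexx _) st; have [t0 _] := near_x t st (lexx _).
have cK : Kt h t - Kt h s @[h --> (0 : R)^'+] --> virial t - virial s.
  by apply: cvgB; exact: cvg_K.
apply: (cvgr_to_le cK).
near=> h.
have h0 : 0 < h by near: h; exact: nbhs_right_gt.
apply: slope_limit_bound => // z /andP[sz zt].
have [z0 Pz] := near_x z sz zt.
exists (Kder h z); first exact: slope_K.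
apply: (le_trans (Kder_le z0 h0)).
apply: (HP (z, h)); split => //=.
apply: Pb => //=; rewrite sub0r normrN gtr0_norm //; near: h; exact: nbhs_right_lt.
Unshelve. all: by end_near. Qed.

Definition local_mass t := \sum_i ip (fun r => wgt 3 r * u t i r) (u t i).

Let loc_norm r : 0 < r -> `|wgt (3 : R) r| <= 1.
Proof. by move=> r0; rewrite gtr0_norm ?wgt_gt0 // wgt_le1. Qed.

Let Lloc (f : R -> R) : L2 f -> L2 (fun r => wgt 3 r * f r).
Proof. exact: (L2_bounded_mul (primitive_measurable (primitive_wgt 3)) loc_norm). Qed.

Let Lloc1 (f : R -> R) : L2 f -> L2 (fun r => wgt1 3 r * f r).
Proof.
move=> Lf; apply: (L2_bounded_mul (primitive_measurable (primitive_wgt1 3)) (K := 4)) => //.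
move=> r r0; have h : 0 < 1 + r by rewrite addr_gt0.
rewrite wgt1E // !normrM normrN (gtr0_norm (x := (1 + r)^-1)) ?invr_gt0 //.
rewrite ler_pdivrMr // -[leRHS]mulr1 -mulrA; apply: ler_pM => //.
  by rewrite ger0_norm ?addr_ge0 //; lra.
by apply: (le_trans (loc_norm r0)); rewrite mulr1 lerDl ltW.
Qed.

Let mass_rate t := 2 * \sum_i ip (fun r => wgt 3 r * u t i r) (ut t i).

Let slope_mass t : 0 < t -> slope_limit local_mass t (mass_rate t).
Proof.
move=> t0; rewrite /mass_rate mulr_sumr; apply: slope_limit_sum => i; rewrite /slope_limit.
rewrite (_ : (fun e => _) = (fun e => ip (fun r => wgt 3 r * q t e i r) (u (t + e) i)
   + ip (fun r => wgt 3 r * u t i r) (q t e i))).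
  rewrite mulr_natl mulr2n; apply: cvgD.
    rewrite [X in _ --> X](_ : _ = ip (fun r => wgt 3 r * ut t i r) (u t i)); last first.
      by apply: ip_ext => r _; ring.
    apply: ip_cvg; rewrite //; try (move=> e; exact: Lloc); try exact: Lloc.
      apply: nrm_cvg_le (du i t0); apply: nearW => e.
      have Le := L2B (Lq t e i) (Lut t i).
      rewrite -[leRHS]mul1r; apply: nrm_le => //.
        by have [] := L2B (Lloc (Lq t e i)) (Lloc (Lut t i)).
      by move=> r r0; rewrite -mulrBr normrM ler_wpM2r // loc_norm.
    apply: (cvg_comp (fun e => t + e) (fun s => nrm (fun r => u s i r - u t i r))); last exact: cont_u.
    exact: shift_cvg.
  apply: ip_cvg => //; [by move=> e; exact: Lloc|exact: Lloc| |exact: du].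
  rewrite (_ : (fun=> _) = (fun=> 0)); first exact: cvg_cst.
  apply/funext => e; rewrite (@nrm_ext _ _ (fun r => 0 * u t i r)) ?nrmZ ?normr0 ?mul0r //.
  by move=> r _; rewrite subrr mul0r.
apply/funext => e.
have Lw := Lloc (Lu (t + e) i); have Lw' := Lloc (Lu t i).
rewrite (@ip_ext _ (fun r => wgt 3 r * q t e i r) _
   (fun r => e^-1 * (wgt 3 r * u (t + e) i r - wgt 3 r * u t i r)) (u (t + e) i)); last first.
  by move=> r _; rewrite /q; ring.
rewrite ipZl ?ipBl //; last exact: L2B.
rewrite /q ipZr ?ipBr //; last exact: L2B.
ring.
Qed.

Let local_mass_le t : 0 <= local_mass t <= energy t.
Proof.
apply/andP; split.
  apply: sumr_ge0 => i _; apply: Rint_ge0 => r /=; rewrite in_itv/= andbT => r0.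
  by rewrite -mulrA mulr_ge0 ?(ltW (wgt_gt0 3 r0)) // -expr2 sqr_ge0.
apply: ler_sum => i _; apply: Rint_le => //; first by apply: L2_itgM => //; exact: Lloc.
  exact: itg_dens.
move=> r /=; rewrite in_itv/= andbT => r0; rewrite -mulrA -expr2.
apply: (@le_trans _ _ (wgt d r / r ^+ 2 * u t i r ^+ 2)).
  by rewrite ler_wpM2r ?sqr_ge0 // loc_le.
rewrite /dens (_ : wgt d r / r ^+ 2 * _ = wgt d r * (u t i r / r) ^+ 2); last first.
  by field; rewrite gt_eqF.
by rewrite ler_wpM2l ?lerDr ?sqr_ge0 // ltW // wgt_gt0.
Qed.

(** 192 = 4 * 4 * 8 + 2 * 4 * 8. The first product is the flux, where |wgt1| <= 4 wgt at parameter
    3; the second is the nonlinear term. *)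
Let mass_rate_le t : `|mass_rate t| <= 192 * energy t.
Proof.
have Ld i : L2 (dirac k m (u t) (ux t) i) by exact: L2_dirac.
have -> : mass_rate t = - (\sum_i ip (fun r => wgt1 3 r * u t i r) (u t (sg i)))
   + 2 * \sum_i ip (fun r => wgt 3 r * u t i r) (F t i).
  rewrite -(dirac_flux k m (Su t)) -mulrDr -big_split /=; congr (_ * _).
  by apply: eq_bigr => i _; rewrite ipDr //; exact: Lloc.
have u_le i r : 0 < r -> `|u t i r| <= r * N t r.
  move=> r0; apply: le_trans (sum_u_le _ r0).
  by apply: (@le_sum_comp _ (fun j => `|u t j r|)).
have abs_le (a b : R -> R) c : 0 <= c -> L2 a -> L2 b ->
    (forall r, 0 < r -> `|a r| * `|b r| <= c * (wgt d r * N t r ^+ 2)) ->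
    `|ip a b| <= c * (8 * energy t).
  move=> c0 La Lb H; rewrite ler_norml -lerNl -ipNl //.
  apply/andP; split; apply: ip_le_energy => //; try exact: L2N.
    by move=> r r0; apply: (le_trans (ler_norm _)); rewrite normrM normrN H.
  by move=> r r0; apply: (le_trans (ler_norm _)); rewrite normrM H.
have h1 i : `|ip (fun r => wgt1 3 r * u t i r) (u t (sg i))| <= 4 * (8 * energy t).
  apply: abs_le => //; first exact: Lloc1.
  move=> r r0; have h : 0 < 1 + r by rewrite addr_gt0.
  apply: (@le_trans _ _ ((4 * wgt 3 r) * ((r * N t r) * (r * N t r)))).
    rewrite normrM -[leLHS]mulrA; apply: ler_pM => //; rewrite ?mulr_ge0 //; last first.
      by apply: ler_pM => //; exact: u_le.
    rewrite wgt1E // !normrM normrN (gtr0_norm (x := (1 + r)^-1)) ?invr_gt0 //.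
    rewrite ler_pdivrMr // (gtr0_norm (wgt_gt0 3 r0)).
    rewrite ger0_norm ?addr_ge0 // (_ : 1 + 3 = 4); last by ring.
    by rewrite ler_peMr ?lerDl ?(ltW r0) // mulr_ge0 // ltW // wgt_gt0.
  rewrite -mulrA ler_wpM2l //.
  apply: (@le_trans _ _ (wgt d r / r ^+ 2 * (r * N t r * (r * N t r)))).
    by rewrite ler_wpM2r ?loc_le // !mulr_ge0 // ltW.
  by rewrite le_eqVlt; apply/orP; left; apply/eqP; field; rewrite gt_eqF.
have h2 i : `|ip (fun r => wgt 3 r * u t i r) (F t i)| <= 1 * (8 * energy t).
  apply: abs_le => //; first exact: Lloc.
  move=> r r0; rewrite mul1r.
  apply: (@le_trans _ _ (wgt 3 r * (r * N t r) * (theta r * (r * N t r)))).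
    apply: ler_pM => //; last exact: F_le.
    by rewrite normrM gtr0_norm ?wgt_gt0 // ler_wpM2l ?u_le // ltW // wgt_gt0.
  apply: (@le_trans _ _ (wgt d r / r ^+ 2 * (r * N t r) * (1 * (r * N t r)))).
    apply: ler_pM.
    - by rewrite !mulr_ge0 ?(ltW r0) // ltW // wgt_gt0.
    - by rewrite !mulr_ge0 ?theta0 ?(ltW r0).
    - by rewrite ler_wpM2r ?loc_le // mulr_ge0 // ltW.
    - by rewrite ler_wpM2r ?rw1 // mulr_ge0 // ltW.
  by rewrite le_eqVlt; apply/orP; left; apply/eqP; field; rewrite gt_eqF.
apply: (le_trans (ler_normD _ _)); rewrite normrN normrM (ger0_norm (x := 2)) //.
apply: (@le_trans _ _ (4 * (4 * (8 * energy t)) + 2 * (4 * (1 * (8 * energy t))))); last by lra.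
apply: lerD.
  apply: (le_trans (ler_norm_sum _ _ _)); apply: (le_trans (ler_sum _ (fun i _ => h1 i))).
  by rewrite sum_comp; lra.
rewrite ler_wpM2l //; apply: (le_trans (ler_norm_sum _ _ _)).
by apply: (le_trans (ler_sum _ (fun i _ => h2 i))); rewrite sum_comp; lra.
Qed.

Lemma local_mass_decay B : eta * Kst <= 3 / 128 -> (forall t, 0 < t -> B <= virial t) ->
  local_mass t @[t --> +oo] --> 0.
Proof.
move=> small Bv.
(* Smallness of [eta] leaves 3/64 - 3/128 = 3/128 of the coercivity. *)
apply: (@virial_decay _ virial local_mass energy mass_rate (3 / 128) 192 B) => //.
move=> x e x0 e0; have [dl dl0 H] := virial_slope x0 e0.
exists dl => // s t xs st tx; apply: (le_trans (H s t xs st tx)).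
rewrite ler_wpM2r ?subr_ge0 // lerD2r ler_wpM2r ?energy_ge0 // lerN2.
by move: small; lra.
Qed.

End Core.

(** * Weak derivatives *)

Section Kernel.
Context {R : realType}.
Implicit Types (a x y z r h e : R).

(** The positive part of z. [ppart2] is half its square, hence a C^1 primitive of it. *)
Definition ppart z := (z + `|z|) / 2.
Definition ppart2 z := (z ^+ 2 + z * `|z|) / 4.

Lemma ppart2_slope z h : `|ppart2 (z + h) - ppart2 z - h * ppart z| <= h ^+ 2 / 2.
Proof.
rewrite /ppart2 /ppart ler_norml.
have [z0|z0] := leP 0 z; have [h0|h0] := leP 0 (z + h);
  rewrite ?(ger0_norm z0) ?(ger0_norm h0) ?(ltr0_norm z0) ?(ltr0_norm h0);
  apply/andP; split; nra.
Qed.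

(** A quadratic remainder gives differentiability without distinguishing the two sides of the kinks
    of [ppart]. *)
Lemma quadratic_is_derive (f : R -> R) x l K :
  (forall h, `|f (x + h) - f x - h * l| <= K * h ^+ 2) -> is_derive x 1 f l.
Proof.
move=> H.
suff C : h^-1 *: (f (h *: 1 + x) - f x) @[h --> (0 : R)^'] --> l.
  by apply: DeriveDef; [apply/cvg_ex; exists l; exact: C|exact: (cvg_lim (@Rhausdorff R) C)].
apply/subr_cvg0; apply/norm_cvg0P.
apply: (squeeze_cvgr (f := fun=> 0) (h := fun h => K * `|h|)).
- near=> h.
  have h0 : h != 0 by near: h; exact: nbhs_dnbhs_neq.
  rewrite normr_ge0 /=.
  have -> : h^-1 *: (f (h *: 1 + x) - f x) - l = h^-1 * (f (x + h) - f x - h * l).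
    rewrite /GRing.scale /= mulr1 (addrC h); by field.
  rewrite normrM normrV ?unitfE // mulrC ler_pdivrMr ?normr_gt0 //.
  by apply: (le_trans (H h)); rewrite -mulrA -expr2 real_normK ?num_real.
- exact: cvg_cst.
- rewrite -[X in _ --> X](mulr0 K); apply: cvgM; first exact: cvg_cst.
  apply/norm_cvg0P; exact: cvg_within.
Unshelve. all: by end_near. Qed.

(* [step x e] is a C^1 transition from 0 to 1 near [x]; its derivative is the
   tent-shaped kernel of mass 1 supported in [x - e, x + e]. *)
Definition step x e r :=
  (ppart2 (r - x + e) - 2 * ppart2 (r - x) + ppart2 (r - x - e)) / e ^+ 2.
Definition tent x e r :=
  (ppart (r - x + e) - 2 * ppart (r - x) + ppart (r - x - e)) / e ^+ 2.

Lemma step_is_derive x e r : 0 < e -> is_derive r 1 (step x e) (tent x e r).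
Proof.
move=> e0; apply: (@quadratic_is_derive _ _ _ (2 / e ^+ 2)) => h.
have := ppart2_slope (r - x + e) h; have := ppart2_slope (r - x) h.
have := ppart2_slope (r - x - e) h.
have -> : r - x - e + h = r + h - x - e by ring.
have -> : r - x + e + h = r + h - x + e by ring.
have -> : r - x + h = r + h - x by ring.
rewrite /step /tent.
set a1 := ppart2 (r + h - x - e); set a2 := ppart2 (r - x - e).
set b1 := ppart2 (r + h - x); set b2 := ppart2 (r - x).
set c1 := ppart2 (r + h - x + e); set c2 := ppart2 (r - x + e).
set p := ppart (r - x - e); set p' := ppart (r - x); set p'' := ppart (r - x + e).
move=> Ha Hb Hc.
have -> : (c1 - 2 * b1 + a1) / e ^+ 2 - (c2 - 2 * b2 + a2) / e ^+ 2
    - h * ((p'' - 2 * p' + p) / e ^+ 2)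
  = ((c1 - c2 - h * p'') - 2 * (b1 - b2 - h * p') + (a1 - a2 - h * p)) / e ^+ 2 by ring.
rewrite normrM (gtr0_norm (x := (e ^+ 2)^-1)) ?invr_gt0 ?exprn_gt0 //.
rewrite mulrAC ler_wpM2r ?invr_ge0 ?exprn_ge0 ?(ltW e0) //.
move: Ha Hb Hc; rewrite !ler_norml; move=> /andP[? ?] /andP[? ?] /andP[? ?].
apply/andP; split; lra.
Qed.

Lemma tent_continuous x e : continuous (tent x e).
Proof.
have cp a : continuous (fun r => ppart (r - a)).
  move=> r; apply: cvgM; last exact: cvg_cst.
  have c1 : (fun r => r - a) @ r --> r - a by apply: cvgB; [exact: cvg_id|exact: cvg_cst].
  by apply: cvgD => //; exact: cvg_norm.
move=> r; apply: cvgM; last exact: cvg_cst.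
apply: cvgD; last first.
  rewrite (_ : (fun r => _) = (fun r => ppart (r - (x + e)))); last first.
    by apply/funext => s; congr ppart; ring.
  rewrite (_ : r - x - e = r - (x + e)); last by ring.
  exact: cp.
apply: cvgB.
  rewrite (_ : (fun r => _) = (fun r => ppart (r - (x - e)))); last first.
    by apply/funext => s; congr ppart; ring.
  rewrite (_ : r - x + e = r - (x - e)); last by ring.
  exact: cp.
by apply: cvgM; [exact: cvg_cst|exact: cp].
Qed.

Lemma step_le x e r : r <= x - e -> 0 < e -> step x e r = 0.
Proof.
move=> h e0; rewrite /step /ppart2 !ler0_norm; [ring|lra..].
Qed.

Lemma step_ge x e r : x + e <= r -> 0 < e -> step x e r = 1.
Proof.
move=> h e0; rewrite /step /ppart2 !ger0_norm; [field; by rewrite gt_eqF|lra..].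
Qed.

Lemma tent_out x e r : e <= `|r - x| -> 0 < e -> tent x e r = 0.
Proof.
move=> h e0; rewrite /tent /ppart.
have [r0|r0] := leP 0 (r - x).
  rewrite ger0_norm // in h.
  by rewrite !ger0_norm; [ring|lra..].
rewrite ltr0_norm // in h.
by rewrite !ler0_norm; [ring|lra..].
Qed.

Lemma tent_bound x e r : 0 < e -> 0 <= tent x e r <= e^-1.
Proof.
move=> e0; rewrite /tent.
have -> : e^-1 = e / e ^+ 2 by field; rewrite gt_eqF.
have p0 : 0 < (e ^+ 2)^-1 by rewrite invr_gt0 exprn_gt0.
rewrite pmulr_lge0 // ler_pM2r // /ppart.
set s := r - x.
have [s0|s0] := leP 0 s; have [s1|s1] := leP 0 (s + e); have [s2|s2] := leP 0 (s - e);
  rewrite ?(ger0_norm s0) ?(ger0_norm s1) ?(ger0_norm s2)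
    ?(ltr0_norm s0) ?(ltr0_norm s1) ?(ltr0_norm s2); apply/andP; split; lra.
Qed.

End Kernel.

Section WeakDerivative.
Context {R : realType}.
Notation mu := (@lebesgue_measure R).
Local Notation D := (`]0, +oo[%classic : set R).
Implicit Types (f g h : R -> R) (a b c e x y r : R).

Lemma ae_imply (P Q : R -> Prop) : (forall r, P r -> Q r) ->
  (\forall r \ae mu, P r) -> \forall r \ae mu, Q r.
Proof.
move=> PQ [N [mN N0 sN]]; exists N; split => //.
by move=> r nQ; apply: sN => Pr; apply: nQ; exact: PQ.
Qed.

Lemma ae_and (P Q : R -> Prop) : (\forall r \ae mu, P r) ->
  (\forall r \ae mu, Q r) -> \forall r \ae mu, P r /\ Q r.
Proof.
move=> hP hQ; have := negligibleU hP hQ.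
by apply: negligibleS => r /= nPQ; apply: contrapT => /not_orP[/contrapT p /contrapT q]; exact: nPQ.
Qed.

Lemma itg_vanish (A B : set R) f : measurable A -> measurable B -> A `<=` B ->
  (forall x, B x -> ~ A x -> f x = 0) ->
  (itg A f -> itg B f) /\ \int[mu]_(x in B) f x = \int[mu]_(x in A) f x.
Proof.
move=> mA mB AB f0.
have E : f \_ B = f \_ A.
  apply/funext => x; rewrite !patchE.
  have [xA|xA] := boolP (x \in A).
    by have -> : x \in B by move: xA => /set_mem/AB/mem_set.
  case: ifP => // /set_mem xB; apply: f0 => // Ax.
  by rewrite (mem_set Ax) in xA.
split; last by rewrite Rintegral_mkcond E -Rintegral_mkcond.
move=> IA.
have := (@integrable_mkcond _ _ _ mu A (EFin \o f) mA).1 IA.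
rewrite restrict_EFin -E -restrict_EFin => IE.
exact: (@integrable_mkcond _ _ _ mu B (EFin \o f) mB).2 IE.
Qed.

Lemma locally_integrable_itg f a b : locally_integrable D f -> 0 < a -> itg `[a, b] f.
Proof.
move=> [mf _ H] a0.
have sub : (`[a, b] `<=` D)%classic.
  by move=> x /=; rewrite !in_itv/= andbT => /andP[ax _]; exact: lt_le_trans ax.
apply/integrableP; split.
  by apply/measurable_realfun.measurable_EFinP; apply: measurable_funS mf.
by apply: H => //; exact: segment_compact.
Qed.

Lemma itg_cst a b c : itg `[a, b] (fun=> c).
Proof.
apply: continuous_compact_integrable; first exact: segment_compact.
by apply: continuous_subspaceT => x; exact: cvg_cst.
Qed.

Lemma exists_primitive g : (forall a b, 0 < a -> itg `[a, b] g) -> exists G, primitive G g.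
Proof.
move=> Ig.
pose G r := if 1 <= r then \int[mu]_(x in `[1, r]) g x else - \int[mu]_(x in `[r, 1]) g x.
exists G => a b a0 ab; split; first exact: Ig.
rewrite /G; have [a1|a1] := leP 1 a; have [b1|b1] := leP 1 b.
- have E := Rint_cat a1 ab (Ig _ _ ltr01); by rewrite E addrC addKr.
- by have := lt_le_trans b1 (le_trans a1 ab); rewrite ltxx.
- have E := Rint_cat (ltW a1) b1 (Ig _ _ a0); by rewrite E opprK addrC.
- have E := Rint_cat ab (ltW b1) (Ig _ _ a0); by rewrite E opprK addrC addrK.
Qed.

(** The lemma of du Bois-Reymond. Testing with the difference of two steps, at x and at y, shows
    that the averages of [h] against the two tents agree; at Lebesgue points these averages tend to
    h x and h y. *)
Lemma weak_derivative_const h :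
  (forall a b, 0 < a -> itg `[a, b] h) ->
  (forall eta, test_function eta -> \int[mu]_(r in D) (h r * derive1 eta r) = 0) ->
  exists c, {ae mu, forall r, 0 < r -> h r = c}.
Proof.
move=> Ih H0.
pose A n : set R := `[n.+1%:R^-1, n.+1%:R]%classic.
(* The differentiation theorem is applied to locally integrable functions on the whole line, a
   property that [h] may lack near 0; hence the truncations. *)
pose hn n := h \_ (A n).
have ln n : {ae mu, forall x, lebesgue_pt (hn n) x}.
  apply: lebesgue_differentiation; apply: integrable_locally_restrict.
    exact: measurable_itv.
  by apply: Ih; rewrite invr_gt0.
have L := ae_foralln ln.
have cmp x y : 0 < x -> 0 < y -> (forall n, lebesgue_pt (hn n) x) ->
    (forall n, lebesgue_pt (hn n) y) -> h x = h y.
  move=> x0 y0 Lx Ly.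
  have [n hn0] : exists n : nat, Num.max (Num.max x x^-1) (Num.max y y^-1) < n%:R.
    by exists (Num.truncn (Num.max (Num.max x x^-1) (Num.max y y^-1))).+1; exact: truncnS_gt.
  move: hn0; rewrite !gt_max => /andP[/andP[xn xVn] /andP[yn yVn]].
  have nS : (n%:R : R) < n.+1%:R by rewrite ltr_nat.
  have inA (z : R) : 0 < z -> z < n%:R -> z^-1 < n%:R -> n.+1%:R^-1 < z /\ z < n.+1%:R.
    move=> z0 zn zVn; split; last exact: lt_trans nS.
    rewrite -[ltRHS]invrK ltf_pV2 ?posrE ?invr_gt0 //; exact: lt_trans nS.
  have [x1 x2] := inA x x0 xn xVn; have [y1 y2] := inA y y0 yn yVn.
  have loc (z : R) : 0 < z -> n.+1%:R^-1 < z -> z < n.+1%:R -> lebesgue_pt (hn n) z ->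
     forall e, 0 < e -> \forall d \near (0 : R)^'+,
       (0 < d) /\ itg D (fun r => h r * tent z d r) /\
       (d < z) /\
       `|\int[mu]_(r in D) (h r * tent z d r) - h z| <= e.
    move=> z0 z1 z2 Lz e e0.
    have e20 : 0 < e / 2 by rewrite divr_gt0.
    have /fine_cvgP[fn /cvgrPdist_le/(_ _ e20) cv] : davg (hn n) z d @[d --> 0^'+] --> (0 : R)%:E.
      exact: Lz.
    suff core (d : R) : 0 < d -> d < z -> d < z - n.+1%:R^-1 -> d < n.+1%:R - z ->
        `|0 - fine (davg (hn n) z d)| <= e / 2 ->
        (0 < d) /\ itg D (fun r => h r * tent z d r) /\ (d < z) /\
        `|\int[mu]_(r in D) (h r * tent z d r) - h z| <= e.
      near=> d; apply: core.
      - by near: d; exact: nbhs_right_gt.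
      - by near: d; exact: nbhs_right_lt.
      - by near: d; apply: nbhs_right_lt; rewrite subr_gt0.
      - by near: d; apply: nbhs_right_lt; rewrite subr_gt0.
      - by near: d; exact: cv.
    move=> d0 dz da db Hd.
    have BA r : z - d <= r -> r <= z + d -> A n r.
      move=> h1 h2; rewrite /A /= in_itv/=; apply/andP; split.
        by apply: le_trans h1; rewrite ltW // ltrBrDl -ltrBrDr.
      by apply: (le_trans h2); rewrite ltW // -ltrBrDl.
    have BD : (`[z - d, z + d] `<=` D)%classic.
      by move=> r /=; rewrite !in_itv/= andbT => /andP[h1 _]; lra.
    have zd0 : 0 < z - d by rewrite subr_gt0.
    have out r : D r -> ~ `[z - d, z + d]%classic r -> tent z d r = 0.
      move=> _ nr; apply: tent_out => //; rewrite leNgt; apply/negP.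
      rewrite ltr_norml => /andP[h1 h2]; apply: nr; rewrite /= in_itv/=; apply/andP; split; lra.
    have PT : primitive (step z d) (tent z d).
      apply: primitive_is_derive => r r0; first exact: step_is_derive.
      exact: tent_continuous.
    have zzd : z - d <= z + d by lra.
    have [It ET] := PT _ _ zd0 zzd.
    have ET1 : \int[mu]_(r in `[z - d, z + d]) tent z d r = 1.
      by rewrite -ET step_ge // step_le // subr0.
    have Ihd : itg `[z - d, z + d] h by exact: Ih.
    have mt : measurable_fun (`[z - d, z + d]%classic : set R) (tent z d) by exact: itg_meas It.
    have tb r : 0 <= tent z d r <= d^-1 by exact: tent_bound.
    have Iht : itg `[z - d, z + d] (fun r => h r * tent z d r).
      apply: (@itg_le _ _ _ (fun r => d^-1 * `|h r|)) => //.
      - by apply: measurable_funM => //; exact: itg_meas Ihd.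
      - move=> r _; rewrite normrM mulrC ler_wpM2r // ger0_norm; by case/andP: (tb r).
      - by apply: itgZ => //; exact: itg_norm.
    have out' r : D r -> ~ `[z - d, z + d]%classic r -> h r * tent z d r = 0.
      by move=> Dr nr; rewrite out // mulr0.
    have [ID EI] := @itg_vanish `[z - d, z + d]%classic D (fun r => h r * tent z d r)
      (measurable_itv _) (measurable_itv _) BD out'.
    split; first exact: d0.
    split; first exact: ID.
    split; first exact: dz.
    rewrite EI -[X in _ - X]mulr1 -[X in _ - _ * X]ET1 -RintZ // -RintB //; last exact: itgZ.
    rewrite (@Rint_ext _ _ _ (fun r => (h r - h z) * tent z d r)); last by move=> r _; ring.
    have Ihz : itg `[z - d, z + d] (fun r => h r - h z).
      apply: itgB => //; exact: itg_cst.
    have Ihzt : itg `[z - d, z + d] (fun r => (h r - h z) * tent z d r).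
      apply: (itg_ext _ _ (itgB _ Iht (itgZ (h z) _ It))) => // r _; ring.
    apply: (le_trans (Rint_norm _ Ihzt)) => //.
    (* The tent is at most 1 / d on an interval of length 2 d, so this is twice the average of |h -
       h z|; hence the e / 2 above. *)
    apply: (@le_trans _ _ (d^-1 * \int[mu]_(r in `[z - d, z + d]) `|h r - h z|)).
      rewrite -RintZ //; last exact: itg_norm.
      apply: Rint_le => //; [exact: itg_norm|by apply: itgZ => //; exact: itg_norm|].
      move=> r _; rewrite normrM mulrC ler_wpM2r // ger0_norm; by case/andP: (tb r).
    have hz : hn n z = h z by rewrite /hn patchE mem_set //; apply: BA; lra.
    have Iball : \int[mu]_(r in `[z - d, z + d]) `|h r - h z|
       = \int[mu]_(r in ball z d) `|hn n r - hn n z|.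
      rewrite ball_itv -Rintegral_itv_obnd_cbnd; last by apply: itg_norm; apply: itg_sub Ihz => //; exact: subset_itv_oc_cc.
      rewrite -Rintegral_itv_bndo_bndc; last by apply: itg_norm; apply: itg_sub Ihz => //; exact: subset_itv_oo_cc.
      apply: Rint_ext => r /=; rewrite in_itv/= => /andP[h1 h2].
      by rewrite hz /hn patchE mem_set //; apply: BA; exact: ltW.
    have Ed : fine (davg (hn n) z d) = (d *+ 2)^-1 * \int[mu]_(r in ball z d) `|hn n r - hn n z|.
      rewrite /davg /iavg lebesgue_measure_ball ?(ltW d0) //.
      have d20 : d *+ 2 != 0 by rewrite mulrn_eq0 /= gt_eqF.
      rewrite inver (negbTE d20) /Rintegral.
      have Ib : itg (ball z d) (fun r => hn n r - hn n z).
        rewrite ball_itv; apply: (@itg_ext _ _ (fun r => h r - h z)) => //.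
          move=> r /=; rewrite in_itv/= => /andP[h1 h2].
          by rewrite hz /hn patchE mem_set //; apply: BA; exact: ltW.
        by apply: itg_sub Ihz => //; exact: subset_itv_oo_cc.
      have mb : measurable (ball z d) by rewrite ball_itv.
      have := @integrable_fin_num _ _ _ mu (ball z d) mb _ (itg_norm Ib).
      by move=> Fin; rewrite fineM //.
    rewrite Iball.
    move: Hd; rewrite sub0r normrN Ed.
    set J := \int[mu]_(r in ball z d) _.
    have J0 : 0 <= J by apply: Rint_ge0.
    rewrite ger0_norm; last by rewrite mulr_ge0 // invr_ge0 mulrn_wge0 // ltW.
    rewrite -mulr_natl invfM => h1.
    have -> : d^-1 * J = 2 * (2^-1 * d^-1 * J) by field; rewrite gt_eqF.
    lra.
  apply/eqP; rewrite -subr_eq0 -normr_le0; apply/ler_addgt0Pr => e e0; rewrite add0r.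
  have e20 : 0 < e / 2 by rewrite divr_gt0.
  near (0 : R)^'+ => d.
  have [d0 [Ix [dx Hx]]] : (0 < d) /\ itg D (fun r => h r * tent x d r) /\ (d < x) /\
      `|\int[mu]_(r in D) (h r * tent x d r) - h x| <= e / 2.
    by near: d; exact: loc.
  have [_ [Iy [dy Hy]]] : (0 < d) /\ itg D (fun r => h r * tent y d r) /\ (d < y) /\
      `|\int[mu]_(r in D) (h r * tent y d r) - h y| <= e / 2.
    by near: d; exact: loc.
  pose eta r := step x d r - step y d r.
  have deta r : is_derive r 1 eta (tent x d r - tent y d r).
    have := is_deriveB (step_is_derive x r d0) (step_is_derive y r d0).
    by [].
  have deta1 : derive1 eta = (fun r => tent x d r - tent y d r).
    by apply/funext => r; rewrite derive1E; have [_ ->] := deta r.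
  have Teta : test_function eta.
    split.
    - by move=> r; have [] := deta r.
    - rewrite deta1 => r; apply: cvgB; exact: tent_continuous.
    - exists (Num.min x y - d), (Num.max x y + d); split.
        by rewrite subr_gt0 lt_min dx dy.
      move=> r; rewrite in_itv/= negb_and -!ltNge => /orP[h1|h1].
        rewrite /eta !step_le ?subrr //.
          by move: h1; rewrite ltrBrDr lt_min => /andP[_ h2]; rewrite lerBrDr ltW.
        by move: h1; rewrite ltrBrDr lt_min => /andP[h2 _]; rewrite lerBrDr ltW.
      rewrite /eta !step_ge ?subrr //.
        by move: h1; rewrite -ltrBrDr gt_max => /andP[_ h2]; rewrite -lerBrDr ltW.
      by move: h1; rewrite -ltrBrDr gt_max => /andP[h2 _]; rewrite -lerBrDr ltW.
  have := H0 eta Teta; rewrite deta1.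
  rewrite (@Rint_ext _ _ _ (fun r => h r * tent x d r - h r * tent y d r)); last by move=> r _; ring.
  rewrite RintB // => E.
  move: Hx Hy; rewrite !ler_norml => /andP[? ?] /andP[? ?]; apply/andP; split; lra.
(* The exceptional set is null and cannot contain the unit interval; the value of [h] at any
   admissible point is the constant. *)
have [x0 [x0p Lx0]] : exists x, 0 < x /\ forall n, lebesgue_pt (hn n) x.
  apply: contrapT => nex.
  have [N [mN N0 sN]] := L.
  have sub : (`]0, 1[%classic : set R) `<=` N.
    move=> x /=; rewrite in_itv/= => /andP[x0 _]; apply: sN => /= Lx.
    by apply: nex; exists x.
  have : (mu (`]0%R, 1%R[%classic : set R) <= 0)%E.
    rewrite -[leRHS]N0; apply: le_measure => //; rewrite inE; [exact: measurable_itv|exact: mN].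
  by rewrite lebesgue_measure_itv/= lte_fin ltr01 oppr0 adde0 lee_fin leNgt ltr01.
exists (h x0).
apply: (ae_imply _ L) => x Lx x0'; exact: cmp.
Unshelve. all: by end_near. Qed.

(** If G is a primitive of [g], then f - G has weak derivative 0 and is almost everywhere
    constant. *)
Lemma weak_derivative_primitive f g : weak_derivative f g ->
  exists2 F, primitive F g & {ae mu, forall r, 0 < r -> f r = F r}.
Proof.
move=> [lf lg H].
have If a b : 0 < a -> itg `[a, b] f by exact: locally_integrable_itg.
have Ig a b : 0 < a -> itg `[a, b] g by exact: locally_integrable_itg.
have [G PG] := exists_primitive Ig.
have [c Hc] : exists c, {ae mu, forall r, 0 < r -> f r - G r = c}.
  apply: weak_derivative_const.
    move=> a b a0; apply: itgB => //; first exact: If.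
    have Ic : itg `[a, b] (fun=> 1 : R) by exact: itg_cst.
    by apply: (itg_ext _ _ (primitive_itgM PG a0 Ic)) => // r _; rewrite mulr1.
  move=> eta Te; have [deta ceta [a [b [a0 eta0]]]] := Te.
  (* The maximum covers the case b < a, and widening to a / 2 and b' + 1 makes [eta] vanish at both
     end points. *)
  pose b' := Num.max a b; pose A : set R := `[a / 2, b' + 1]%classic.
  have mA : measurable A by exact: measurable_itv.
  have ab' : a <= b' by rewrite le_max lexx.
  have bb' : b <= b' by rewrite le_max lexx orbT.
  have a20 : 0 < a / 2 by rewrite divr_gt0.
  have abA : a / 2 <= b' + 1 by lra.
  have AD : (A `<=` D)%classic.
    by move=> x; rewrite /A /= !in_itv/= andbT => /andP[ax _]; exact: lt_le_trans ax.
  have out r : ~ A r -> r \notin `[a, b].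
    move=> nA; apply/negP; rewrite in_itv/= => /andP[h1 h2]; apply: nA.
    by rewrite /A /= in_itv/=; apply/andP; split; lra.
  have deta0 r : ~ A r -> derive1 eta r = 0.
    move=> /out nr; rewrite derive1E.
    have nz : \near r, eta r = (cst 0 : R -> R) r.
      have oC : open (~` `[a, b]%classic : set R).
        by apply: closed_openC; exact: itv_closed.
      have := open_nbhs_nbhs (conj oC (negP nr)).
      by apply: filterS => s /negP/eta0.
    by rewrite (near_eq_derive _ nz) derive_cst.
  have [c _ cM] : exists2 c, c \in `[a / 2, b' + 1] & forall r, r \in `[a / 2, b' + 1] ->
      `|derive1 eta r| <= `|derive1 eta c|.
    apply: EVT_max => //; apply: continuous_subspaceT => r.
    by apply: cvg_norm; exact: ceta.
  have Ieta h : itg A h -> itg A (fun r => h r * derive1 eta r).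
    move=> Ih; apply: (@itg_le _ _ _ (fun r => `|derive1 eta c| * `|h r|)).
    - exact: measurable_itv.
    - apply: measurable_funM; first exact: itg_meas Ih.
      by apply: (measurable_funS _ AD) => //; apply: continuous_measurable_fun => r _; exact: ceta.
    - by move=> r Ar; rewrite normrM mulrC ler_wpM2r // cM.
    - by apply: itgZ => //; exact: itg_norm.
  have IG : itg A G.
    have Ic : itg A (fun=> 1 : R) by exact: itg_cst.
    by apply: (itg_ext _ _ (primitive_itgM PG a20 Ic)) => // r _; rewrite mulr1.
  have Peta := primitive_C1 (fun r _ => deta r) (fun r _ => ceta r).
  have [IP EP] := primitiveM PG Peta a20 abA.
  have eta_a : eta (a / 2) = 0.
    by apply: eta0; rewrite in_itv/= negb_and -!ltNge; apply/orP; left; lra.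
  have eta_b : eta (b' + 1) = 0.
    by apply: eta0; rewrite in_itv/= negb_and -!ltNge; apply/orP; right; lra.
  have Ige : itg A (fun r => g r * eta r).
    have := primitive_itgM Peta a20 (Ig _ (b' + 1) a20).
    by apply: itg_ext => // r _; rewrite mulrC.
  rewrite eta_a eta_b !mulr0 subrr RintD // in EP; last exact: Ieta.
  have EH : \int[mu]_(r in D) (f r * derive1 eta r) = - \int[mu]_(r in D) (g r * eta r).
    by rewrite /Rintegral (H eta Te) fineN.
  have IfA : itg A f by exact: If.
  have o1 h r : D r -> ~ A r -> h r * derive1 eta r = 0.
    by move=> _ nA; rewrite deta0 ?mulr0.
  have o2 r : D r -> ~ A r -> g r * eta r = 0.
    by move=> _ nA; rewrite eta0 ?mulr0 //; exact: out.
  have [_ V1] := @itg_vanish A D (fun r => f r * derive1 eta r) (measurable_itv _)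
    (measurable_itv _) AD (o1 _).
  have [_ V2] := @itg_vanish A D (fun r => g r * eta r) (measurable_itv _)
    (measurable_itv _) AD o2.
  have [_ V3] := @itg_vanish A D (fun r => (f r - G r) * derive1 eta r) (measurable_itv _)
    (measurable_itv _) AD (o1 _).
  rewrite V1 V2 in EH; rewrite V3.
  rewrite (@Rint_ext _ _ _ (fun r => f r * derive1 eta r - G r * derive1 eta r));
    last by move=> r _; ring.
  rewrite RintB ?EH //; [|exact: Ieta|exact: Ieta].
  by move: EP; rewrite -/A => EP; rewrite -opprD -EP oppr0.
exists (fun r => G r + c).
  apply: (primitive_ext _ _ (primitiveD PG (primitive_cst c))) => // r _.
  by rewrite addr0.
by apply: (ae_imply _ Hc) => r Hr r0; rewrite -(Hr r0) addrC subrK.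
Qed.

End WeakDerivative.

(** * The nonlinearity *)

Section RealPolynomial.
Context {R : realType}.
Implicit Types (v w : comp -> R) (r s : R).

Definition cabs v : R := Num.sqrt (\sum_i v i ^+ 2).

(** Rebuilds a spinor from its four real components, with the minus sign of -Im u1. *)
Definition mkspinor v : spinor R :=
  ((v (false, false) +i* - v (true, false))%C, (v (true, true) +i* v (false, true))%C).

Lemma spinor_abs_mkspinor v : spinor_abs (mkspinor v) = cabs v.
Proof. by rewrite /spinor_abs /cabs sum_comp /=; congr Num.sqrt; ring. Qed.

Lemma cabs_ge0 v : 0 <= cabs v. Proof. exact: sqrtr_ge0. Qed.

Lemma cabs_sqr v : cabs v ^+ 2 = \sum_i v i ^+ 2.
Proof. by rewrite sqr_sqrtr // sumr_ge0 // => i _; exact: sqr_ge0. Qed.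

Lemma cabs_le v : cabs v <= \sum_i `|v i|.
Proof.
have s0 : 0 <= \sum_i `|v i| by rewrite sumr_ge0.
rewrite -(ler_pXn2r (n := 2)) ?nnegrE ?cabs_ge0 // cabs_sqr !sum_comp.
set a := v _; set b := v _; set c := v _; set e := v _.
rewrite -(real_normK (num_real a)) -(real_normK (num_real b)).
rewrite -(real_normK (num_real c)) -(real_normK (num_real e)).
have := normr_ge0 a; have := normr_ge0 b; have := normr_ge0 c; have := normr_ge0 e.
set A := `|a|; set B := `|b|; set X := `|c|; set E := `|e| => e0 c0 b0 a0.
have := mulr_ge0 a0 b0; have := mulr_ge0 a0 c0; have := mulr_ge0 a0 e0.
have := mulr_ge0 b0 c0; have := mulr_ge0 b0 e0; have := mulr_ge0 c0 e0.
by rewrite -subr_ge0 => *; rewrite -subr_ge0; lra.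
Qed.

Lemma cabs_segment v w s rho : 0 <= s -> s <= 1 -> cabs v <= rho -> cabs w <= rho ->
  cabs (fun i => w i + s * (v i - w i)) <= rho.
Proof.
move=> s0 s1 hv hw.
have rho0 : 0 <= rho by apply: le_trans hv; exact: cabs_ge0.
have cv2 : \sum_i v i ^+ 2 <= rho ^+ 2.
  by rewrite -cabs_sqr ler_pXn2r ?nnegrE ?cabs_ge0.
have cw2 : \sum_i w i ^+ 2 <= rho ^+ 2.
  by rewrite -cabs_sqr ler_pXn2r ?nnegrE ?cabs_ge0.
rewrite -(ler_pXn2r (n := 2)) ?nnegrE ?cabs_ge0 // cabs_sqr.
apply: (@le_trans _ _ ((1 - s) * \sum_i w i ^+ 2 + s * \sum_i v i ^+ 2)).
  rewrite !mulr_sumr -big_split; apply: ler_sum => i _ /=.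
  rewrite -subr_ge0.
  have -> : (1 - s) * w i ^+ 2 + s * v i ^+ 2 - (w i + s * (v i - w i)) ^+ 2
    = s * (1 - s) * (v i - w i) ^+ 2 by ring.
  by apply: mulr_ge0; [rewrite mulr_ge0 // subr_ge0|exact: sqr_ge0].
apply: (@le_trans _ _ ((1 - s) * rho ^+ 2 + s * rho ^+ 2)); last by lra.
by apply: lerD; rewrite ler_wpM2l // subr_ge0.
Qed.

(* The inductive presentation gives by induction both the chain rule along a
   line and the one for merely absolutely continuous functions. *)
Inductive rpoly : ((comp -> R) -> R) -> ((comp -> R) -> (comp -> R) -> R) -> Prop :=
| rpoly_cst c : rpoly (fun=> c) (fun _ _ => 0)
| rpoly_var i : rpoly (fun v => v i) (fun _ w => w i)
| rpolyD P DP Q DQ : rpoly P DP -> rpoly Q DQ ->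
    rpoly (fun v => P v + Q v) (fun v w => DP v w + DQ v w)
| rpolyM P DP Q DQ : rpoly P DP -> rpoly Q DQ ->
    rpoly (fun v => P v * Q v) (fun v w => DP v w * Q v + P v * DQ v w).

Lemma rpoly_is_derive P DP (f : R -> comp -> R) (g : comp -> R) s : rpoly P DP ->
  (forall i, is_derive s 1 (fun x => f x i) (g i)) ->
  is_derive s 1 (fun x => P (f x)) (DP (f s) g).
Proof.
move=> H df; elim: H => [c|i|{}P {}DP Q DQ _ IP _ IQ|{}P {}DP Q DQ _ IP _ IQ].
- exact: is_derive_cst.
- exact: df.
- exact: is_deriveD.
- suff <- : P (f s) *: DQ (f s) g + Q (f s) *: DP (f s) g
      = DP (f s) g * Q (f s) + P (f s) * DQ (f s) g by exact: is_deriveM.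
  by rewrite /GRing.scale /=; ring.
Qed.

Lemma rpoly_primitive P DP (f fx : comp -> R -> R) : rpoly P DP ->
  (forall i, primitive (f i) (fx i)) ->
  primitive (fun r => P (fun i => f i r)) (fun r => DP (fun i => f i r) (fun i => fx i r)).
Proof.
move=> H pf; elim: H => [c|i|{}P {}DP Q DQ _ IP _ IQ|{}P {}DP Q DQ _ IP _ IQ].
- exact: primitive_cst.
- exact: pf.
- exact: primitiveD.
- exact: primitiveM.
Qed.

Lemma is_derive_line v w s i : is_derive s 1 (fun x : R => v i + x * w i) (w i).
Proof.
apply: (@quadratic_is_derive _ _ _ _ 0) => h.
by rewrite mul0r normr_le0; apply/eqP; ring.
Qed.

(** Mean value theorem along the segment from [w] to [v], which stays in the ball where the
    derivative is bounded. *)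
Lemma rpoly_lipschitz P DP rho K v w : rpoly P DP -> cabs v <= rho -> cabs w <= rho ->
  (forall z y, cabs z <= rho -> `|DP z y| <= K * cabs y) ->
  `|P v - P w| <= K * cabs (fun i => v i - w i).
Proof.
move=> H hv hw HK.
pose y i := v i - w i; pose g (s : R) := P (fun i => w i + s * y i).
have dg (s : R) : is_derive s 1 g (DP (fun i => w i + s * y i) y).
  by apply: (rpoly_is_derive (f := fun s i => w i + s * y i) H) => i; exact: is_derive_line.
have cg : {within `[0, 1], continuous g}.
  apply: continuous_subspaceT => s; apply: differentiable_continuous.
  by apply/derivable1_diffP; have [] := dg s.
have [c] := MVT_segment ler01 (fun s _ => dg s) cg.
  rewrite in_itv/= => /andP[c0 c1].
  rewrite subr0 mulr1 /g => E; rewrite (_ : P v = P (fun i => w i + 1 * y i)); last first.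
    by congr P; apply/funext => i; rewrite /y mul1r addrC subrK.
  rewrite {2}(_ : w = fun i => w i + 0 * y i); last by apply/funext => i; rewrite mul0r addr0.
  rewrite E; apply: HK; exact: cabs_segment.
Qed.

Definition cpoly (f : (comp -> R) -> R[i]) := exists P Q DP DQ,
  [/\ rpoly P DP, rpoly Q DQ & forall v, f v = (P v +i* Q v)%C].

Lemma cpoly_cst c : cpoly (fun=> c).
Proof.
exists (fun=> complex.Re c), (fun=> complex.Im c), (fun _ _ => 0), (fun _ _ => 0).
by split; [exact: rpoly_cst|exact: rpoly_cst|case: c].
Qed.

Lemma cpolyD f g : cpoly f -> cpoly g -> cpoly (fun v => f v + g v).
Proof.
move=> [P [Q [DP [DQ [hP hQ fE]]]]] [P' [Q' [DP' [DQ' [hP' hQ' gE]]]]].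
do 4 eexists; split; [exact: (rpolyD hP hP')|exact: (rpolyD hQ hQ')|].
by move=> v; rewrite fE gE.
Qed.

Lemma cpolyM f g : cpoly f -> cpoly g -> cpoly (fun v => f v * g v).
Proof.
move=> [P [Q [DP [DQ [hP hQ fE]]]]] [P' [Q' [DP' [DQ' [hP' hQ' gE]]]]].
do 4 eexists; split.
- exact: (rpolyD (rpolyM hP hP') (rpolyM (rpoly_cst (-1)) (rpolyM hQ hQ'))).
- exact: (rpolyD (rpolyM hP hQ') (rpolyM hQ hP')).
- move=> v; rewrite fE gE; apply/eqP; rewrite eq_complex /=.
  by apply/andP; split; apply/eqP; ring.
Qed.

Lemma cpolyX f n : cpoly f -> cpoly (fun v => f v ^+ n).
Proof.
move=> hf; elim: n => [|n IH]; first exact: (cpoly_cst 1).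
by rewrite (_ : (fun v => _) = fun v => f v * f v ^+ n);
  [exact: cpolyM|apply/funext => v; rewrite exprS].
Qed.

Lemma cpoly_sum (I : Type) (s : seq I) (f : I -> (comp -> R) -> R[i]) :
  (forall i, cpoly (f i)) -> cpoly (fun v => \sum_(i <- s) f i v).
Proof.
move=> hf; elim: s => [|i s IH].
  by rewrite (_ : (fun v => _) = fun=> 0); [exact: cpoly_cst|apply/funext => v; rewrite big_nil].
rewrite (_ : (fun v => _) = fun v => f i v + \sum_(i <- s) f i v).
  exact: cpolyD.
by apply/funext => v; rewrite big_cons.
Qed.

Lemma cpoly_prod (I : Type) (s : seq I) (f : I -> (comp -> R) -> R[i]) :
  (forall i, cpoly (f i)) -> cpoly (fun v => \prod_(i <- s) f i v).
Proof.
move=> hf; elim: s => [|i s IH].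
  by rewrite (_ : (fun v => _) = fun=> 1); [exact: cpoly_cst|apply/funext => v; rewrite big_nil].
rewrite (_ : (fun v => _) = fun v => f i v * \prod_(i <- s) f i v).
  exact: cpolyM.
by apply/funext => v; rewrite big_cons.
Qed.

Lemma cpoly_nl_eval (W : nonlinearity R) : cpoly (fun v => nl_eval W (mkspinor v)).
Proof.
rewrite (_ : (fun v => _) = (fun v => \sum_(mm <- mpoly.msupp W)
    mpoly.mcoeff mm W * \prod_(k < 4)
      (nth 0 [:: (mkspinor v).1; ((mkspinor v).1^*)%C; (mkspinor v).2; ((mkspinor v).2^*)%C] k)
        ^+ (mpoly.fun_of_multinom mm k))); last first.
  by apply/funext => v; rewrite /nl_eval /eval4 mpoly.mevalE.
apply: cpoly_sum => mm; apply: cpolyM; first exact: cpoly_cst.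
apply: cpoly_prod => k; apply: cpolyX.
have var i : cpoly (fun v => (v i)%:C%C).
  by exists (fun v => v i), (fun=> 0), (fun _ w => w i), (fun _ _ => 0);
    split; [exact: rpoly_var|exact: rpoly_cst|].
have E a b c : cpoly (fun v => (v a)%:C%C + c * (v b)%:C%C).
  by apply: cpolyD => //; apply: cpolyM => //; exact: cpoly_cst.
case: k => -[|[|[|[|//]]]] ? /=.
- rewrite (_ : (fun v => _) = fun v => (v (false, false))%:C%C + - 'i%C * (v (true, false))%:C%C) //.
  by apply/funext => v; apply/eqP; rewrite eq_complex /=; apply/andP; split; apply/eqP; ring.
- rewrite (_ : (fun v => _) = fun v => (v (false, false))%:C%C + 'i%C * (v (true, false))%:C%C) //.
  by apply/funext => v; apply/eqP; rewrite eq_complex /=; apply/andP; split; apply/eqP; ring.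
- rewrite (_ : (fun v => _) = fun v => (v (true, true))%:C%C + 'i%C * (v (false, true))%:C%C) //.
  by apply/funext => v; apply/eqP; rewrite eq_complex /=; apply/andP; split; apply/eqP; ring.
- rewrite (_ : (fun v => _) = fun v => (v (true, true))%:C%C + - 'i%C * (v (false, true))%:C%C) //.
  by apply/funext => v; apply/eqP; rewrite eq_complex /=; apply/andP; split; apply/eqP; ring.
Qed.

Lemma normc_Re (z : R[i]) : `|complex.Re z| <= Normc.normc z.
Proof.
case: z => a b /=; rewrite -sqrtr_sqr ler_sqrt ?lerDl ?sqr_ge0 //.
by rewrite addr_ge0 ?sqr_ge0.
Qed.

Lemma normc_Im (z : R[i]) : `|complex.Im z| <= Normc.normc z.
Proof.
case: z => a b /=; rewrite -sqrtr_sqr ler_sqrt ?lerDr ?sqr_ge0 //.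
by rewrite addr_ge0 ?sqr_ge0.
Qed.

Lemma normc_ge0 (z : R[i]) : 0 <= Normc.normc z.
Proof. by apply: le_trans (normc_Re z). Qed.

(** Replaces the real exponent of the hypotheses by an integer one, which is possible since only
    |phi| < 1 is considered. *)
Lemma powR_le_expr (x p : R) n : 0 <= x -> x < 1 -> n%:R <= p -> (0 < n)%N -> x `^ p <= x ^+ n.
Proof.
move=> x0 x1 np n0; rewrite -powR_mulrn //.
move: x0; rewrite le_eqVlt => /predU1P[<-|x0].
  rewrite !powR0 //; first by rewrite pnatr_eq0 -lt0n.
  by rewrite gt_eqF // (lt_le_trans _ np) // ltr0n.
by apply: ger_powR => //; rewrite x0 ltW.
Qed.

(** [P] lists the components of -i W in the coordinates of [mkspinor], because the equation is
    solved for the time derivative. One power of |v| is split off so that each bound is a small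
    factor times |v| or |w|. *)
Lemma nonlinearity_components (W1 W2 : nonlinearity R) (C p : R) (q : nat) :
  0 < C -> (0 < q)%N -> q.+1%:R <= p -> nl_bound C p W1 W2 -> nl_derivative_bound C p W1 W2 ->
  exists (P : comp -> (comp -> R) -> R) (DP : comp -> (comp -> R) -> (comp -> R) -> R),
  [/\ forall i, rpoly (P i) (DP i),
      forall v, nl_eval W1 (mkspinor v) = (P (true, false) v +i* P (false, false) v)%C
        /\ nl_eval W2 (mkspinor v) = (- P (false, true) v +i* P (true, true) v)%C,
      forall i v, cabs v < 1 -> `|P i v| <= C * cabs v ^+ q * cabs v &
      forall i v w, cabs v < 1 -> `|DP i v w| <= C * cabs v ^+ q * cabs w].
Proof.
move=> C0 q0 qp hW hdW.
have [P1 [Q1 [DP1 [DQ1 [hP1 hQ1 E1]]]]] := cpoly_nl_eval W1.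
have [P2 [Q2 [DP2 [DQ2 [hP2 hQ2 E2]]]]] := cpoly_nl_eval W2.
pose P (i : comp) : (comp -> R) -> R := if i.1 then (if i.2 then Q2 else P1)
  else (if i.2 then (fun v => -1 * P2 v) else Q1).
pose DP (i : comp) : (comp -> R) -> (comp -> R) -> R := if i.1 then (if i.2 then DQ2 else DP1)
  else (if i.2 then (fun v w => 0 * P2 v + -1 * DP2 v w) else DQ1).
exists P, DP; split.
- by case=> [[] []]; rewrite /P /DP //=; exact: (rpolyM (rpoly_cst (-1)) hP2).
- by move=> v; rewrite E1 E2 /P /= mulN1r opprK.
- move=> i v v1; have := hW (mkspinor v); rewrite spinor_abs_mkspinor => /(_ v1).
  rewrite -mulrA -exprSr => H.
  have {}H : Normc.normc (nl_eval W1 (mkspinor v)) + Normc.normc (nl_eval W2 (mkspinor v))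
      <= C * cabs v ^+ q.+1.
    by apply: (le_trans H); rewrite ler_pM2l // powR_le_expr ?cabs_ge0.
  have n1 := normc_ge0 (nl_eval W1 (mkspinor v)); have n2 := normc_ge0 (nl_eval W2 (mkspinor v)).
  have := normc_Re (nl_eval W1 (mkspinor v)); have := normc_Im (nl_eval W1 (mkspinor v)).
  have := normc_Re (nl_eval W2 (mkspinor v)); have := normc_Im (nl_eval W2 (mkspinor v)).
  rewrite {1 3}E2 {1 3}E1 /= => h1 h2 h3 h4.
  by case: i => [[] []]; rewrite /P /= ?mulN1r ?normrN; lra.
- move=> i v w v1.
  (* This path has value [v] and derivative [w] at s = 1. The derivative bound is applied there, 1
     being a positive radius. *)
  pose f (s : R) (i : comp) := (v i - w i) + s * w i.
  have f1 : f 1 = v by apply/funext => j; rewrite /f mul1r subrK.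
  have df j : is_derive (1 : R) 1 (fun s => f s j) (w j) by exact: (is_derive_line (fun j => v j - w j)).
  have := hdW (fun s => mkspinor (f s)) 1 ltr01.
  have d1 (g : R -> R) l : is_derive (1 : R) 1 g l -> derivable g 1 1 /\ derive1 g 1 = l.
    by move=> [? ?]; rewrite derive1E.
  have [dff eff] := d1 _ _ (df (false, false)); have [dft eft] := d1 _ _ (df (false, true)).
  have [dtt ett] := d1 _ _ (df (true, true)).
  have [dtf etf] : derivable (fun s => - f s (true, false)) 1 1 /\
      derive1 (fun s => - f s (true, false)) 1 = - w (true, false).
    by apply: d1; exact: is_deriveN.
  have -> : (cderive (fun s => (mkspinor (f s)).1) 1, cderive (fun s => (mkspinor (f s)).2) 1)
      = mkspinor w.
    by rewrite /cderive /= eff eft ett etf.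
  rewrite !spinor_abs_mkspinor f1.
  have dP Pi DPi : rpoly Pi DPi -> derive1 (fun s => Pi (f s)) 1 = DPi v w.
    by move=> h; have [_ ->] := d1 _ _ (rpoly_is_derive h df); rewrite f1.
  have -> : cderive (fun s => nl_eval W1 (mkspinor (f s))) 1 = (DP1 v w +i* DQ1 v w)%C.
    rewrite /cderive -(dP _ _ hP1) -(dP _ _ hQ1); congr (derive1 _ 1 +i* derive1 _ 1)%C;
      by apply/funext => s; rewrite E1.
  have -> : cderive (fun s => nl_eval W2 (mkspinor (f s))) 1 = (DP2 v w +i* DQ2 v w)%C.
    rewrite /cderive -(dP _ _ hP2) -(dP _ _ hQ2); congr (derive1 _ 1 +i* derive1 _ 1)%C;
      by apply/funext => s; rewrite E2.
  move=> /(_ (conj dff dtf) (conj dtt dft) v1) H.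
  have {}H : Normc.normc (DP1 v w +i* DQ1 v w)%C + Normc.normc (DP2 v w +i* DQ2 v w)%C
      <= C * cabs v ^+ q * cabs w.
    apply: (le_trans H); rewrite ler_wpM2r ?cabs_ge0 // ler_pM2l //.
    by apply: powR_le_expr => //; [exact: cabs_ge0|by rewrite lerBrDr natr1].
  have n1 := normc_ge0 (DP1 v w +i* DQ1 v w)%C; have n2 := normc_ge0 (DP2 v w +i* DQ2 v w)%C.
  have := normc_Re (DP1 v w +i* DQ1 v w)%C; have := normc_Im (DP1 v w +i* DQ1 v w)%C.
  have := normc_Re (DP2 v w +i* DQ2 v w)%C; have := normc_Im (DP2 v w +i* DQ2 v w)%C.
  move=> h1 h2 h3 h4; move: H n1 n2 h1 h2 h3 h4.
  set N1 := Normc.normc _; set N2 := Normc.normc _; move=> H n1 n2 /= h1 h2 h3 h4.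
  by case: i => [[] []]; rewrite /DP /= ?mul0r ?add0r ?mulN1r ?normrN; lra.
Qed.

End RealPolynomial.

(** * Radial spinors *)

Section AlmostEverywhere.
Context {R : realType}.
Notation mu := (@lebesgue_measure R).
Local Notation D := (`]0, +oo[%classic : set R).
Implicit Types (f g : R -> R) (r : R).

Lemma Rint_ae (A : set R) f g : measurable A -> measurable_fun A f -> measurable_fun A g ->
  (\forall r \ae mu, A r -> f r = g r) -> \int[mu]_(r in A) f r = \int[mu]_(r in A) g r.
Proof.
move=> mA mf mg fg; congr fine.
apply: (@ae_eq_integral _ _ _ mu A (EFin \o g) (EFin \o f)) => //.
- exact/measurable_realfun.measurable_EFinP.
- exact/measurable_realfun.measurable_EFinP.
- by apply: (ae_imply _ fg) => r fgr Ar /=; rewrite fgr.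
Qed.

Lemma itg_ae (A : set R) f g : measurable A -> itg A f -> measurable_fun A g ->
  (\forall r \ae mu, A r -> f r = g r) -> itg A g.
Proof.
move=> mA If mg fg; apply/integrableP; split; first exact/measurable_realfun.measurable_EFinP.
have /integrableP[mf fi] := If.
rewrite (_ : integral _ _ _ = (\int[mu]_(x in A) `|(f x)%:E|)%E) //.
apply: (@ae_eq_integral _ _ _ mu A (fun x => `|(f x)%:E|)%E (fun x => `|(g x)%:E|)%E) => //.
- by apply: measurableT_comp => //; exact/measurable_realfun.measurable_EFinP.
- exact: measurableT_comp.
- by apply: (ae_imply _ fg) => r fgr Ar /=; rewrite fgr.
Qed.

Lemma L2_ae f g : L2 f -> measurable_fun D g -> (\forall r \ae mu, D r -> f r = g r) -> L2 g.
Proof.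
move=> [mf If] mg fg; split => //; apply: (itg_ae _ If) => //.
  exact: measurable_funX.
by apply: (ae_imply _ fg) => r fgr Ar; rewrite fgr.
Qed.

Lemma nrm_ae f g : measurable_fun D f -> measurable_fun D g ->
  (\forall r \ae mu, D r -> f r = g r) -> nrm f = nrm g.
Proof.
move=> mf mg fg; congr Num.sqrt; apply: Rint_ae => //; [exact: measurable_funX|exact: measurable_funX|].
by apply: (ae_imply _ fg) => r fgr Ar; rewrite fgr.
Qed.

Lemma Rint_eq0_ae (A : set R) f : measurable A -> itg A f -> (forall r, A r -> 0 <= f r) ->
  \int[mu]_(r in A) f r = 0 -> \forall r \ae mu, A r -> f r = 0.
Proof.
move=> mA If f0 If0.
have fin := @integrable_fin_num _ _ _ mu A mA _ If.
have E : (\int[mu]_(x in A) `|(f x)%:E| = 0)%E.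
  rewrite -[RHS]/(0%:E) -If0 fineK //.
  apply: eq_integral => x /set_mem Ax; by rewrite /= ger0_norm // f0.
have [H _] := @ae_eq_integral_abs _ _ _ mu A mA (EFin \o f) (proj1 (integrableP _ _ _ If)).
by apply: (ae_imply _ (H E)) => r + Ar => /(_ Ar) [].
Qed.

(** A violation at one point would persist on a nonempty interval, which is not a null set. *)
Lemma ae_continuous_le f c : (forall r, 0 < r -> {for r, continuous f}) ->
  (\forall r \ae mu, 0 < r -> f r <= c) -> forall r, 0 < r -> f r <= c.
Proof.
move=> cf [N [mN N0 sN]] r r0; rewrite leNgt; apply/negP => cfr.
have /(cf r r0) : nbhs (f r) [set y | c < y] by exact: lt_nbhsr.
rewrite nbhs_simpl /= => -[e /= e0 He].
have sub : (`]r, r + e[%classic : set R) `<=` N.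
  move=> x /=; rewrite in_itv/= => /andP[rx xe]; apply: sN => /= Hx.
  have /He /= : ball r e x by rewrite /ball /= distrC gtr0_norm ?subr_gt0 // ltrBlDl.
  by rewrite ltNge Hx // (lt_trans r0 rx).
have : (mu (`]r, (r + e)%R[%classic : set R) <= 0)%E.
  rewrite -[leRHS]N0; apply: le_measure => //; rewrite inE; [exact: measurable_itv|exact: mN].
rewrite lebesgue_measure_itv/= lte_fin ltrDl e0 -EFinD lee_fin => h.
by move: h; rewrite addrAC subrr add0r leNgt e0.
Qed.

End AlmostEverywhere.

(** * Weighted norms of spinors in terms of their profiles *)

Section SpinorNorms.
Context {R : realType}.
Notation mu := (@lebesgue_measure R).
Local Notation D := (`]0, +oo[%classic : set R).
Implicit Types (r : R) (Psi : radial R).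

Definition coord (z : spinor R) (i : comp) : R :=
  if i.1 then (if i.2 then complex.Re z.2 else - complex.Im z.1)
  else (if i.2 then complex.Im z.2 else complex.Re z.1).

Lemma coordK z : mkspinor (coord z) = z.
Proof. by case: z => [[a b] [c e]]; rewrite /mkspinor /coord /= opprK. Qed.

Lemma coordB (z y : spinor R) i : coord (z - y) i = coord z i - coord y i.
Proof.
by case: z => [[? ?] [? ?]]; case: y => [[? ?] [? ?]]; case: i => [[] []]; rewrite /coord //=; ring.
Qed.

Lemma spinor_absE z : spinor_abs z = cabs (coord z).
Proof. by rewrite -{1}(coordK z) spinor_abs_mkspinor. Qed.

(** The factor sqrt r turns the planar measure r dr into dr. *)
Definition profile Psi (i : comp) r : R := Num.sqrt r * coord (Psi r) i.

Lemma measurable_sqrt : measurable_fun D (@Num.sqrt R).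
Proof. by apply: continuous_measurable_fun => r _; exact: sqrt_continuous. Qed.

Lemma measurable_coord Psi i : componentwise (fun f : R -> R => measurable_fun D f) Psi ->
  measurable_fun D (fun r => coord (Psi r) i).
Proof.
move=> [m1 m2 m3 m4]; case: i => [[] []]; rewrite /coord //=.
exact: measurableT_comp.
Qed.

Lemma measurable_profile Psi i : componentwise (fun f : R -> R => measurable_fun D f) Psi ->
  measurable_fun D (profile Psi i).
Proof.
by move=> mP; apply: measurable_funM; [exact: measurable_sqrt|exact: measurable_coord].
Qed.

Lemma profile_sqr Psi r : 0 < r ->
  spinor_abs (Psi r) ^+ 2 * r = \sum_i profile Psi i r ^+ 2.
Proof.
move=> r0; rewrite spinor_absE cabs_sqr mulr_suml; apply: eq_bigr => i _.
by rewrite /profile exprMn sqr_sqrtr ?ltW // mulrC.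
Qed.

Lemma L2norm_itg (g : R -> R) : measurable_fun D g -> (L2norm `]0%R, +oo[ g < +oo)%E ->
  itg D (fun r => g r ^+ 2 * r).
Proof.
move=> mg h; apply/integrableP; split.
  apply/measurable_realfun.measurable_EFinP; apply: measurable_funM; last exact: measurable_id.
  exact: measurable_funX.
apply: le_lt_trans (lty_poweRy _ h); last by rewrite invr_eq0.
rewrite le_eqVlt; apply/orP; left; apply/eqP; apply: eq_integral => r.
rewrite inE /= in_itv/= andbT => r0.
by rewrite ger0_norm // mulr_ge0 ?sqr_ge0 // ltW.
Qed.

Lemma L2norm_Rint (A : set R) (g : R -> R) : measurable A -> A `<=` D ->
  itg A (fun r => g r ^+ 2 * r) ->
  L2norm A g = (Num.sqrt (\int[mu]_(r in A) (g r ^+ 2 * r)))%:E.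
Proof.
move=> mA AD Ig; rewrite /L2norm -(fineK (@integrable_fin_num _ _ _ mu A mA _ Ig)).
rewrite poweR_EFin powR12_sqrt //; apply: Rint_ge0 => r /AD /=.
by rewrite in_itv/= andbT => r0; rewrite mulr_ge0 ?sqr_ge0 // ltW.
Qed.

Lemma L2norm_lt (g : R -> R) e : measurable_fun D g -> 0 < e -> (L2norm `]0%R, +oo[ g < e%:E)%E ->
  itg D (fun r => g r ^+ 2 * r) /\ \int[mu]_(r in D) (g r ^+ 2 * r) <= e ^+ 2.
Proof.
move=> mg e0 h.
have Ig : itg D (fun r => g r ^+ 2 * r).
  by apply: L2norm_itg => //; apply: (lt_trans h); exact: ltry.
split => //; move: h; rewrite L2norm_Rint // lte_fin => h.
rewrite -ler_sqrt ?exprn_ge0 ?(ltW e0) // sqrtr_sqr gtr0_norm //; exact: ltW.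
Qed.

Lemma measurable_spinor_abs Psi : componentwise (fun f : R -> R => measurable_fun D f) Psi ->
  measurable_fun D (fun r => spinor_abs (Psi r)).
Proof.
move=> mP; rewrite (_ : (fun r => _) = Num.sqrt \o (fun r => \sum_i coord (Psi r) i ^+ 2)).
  apply: measurableT_comp; first by apply: measurable_realfun.continuous_measurable_fun; exact: sqrt_continuous.
  by apply: measurable_sum => i; apply: measurable_funX; exact: measurable_coord.
by apply/funext => r; rewrite spinor_absE.
Qed.

Lemma in_L2_profile Psi i : in_L2 Psi -> L2 (profile Psi i).
Proof.
move=> [mP hP]; split; first exact: measurable_profile.
have Ig := L2norm_itg (measurable_spinor_abs mP) hP.
apply: (itg_le _ _ _ Ig) => //; first by apply: measurable_funX; exact: measurable_profile.
move=> r; rewrite /= in_itv/= andbT => r0; rewrite profile_sqr // ger0_norm ?sqr_ge0 //.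
by apply: (le_sum_comp (f := fun i => profile Psi i r ^+ 2)) => j; exact: sqr_ge0.
Qed.

Lemma sL2normE Psi (A : set R) : in_L2 Psi -> measurable A -> A `<=` D ->
  sL2norm A Psi = (Num.sqrt (\sum_i \int[mu]_(r in A) (profile Psi i r ^+ 2)))%:E.
Proof.
move=> hP mA AD.
have Ip i : itg A (fun r => profile Psi i r ^+ 2).
  by apply: itg_sub (proj2 (in_L2_profile i hP)).
have E r : A r -> \sum_i profile Psi i r ^+ 2 = spinor_abs (Psi r) ^+ 2 * r.
  by move=> /AD /=; rewrite in_itv/= andbT => r0; rewrite profile_sqr.
rewrite /sL2norm L2norm_Rint //; last first.
  by apply: (itg_ext _ E) => //; exact: itg_sum.
rewrite -Rint_sum //; congr (Num.sqrt _)%:E.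
by apply: Rint_ext => r /E.
Qed.

Lemma nrm_le_sL2norm Psi i : componentwise (fun f : R -> R => measurable_fun D f) Psi ->
  ((nrm (profile Psi i))%:E <= sL2norm `]0%R, +oo[ Psi)%E.
Proof.
move=> mP; have [h|] := ltP (sL2norm `]0%R, +oo[ Psi) +oo%E; last first.
  by rewrite leye_eq => /eqP ->; rewrite leey.
have hP : in_L2 Psi by [].
rewrite sL2normE // lee_fin /nrm ler_sqrt.
  apply: (le_sum_comp (f := fun i => \int[mu]_(r in D) (profile Psi i r ^+ 2))) => j.
  by apply: Rint_ge0 => r _; exact: sqr_ge0.
by apply: sumr_ge0 => j _; apply: Rint_ge0 => r _; exact: sqr_ge0.
Qed.

Lemma nrm_cvg0 (T : Type) (F : set_system T) (FF : Filter F) (Psi : T -> radial R) i :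
  (forall h, componentwise (fun f : R -> R => measurable_fun D f) (Psi h)) ->
  sL2norm `]0%R, +oo[ (Psi h) @[h --> F] --> 0%E ->
  nrm (profile (Psi h) i) @[h --> F] --> (0 : R).
Proof.
move=> mP H.
suff /fine_cvgP[_ //] : (nrm (profile (Psi h) i))%:E @[h --> F] --> 0%E.
apply: (squeeze_cvge (f := fun=> 0%E) (h := fun h => sL2norm `]0%R, +oo[ (Psi h))) => //.
- by near=> h; rewrite lee_fin nrm_ge0 /= nrm_le_sL2norm.
- exact: cvg_cst.
Unshelve. all: by end_near. Qed.

End SpinorNorms.

(** * Absolutely continuous representatives and their decay *)

Section Representative.
Context {R : realType}.
Notation mu := (@lebesgue_measure R).
Local Notation D := (`]0, +oo[%classic : set R).
Implicit Types (f g : R -> R) (a r x e : R) (Psi : radial R).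

(** [small_value] applied to g^2 x^2, on a window whose logarithmic length exceeds the integral
    divided by [e]. *)
Lemma small_tail g e a : itg D (fun x => g x ^+ 2 * x) -> 0 < e -> 0 < a ->
  exists x, a <= x /\ g x ^+ 2 < e.
Proof.
move=> Ig e0 a0.
pose K := \int[mu]_(x in D) `|g x ^+ 2 * x ^+ 2 / x|.
pose b := Num.max a 1.
have b1 : 1 <= b by rewrite le_max lexx orbT.
have b0 : 0 < b by apply: lt_le_trans b1.
have ab : a <= b by rewrite le_max lexx.
pose L := expR ((K + 1) / e).
have K0 : 0 <= K by apply: Rint_ge0.
have L1 : 1 <= L by rewrite -expR0 ler_expR divr_ge0 ?(ltW e0) // addr_ge0.
have [] := @small_value _ (fun x => g x ^+ 2 * x ^+ 2) e b (b * L) _ e0 b0.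
- apply: (itg_ext _ _ Ig) => // x /=; rewrite in_itv/= andbT => x0.
  by field; rewrite gt_eqF.
- by rewrite ler_peMr // ltW.
- rewrite -/K lnM ?posrE ?expR_gt0 // addrAC subrr add0r expRK mulrC divfK ?gt_eqF //.
  by rewrite ltrDl.
move=> x [/andP[bx _]]; rewrite ger0_norm => [H|]; last by apply: mulr_ge0; exact: sqr_ge0.
exists x; split; first exact: le_trans bx.
by apply: le_lt_trans H; rewrite ler_peMr ?sqr_ge0 // exprn_ege1 // (le_trans b1).
Qed.

(** Radial Sobolev inequality: f(a)^2 is at most f(b)^2 plus the integral of f^2 + f'^2 from a to b.
    Monotonicity lets the weight enter the integral, and b is taken far out where [f] is small. *)
Lemma radial_decay f fx (q : R -> R) a : primitive f fx -> 0 < a -> 0 < q a ->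
  (forall x, a <= x -> q a <= q x) -> (forall x, 0 < x -> x <= q x) ->
  itg D (fun x => q x * f x ^+ 2) -> itg D (fun x => q x * fx x ^+ 2) ->
  f a ^+ 2 * q a <= \int[mu]_(x in D) (q x * f x ^+ 2) + \int[mu]_(x in D) (q x * fx x ^+ 2).
Proof.
move=> pf a0 qa0 qinc qx If Ifx.
set E := _ + _.
have mf := primitive_measurable pf.
apply/ler_addgt0Pr => e e0.
have eq0 : 0 < e / q a by rewrite divr_gt0.
have [b [ab fb]] : exists x, a <= x /\ f x ^+ 2 < e / q a.
  apply: small_tail => //; apply: (itg_le _ _ _ If) => //.
    by apply: measurable_funM; [exact: measurable_funX|exact: measurable_id].
  move=> x /=; rewrite in_itv/= andbT => x0.
  rewrite ger0_norm; last by apply: mulr_ge0; [exact: sqr_ge0|exact: ltW].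
  by rewrite mulrC ler_wpM2r ?sqr_ge0 // qx.
have [I2 E2] := primitiveM pf pf a0 ab.
have sub : (`[a, b] `<=` D)%classic.
  by move=> x /=; rewrite !in_itv/= andbT => /andP[ax _]; exact: lt_le_trans ax.
have Iq : itg D (fun x => q x * f x ^+ 2 + q x * fx x ^+ 2) by exact: itgD.
have q0 x : 0 < x -> 0 <= q x by move=> x0; apply: le_trans (qx x x0); exact: ltW.
have Iqab : itg `[a, b] (fun x => q x * f x ^+ 2 + q x * fx x ^+ 2) by exact: itg_sub Iq.
have H1 : q a * (f a * f a - f b * f b) <= E.
  have -> : q a * (f a * f a - f b * f b) = - q a * (f b * f b - f a * f a) by ring.
  rewrite E2 -RintZ // /E -RintD //.
  apply: (@le_trans _ _ (\int[mu]_(x in `[a, b]) (q x * f x ^+ 2 + q x * fx x ^+ 2))).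
    apply: Rint_le => //; first exact: itgZ.
    move=> x /=; rewrite in_itv/= => /andP[ax _].
    apply: (@le_trans _ _ (q a * (f x ^+ 2 + fx x ^+ 2))).
      rewrite mulNr -mulrN ler_pM2l // -subr_ge0.
      rewrite (_ : _ - _ = (f x + fx x) ^+ 2); last by ring.
      exact: sqr_ge0.
    by rewrite -mulrDr ler_wpM2r ?addr_ge0 ?sqr_ge0 // qinc.
  apply: Rint_subset => // x /=; rewrite in_itv/= andbT => x0.
  by rewrite addr_ge0 // mulr_ge0 ?sqr_ge0 ?q0.
have H2 : q a * (f b * f b) <= e.
  by rewrite -expr2 mulrC -ler_pdivlMr // ltW.
move: H1 H2; rewrite mulrBr expr2 [f a * f a * _]mulrC; lra.
Qed.

Variables (delta d : R).
Hypothesis d0 : 0 < d.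
Hypothesis d4 : d <= 1 / 4.
Hypothesis ddelta : d <= delta.

(** The square of the weight of E(delta), times the planar factor r. *)
Let wt r := (japanese r `^ (delta / 2)) ^+ 2 * r.

Let jap1 r : 1 <= japanese r.
Proof. by rewrite /japanese -{1}sqrtr1 ler_sqrt ?lerDl ?addr_ge0 ?sqr_ge0. Qed.

Let jap0 r : 0 < japanese r. Proof. exact: lt_le_trans (jap1 r). Qed.

Let japE r : (japanese r `^ (delta / 2)) ^+ 2 = japanese r `^ delta.
Proof. by rewrite -powR_mulrn ?powR_ge0 // -powRrM divfK. Qed.

Let wt_inc a x : 0 < a -> a <= x -> wt a <= wt x.
Proof.
move=> a0 ax; rewrite /wt !japE; apply: ler_pM => //; [exact: powR_ge0|exact: ltW|].
apply: ge0_ler_powR; rewrite ?nnegrE ?(ltW (jap0 _)) //; first by apply: le_trans ddelta; exact: ltW.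
rewrite /japanese ler_sqrt ?addr_ge0 ?sqr_ge0 // lerD2l ler_pXn2r ?nnegrE ?(ltW a0) //.
by apply: le_trans ax; exact: ltW.
Qed.

Let wt_ge r : 0 < r -> r <= wt r.
Proof.
move=> r0; rewrite /wt japE ler_peMl ?(ltW r0) //.
have <- : 1 `^ delta = 1 :> R by rewrite powR1.
apply: ge0_ler_powR; rewrite ?nnegrE //.
- by apply: le_trans ddelta; exact: ltW.
- exact: ltW.
Qed.

(** From (1 + r)^(1 + d) <= (2 r)^(1 + d) <= 4 r^(1 + d), and from r^d <= <r>^delta because d <=
    delta. *)
Let wt_wgt r : 1 <= r -> 1 <= 4 * wt r * wgt d r.
Proof.
move=> r1; have r0 : 0 < r by exact: lt_le_trans r1.
have h1 : 0 < 1 + r by rewrite addr_gt0.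
rewrite /wgt powRN ler_pdivlMr ?powR_gt0 // mul1r.
have ge_r : r <= japanese r.
  rewrite /japanese -[leLHS]gtr0_norm // -sqrtr_sqr ler_sqrt ?lerDr //.
  by rewrite addr_ge0 ?sqr_ge0.
have hj : r `^ d <= japanese r `^ delta.
  apply: (@le_trans _ _ (japanese r `^ d)).
    by apply: ge0_ler_powR; rewrite ?nnegrE ?(ltW d0) ?(ltW r0) ?(ltW (jap0 _)).
  exact: ler_powR.
apply: (@le_trans _ _ ((2 * r) `^ (1 + d))).
  apply: ge0_ler_powR; rewrite ?nnegrE ?addr_ge0 ?mulr_ge0 ?(ltW d0) ?(ltW r0) //.
  by rewrite mulr2n mulrDl mul1r lerD2r.
rewrite powRM ?(ltW r0) // /wt japE; apply: ler_pM; rewrite ?powR_ge0 //.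
  apply: (@le_trans _ _ (2 `^ 2)).
    by apply: ler_powR; [rewrite ler1n|move: d4; lra].
  by rewrite powR_mulrn // -natrX ler_nat.
rewrite powRD ?powRr1 ?(ltW r0) ?(gt_eqF r0) ?implybT // mulrC.
by rewrite ler_pM2r.
Qed.

Let wgt_small r : 0 < r -> r <= 1 -> 1 <= 4 * wgt d r.
Proof.
move=> r0 r1; have h1 : 0 < 1 + r by rewrite addr_gt0.
rewrite /wgt powRN ler_pdivlMr ?powR_gt0 // mul1r.
apply: (@le_trans _ _ (2 `^ (1 + d))).
  apply: ge0_ler_powR; rewrite ?nnegrE ?addr_ge0 ?(ltW d0) ?(ltW r0) //.
  by rewrite mulr2n lerD2l.
apply: (@le_trans _ _ (2 `^ 2)).
  by apply: ler_powR; [rewrite ler1n|move: d4; lra].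
by rewrite powR_mulrn // -natrX ler_nat.
Qed.

Let measurable_jap : measurable_fun D (fun r => japanese r `^ (delta / 2)).
Proof.
rewrite (_ : (fun r => _) = (@powR R ^~ (delta / 2)) \o (@japanese R)) //.
apply: measurableT_comp; first exact: measurable_powR.
apply: measurableT_comp.
  by apply: measurable_realfun.continuous_measurable_fun; exact: sqrt_continuous.
by apply: measurable_funD; [exact: measurable_cst|apply: measurable_funX; exact: measurable_id].
Qed.

Let weighted_bound Psi i e :
  componentwise (fun f : R -> R => measurable_fun D f) Psi -> 0 < e ->
  (L2norm `]0%R, +oo[ (fun r => japanese r `^ (delta / 2) * spinor_abs (Psi r))%R < e%:E)%E ->
  itg D (fun r => wt r * coord (Psi r) i ^+ 2) /\
  \int[mu]_(r in D) (wt r * coord (Psi r) i ^+ 2) <= e ^+ 2.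
Proof.
move=> mP e0 H.
have [] := L2norm_lt _ e0 H.
  by apply: measurable_funM; [exact: measurable_jap|exact: measurable_spinor_abs].
move=> I1 I2.
have le r : D r -> wt r * coord (Psi r) i ^+ 2
    <= (japanese r `^ (delta / 2) * spinor_abs (Psi r)) ^+ 2 * r.
  rewrite /= in_itv/= andbT => r0.
  rewrite exprMn /wt mulrAC ler_wpM2r ?(ltW r0) // ler_wpM2l ?sqr_ge0 //.
  rewrite spinor_absE cabs_sqr.
  by apply: (le_sum_comp (f := fun j => coord (Psi r) j ^+ 2)) => j; exact: sqr_ge0.
have ge0 r : D r -> 0 <= wt r * coord (Psi r) i ^+ 2.
  rewrite /= in_itv/= andbT => r0; rewrite mulr_ge0 ?sqr_ge0 //.
  by apply: le_trans (wt_ge r0); exact: ltW.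
have I3 : itg D (fun r => wt r * coord (Psi r) i ^+ 2).
  apply: (itg_le _ _ _ I1) => //.
    apply: measurable_funM; last by apply: measurable_funX; exact: measurable_coord.
    by apply: measurable_funM; [exact: measurable_funX|exact: measurable_id].
  by move=> r Dr; rewrite ger0_norm; [exact: le|exact: ge0].
split => //; apply: le_trans I2; exact: Rint_le.
Qed.

Lemma coord_primitive Psi i : componentwise weakly_derivable Psi ->
  exists2 f, primitive f (fun r => coord (dr Psi r) i) &
    \forall r \ae mu, 0 < r -> coord (Psi r) i = f r.
Proof.
have W (g : R -> R) : weakly_derivable g -> exists2 f, primitive f (wderive g) &
    \forall r \ae mu, 0 < r -> g r = f r.
  move=> h; apply: weak_derivative_primitive.
  exact: (@xgetPex _ _ [set g' | weak_derivative g g'] h).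
move=> [h1 h2 h3 h4]; case: i => [[] []]; rewrite /coord /=; [exact: W| |exact: W|exact: W].
have [f pf fE] := W _ h2; exists (fun r => - f r); first exact: primitiveN.
by apply: (ae_imply _ fE) => r H r0; rewrite H.
Qed.

(** The pointwise bound has two regimes: for r > 1, [radial_decay] gives f^2 wt <= 2 e^2, and 1 <= 4
    wt wgt produces the 8; for r <= 1 the supremum norm and 1 <= 4 wgt suffice. *)
Lemma regular_representative Psi e : in_E delta Psi -> 0 < e ->
  (ELinfnorm delta Psi < e%:E)%E ->
  exists f : comp -> R -> R, forall i,
  [/\ primitive (f i) (fun r => coord (dr Psi r) i),
      \forall r \ae mu, 0 < r -> coord (Psi r) i = f i r,
      forall r, 0 < r -> f i r ^+ 2 <= 8 * e ^+ 2 * wgt d r,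
      itg D (fun r => r * f i r ^+ 2) /\ \int[mu]_(r in D) (r * f i r ^+ 2) <= e ^+ 2 &
      itg D (fun r => r * coord (dr Psi r) i ^+ 2) /\
      \int[mu]_(r in D) (r * coord (dr Psi r) i ^+ 2) <= e ^+ 2].
Proof.
move=> [[[mP _] wP [mdP _]] _] e0 H.
suff K i : exists f,
  [/\ primitive f (fun r => coord (dr Psi r) i),
      \forall r \ae mu, 0 < r -> coord (Psi r) i = f r,
      forall r, 0 < r -> f r ^+ 2 <= 8 * e ^+ 2 * wgt d r,
      itg D (fun r => r * f r ^+ 2) /\ \int[mu]_(r in D) (r * f r ^+ 2) <= e ^+ 2 &
      itg D (fun r => r * coord (dr Psi r) i ^+ 2) /\
      \int[mu]_(r in D) (r * coord (dr Psi r) i ^+ 2) <= e ^+ 2].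
  by have [f Hf] := choice K; exists f.
have [f pf fE] := coord_primitive i wP; exists f.
have muT : (0 < mu [set: R])%E.
  by rewrite (_ : mu _ = +oo%E) ?ltry // -set_itvNyy lebesgue_measure_itv.
have Li0 : (0 <= Linfnorm Psi)%E.
  apply: ess_sup_gee => //; apply: aeW => r; rewrite /= lee_fin patchE; case: ifP => // _.
  exact: sqrtr_ge0.
have N0 (g : R -> R) : (0 <= L2norm `]0%R, +oo[ g)%E by exact: poweR_ge0.
have [Hdr HPsi HLi] : [/\
    (L2norm `]0%R, +oo[ (fun r => japanese r `^ (delta / 2) * spinor_abs (dr Psi r))%R < e%:E)%E,
    (L2norm `]0%R, +oo[ (fun r => japanese r `^ (delta / 2) * spinor_abs (Psi r))%R < e%:E)%E &
    (Linfnorm Psi <= e%:E)%E].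
  move: H; rewrite /ELinfnorm /Enorm; set A := L2norm _ _; set B := L2norm _ _ => H.
  have A0 : (0 <= A)%E by exact: N0.
  have B0 : (0 <= B)%E by exact: N0.
  split.
  - by apply: le_lt_trans H; rewrite -addeA leeDl // adde_ge0.
  - by apply: le_lt_trans H; rewrite addeAC leeDr // adde_ge0.
  - by apply: ltW; apply: le_lt_trans H; rewrite leeDr // adde_ge0.
have [Id Ed] := weighted_bound i mdP e0 Hdr.
have [Ic Ec] := weighted_bound i mP e0 HPsi.
have mf := primitive_measurable pf.
have mfx := primitive_measurable_derivative pf.
have mwt : measurable_fun D wt.
  by apply: measurable_funM; [exact: measurable_funX|exact: measurable_id].
have mwf : measurable_fun D (fun r => wt r * f r ^+ 2).
  by apply: measurable_funM => //; exact: measurable_funX.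
have wfE : \forall r \ae mu, D r -> wt r * coord (Psi r) i ^+ 2 = wt r * f r ^+ 2.
  by apply: (ae_imply _ fE) => r h /=; rewrite in_itv/= andbT => /h ->.
have If : itg D (fun r => wt r * f r ^+ 2) by exact: (itg_ae _ Ic).
have Ef : \int[mu]_(r in D) (wt r * f r ^+ 2) <= e ^+ 2.
  by rewrite -(Rint_ae _ _ _ wfE) //; exact: itg_meas Ic.
have weak (g : R -> R) : measurable_fun D g -> itg D (fun r => wt r * g r ^+ 2) ->
    \int[mu]_(r in D) (wt r * g r ^+ 2) <= e ^+ 2 ->
    itg D (fun r => r * g r ^+ 2) /\ \int[mu]_(r in D) (r * g r ^+ 2) <= e ^+ 2.
  move=> mg Ig Eg.
  have le r : D r -> r * g r ^+ 2 <= wt r * g r ^+ 2.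
    by rewrite /= in_itv/= andbT => r0; rewrite ler_wpM2r ?sqr_ge0 // wt_ge.
  have I1 : itg D (fun r => r * g r ^+ 2).
    apply: (itg_le _ _ _ Ig) => //.
      by apply: measurable_funM; [exact: measurable_id|exact: measurable_funX].
    move=> r Dr; rewrite ger0_norm; first exact: le.
    by move: Dr; rewrite /= in_itv/= andbT => r0; rewrite mulr_ge0 ?sqr_ge0 ?(ltW r0).
  by split => //; apply: le_trans Eg; exact: Rint_le.
have cf r : 0 < r -> {for r, continuous f} by exact: primitive_continuous pf.
have fsmall r : 0 < r -> f r ^+ 2 <= e ^+ 2.
  move: r; apply: (@ae_continuous_le _ (fun r => f r ^+ 2)).
    move=> r r0; have c := cf r r0.
    rewrite (_ : (fun r => _) = fun r => f r * f r); last by apply/funext => x; rewrite expr2.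
    exact: cvgM.
  have /ess_supP := HLi.
  have fE2 := ae_and fE.
  move=> hess; apply: (ae_imply _ (fE2 _ hess)) => x [h1 h2] x0.
  rewrite -(h1 x0) -real_normK ?num_real // ler_pXn2r ?nnegrE ?(ltW e0) //.
  move: h2; rewrite /= patchE mem_set /=; last by rewrite in_itv/= x0.
  rewrite lee_fin spinor_absE => h2; apply: le_trans h2.
  rewrite -(ler_pXn2r (n := 2)) ?nnegrE ?cabs_ge0 // cabs_sqr real_normK ?num_real //.
  by apply: (le_sum_comp (f := fun j => coord (Psi x) j ^+ 2)) => j; exact: sqr_ge0.
split => //; [|exact: weak|exact: weak].
move=> r r0; have w0 := wgt_gt0 d r0; have e20 : 0 < e ^+ 2 by rewrite exprn_gt0.
have [r1|r1] := leP r 1.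
  have h := wgt_small r0 r1; have fs := fsmall r r0.
  apply: (le_trans fs); rewrite -mulrA [8 * _]mulrC -mulrA ler_peMr ?(ltW e20) //.
  by move: h; lra.
have wt0 : 0 < wt r by apply: lt_le_trans (wt_ge r0).
have := @radial_decay f _ wt r pf r0 wt0 (fun x => wt_inc r0) wt_ge If Id.
move=> h; have h2 := wt_wgt (ltW r1).
have h3 : f r ^+ 2 * wt r <= 2 * e ^+ 2 by move: h Ef Ed; lra.
apply: (@le_trans _ _ (f r ^+ 2 * (4 * wt r * wgt d r))); first by rewrite ler_peMr ?sqr_ge0.
have -> : f r ^+ 2 * (4 * wt r * wgt d r) = (f r ^+ 2 * wt r) * (4 * wgt d r) by ring.
have -> : 8 * e ^+ 2 * wgt d r = (2 * e ^+ 2) * (4 * wgt d r) by ring.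
by rewrite ler_wpM2r // mulr_ge0 // ltW.
Qed.

End Representative.

(** * The system for u = sqrt r * phi *)

Section Regularized.
Context {R : realType}.
Notation mu := (@lebesgue_measure R).
Local Notation D := (`]0, +oo[%classic : set R).
Implicit Types (f fx g : comp -> R -> R) (r : R) (i : comp).

Definition udir f i r : R := Num.sqrt r * f i r.
Definition uder f fx i r : R := Num.sqrt r * fx i r + udir f i r / (2 * r).

Lemma primitive_sqrt : primitive (@Num.sqrt R) (fun r => Num.sqrt r / (2 * r)).
Proof.
have E r : 0 < r -> (2 * Num.sqrt r)^-1 = Num.sqrt r / (2 * r).
  move=> r0; rewrite -{3}(sqr_sqrtr (ltW r0)).
  by field; rewrite gt_eqF ?sqrtr_gt0.
apply: (@primitive_ext _ _ _ (fun r => (2 * Num.sqrt r)^-1)) => //.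
apply: primitive_is_derive => r r0.
apply: cvgV; first by rewrite mulf_neq0 // gt_eqF // sqrtr_gt0.
by apply: cvgM; [exact: cvg_cst|exact: sqrt_continuous].
Qed.

Lemma primitive_udir (g gx : R -> R) : primitive g gx ->
  primitive (fun r => Num.sqrt r * g r)
    (fun r => Num.sqrt r * gx r + Num.sqrt r * g r / (2 * r)).
Proof.
move=> pg; apply: (primitive_ext _ _ (primitiveM primitive_sqrt pg)) => // r _; ring.
Qed.

Variables (P : comp -> (comp -> R) -> R) (DP : comp -> (comp -> R) -> (comp -> R) -> R).
Variables (C : R) (n : nat) (N : R -> R).
Hypothesis C0 : 0 < C.
Hypothesis hP : forall i, rpoly (P i) (DP i).
Hypothesis P_bound : forall i v, cabs v < 1 -> `|P i v| <= C * cabs v ^+ n.*2 * cabs v.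
Hypothesis DP_bound : forall i v w, cabs v < 1 -> `|DP i v w| <= C * cabs v ^+ n.*2 * cabs w.
Hypothesis N0 : forall r, 0 < r -> 0 <= N r.
Hypothesis N1 : forall r, 0 < r -> N r < 1.

(* In terms of [u = sqrt r * phi] the nonlinearity is [sqrt r * W(phi)]. *)
Definition ndir f i r : R := Num.sqrt r * P i (fun j => f j r).
Definition nder f fx i r : R :=
  Num.sqrt r * DP i (fun j => f j r) (fun j => fx j r) + ndir f i r / (2 * r).
(** [N] bounds the square of |phi|, hence the exponent [n] here against [n.*2] in the hypotheses. *)
Definition theta r : R := C * N r ^+ n.

Definition admissible f := forall r, 0 < r -> cabs (fun j => f j r) ^+ 2 <= N r.

Lemma admissible_lt1 f r : admissible f -> 0 < r -> cabs (fun j => f j r) < 1.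
Proof.
move=> af r0; rewrite -(ltr_pXn2r (n := 2)) ?nnegrE ?cabs_ge0 // expr1n.
exact: le_lt_trans (af r r0) (N1 r0).
Qed.

Lemma theta_ge0 r : 0 < r -> 0 <= theta r.
Proof. by move=> r0; rewrite mulr_ge0 ?(ltW C0) // exprn_ge0 // N0. Qed.

Lemma cabs_theta f r : admissible f -> 0 < r ->
  C * cabs (fun j => f j r) ^+ n.*2 <= theta r.
Proof.
move=> af r0; rewrite /theta ler_pM2l // -mul2n exprM.
by apply: lerXn2r; rewrite ?nnegrE ?N0 ?exprn_ge0 ?cabs_ge0 // af.
Qed.

Lemma sqrt_sum f r : 0 < r -> Num.sqrt r * \sum_j `|f j r| = \sum_j `|udir f j r|.
Proof.
move=> r0; rewrite mulr_sumr; apply: eq_bigr => j _.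
by rewrite /udir normrM ger0_norm ?sqrtr_ge0.
Qed.

Lemma ndir_le f i r : admissible f -> 0 < r ->
  `|ndir f i r| <= theta r * \sum_j `|udir f j r|.
Proof.
move=> af r0; rewrite /ndir normrM (ger0_norm (sqrtr_ge0 _)) -sqrt_sum // mulrCA.
apply: ler_wpM2l; first exact: sqrtr_ge0.
apply: le_trans (P_bound i (admissible_lt1 af r0)) _.
apply: ler_pM; rewrite ?cabs_ge0 ?cabs_le ?cabs_theta //.
by rewrite mulr_ge0 ?(ltW C0) // exprn_ge0 ?cabs_ge0.
Qed.

Lemma ndir_lipschitz f g i r : admissible f -> admissible g -> 0 < r ->
  `|ndir f i r - ndir g i r| <= theta r * \sum_j `|udir f j r - udir g j r|.
Proof.
move=> af ag r0; rewrite /ndir -mulrBr normrM (ger0_norm (sqrtr_ge0 _)).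
have -> : \sum_j `|udir f j r - udir g j r| = Num.sqrt r * \sum_j `|f j r - g j r|.
  rewrite mulr_sumr; apply: eq_bigr => j _.
  by rewrite /udir -mulrBr normrM ger0_norm ?sqrtr_ge0.
rewrite mulrCA; apply: ler_wpM2l; first exact: sqrtr_ge0.
have le_sqrtN h : admissible h -> cabs (fun j => h j r) <= Num.sqrt (N r).
  move=> ah; rewrite -(ler_pXn2r (n := 2)) ?nnegrE ?cabs_ge0 ?sqrtr_ge0 //.
  by rewrite (sqr_sqrtr (N0 r0)); exact: ah.
apply: (@le_trans _ _ (theta r * cabs (fun j => f j r - g j r))).
  apply: (rpoly_lipschitz (rho := Num.sqrt (N r)) (hP i)); [exact: le_sqrtN|exact: le_sqrtN|].
  move=> z y hz.
  have hz2 : cabs z ^+ 2 <= N r.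
    by rewrite -[leRHS]sqr_sqrtr ?N0 // lerXn2r ?nnegrE ?cabs_ge0 ?sqrtr_ge0.
  have z1 : cabs z < 1.
    rewrite -(ltr_pXn2r (n := 2)) ?nnegrE ?cabs_ge0 // expr1n.
    exact: le_lt_trans hz2 (N1 r0).
  apply: le_trans (DP_bound i y z1) _; rewrite ler_wpM2r ?cabs_ge0 // /theta ler_pM2l //.
  by rewrite -mul2n exprM lerXn2r ?nnegrE ?N0 ?exprn_ge0 ?cabs_ge0.
by rewrite ler_wpM2l ?theta_ge0 // cabs_le.
Qed.

(** Half of u / r comes from ndir / (2 r), and the other half from writing sqrt r * fx as [uder]
    minus udir / (2 r); together they give the coefficient 1. *)
Lemma nder_le f fx i r : admissible f -> 0 < r ->
  `|nder f fx i r| <= theta r * \sum_j (`|uder f fx j r| + `|udir f j r / r|).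
Proof.
move=> af r0; have th0 := theta_ge0 r0; have sr0 := sqrtr_ge0 r.
have h1 : `|Num.sqrt r * DP i (fun j => f j r) (fun j => fx j r)|
    <= theta r * \sum_j `|Num.sqrt r * fx j r|.
  have -> : \sum_j `|Num.sqrt r * fx j r| = Num.sqrt r * \sum_j `|fx j r|.
    by rewrite mulr_sumr; apply: eq_bigr => j _; rewrite normrM ger0_norm.
  rewrite normrM ger0_norm // mulrCA; apply: ler_wpM2l => //.
  apply: le_trans (DP_bound i _ (admissible_lt1 af r0)) _.
  apply: ler_pM; rewrite ?cabs_ge0 ?cabs_le ?cabs_theta //.
  by rewrite mulr_ge0 ?(ltW C0) // exprn_ge0 ?cabs_ge0.
have h2 : `|ndir f i r / (2 * r)| <= theta r * \sum_j `|udir f j r / r| / 2.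
  rewrite normrM (gtr0_norm (x := (2 * r)^-1)) ?invr_gt0 ?mulr_gt0 //.
  rewrite ler_pdivrMr ?mulr_gt0 // -mulrA mulr_suml.
  apply: (le_trans (ndir_le i af r0)); rewrite ler_wpM2l //.
  rewrite le_eqVlt; apply/orP; left; apply/eqP; apply: eq_bigr => j _.
  rewrite (normrM _ r^-1) (gtr0_norm (x := r^-1)) ?invr_gt0 //.
  by field; rewrite gt_eqF.
apply: (le_trans (ler_normD _ _)); apply: (le_trans (lerD h1 h2)).
rewrite -mulrDr ler_wpM2l // -big_split; apply: ler_sum => j _ /=.
have : `|Num.sqrt r * fx j r| <= `|uder f fx j r| + `|udir f j r / r| / 2.
  have -> : Num.sqrt r * fx j r = uder f fx j r - (udir f j r / r) / 2.
    by rewrite /uder; field; rewrite gt_eqF.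
  by apply: (le_trans (ler_normB _ _)); rewrite (normrM _ 2^-1) (gtr0_norm (x := 2^-1)).
lra.
Qed.

Lemma primitive_ndir f fx i : (forall j, primitive (f j) (fx j)) ->
  primitive (ndir f i) (nder f fx i).
Proof. by move=> pf; apply: primitive_udir; exact: rpoly_primitive. Qed.

Variables (S : int) (m : R).
Hypothesis hS1 : S != -1.
Hypothesis hS0 : S != 0.
Local Notation k := (S%:~R + 1 / 2 : R).

(** Differentiating the factor sqrt r subtracts 1 / (2 r) from both coefficients, which turns (S +
    1) / r and - S / r into k / r and - k / r with k = S + 1/2. *)
Lemma coord_equation (W1 W2 : nonlinearity R) (z zx zt : spinor R) r f fx : 0 < r ->
  (forall v, nl_eval W1 (mkspinor v) = (P (true, false) v +i* P (false, false) v)%C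
        /\ nl_eval W2 (mkspinor v) = (- P (false, true) v +i* P (true, true) v)%C) ->
  (forall i, coord z i = f i r) -> (forall i, coord zx i = fx i r) ->
  'i%C * zt.1 = zx.2 + (((S + 1)%:~R / r)%:C)%C * z.2 - (m%:C)%C * z.1 + nl_eval W1 z ->
  'i%C * zt.2 = - (zx.1 - ((S%:~R / r)%:C)%C * z.1) + (m%:C)%C * z.2 + nl_eval W2 z ->
  forall i, Num.sqrt r * coord zt i = dirac k m (udir f) (uder f fx) i r + ndir f i r.
Proof.
move=> r0 HP zf zxf.
have [-> ->] : nl_eval W1 z = (P (true, false) (f^~ r) +i* P (false, false) (f^~ r))%C
    /\ nl_eval W2 z = (- P (false, true) (f^~ r) +i* P (true, true) (f^~ r))%C.
  have -> : z = mkspinor (f^~ r) by rewrite -(coordK z); congr mkspinor; apply/funext => j.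
  exact: HP.
have := zf (false, false); have := zf (false, true); have := zf (true, false); have := zf (true, true).
have := zxf (false, false); have := zxf (false, true); have := zxf (true, false); have := zxf (true, true).
case: z {zf} => [[a1 b1] [a2 b2]]; case: zx {zxf} => [[ax1 bx1] [ax2 bx2]].
case: zt => [[c1 e1] [c2 e2]]; rewrite /coord /=.
move=> Ex4 Ex3 Ex2 Ex1 E4 E3 E2 E1 [H1 H2] [H3 H4] i.
rewrite intrD in H1 H2.
have rn0 : r != 0 by rewrite gt_eqF.
rewrite /dirac /uder /udir /ndir /kap /ep /sg /ta.
case: i => [[] []] /=; rewrite -?Ex1 -?Ex2 -?Ex3 -?Ex4 -?E1 -?E2 -?E3 -?E4;
  move: H1 H2 H3 H4; set p1 := P (true, false) _; set p2 := P (false, false) _;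
  set p3 := P (false, true) _; set p4 := P (true, true) _ => H1 H2 H3 H4.
- have -> : c2 = - (bx1 - S%:~R / r * b1) + m * b2 + p4 by move: H4; lra.
  by field.
- have -> : e1 = - (ax2 + (S%:~R + 1) / r * a2 - m * a1 + p1) by move: H1; lra.
  by field.
- have -> : e2 = (ax1 - S%:~R / r * a1) - m * a2 + p3 by move: H3; lra.
  by field.
- have -> : c1 = bx2 + (S%:~R + 1) / r * b2 - m * b1 + p2 by move: H2; lra.
  by field.
Qed.

End Regularized.

(** * Profiles of solutions have u / r in L^2 *)

Section SobolevProfiles.
Context {R : realType}.
Notation mu := (@lebesgue_measure R).
Local Notation D := (`]0, +oo[%classic : set R).
Implicit Types (r : R) (i j : comp).

Variables (P : comp -> (comp -> R) -> R) (DP : comp -> (comp -> R) -> (comp -> R) -> R).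
Variables (C : R) (n : nat) (N : R -> R) (S : int) (m : R).
Hypothesis C0 : 0 < C.
Hypothesis hP : forall i, rpoly (P i) (DP i).
Hypothesis P_bound : forall i v, cabs v < 1 -> `|P i v| <= C * cabs v ^+ n.*2 * cabs v.
Hypothesis DP_bound : forall i v w, cabs v < 1 -> `|DP i v w| <= C * cabs v ^+ n.*2 * cabs w.
Hypothesis N0 : forall r, 0 < r -> 0 <= N r.
Hypothesis N1 : forall r, 0 < r -> N r < 1.
Hypothesis theta1 : forall r, 0 < r -> theta C n N r <= 1.
Hypothesis hS1 : S != -1.
Hypothesis hS0 : S != 0.
Local Notation k := (S%:~R + 1 / 2 : R).

Variables (f fx g : comp -> R -> R).
Hypothesis pf : forall j, primitive (f j) (fx j).
Hypothesis af : admissible N f.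
Hypothesis If : forall j, itg D (fun r => r * f j r ^+ 2).
Hypothesis Ifx : forall j, itg D (fun r => r * fx j r ^+ 2).

Let sqr_sqrtM (h : R -> R) r : D r -> r * h r ^+ 2 = (Num.sqrt r * h r) ^+ 2.
Proof. by rewrite /= in_itv/= andbT => r0; rewrite exprMn sqr_sqrtr // ltW. Qed.

Lemma L2_sqrtM (h : R -> R) : measurable_fun D h -> itg D (fun r => r * h r ^+ 2) ->
  L2 (fun r => Num.sqrt r * h r).
Proof.
move=> mh Ih; split; first by apply: measurable_funM => //; exact: measurable_sqrt.
by apply: (itg_ext _ _ Ih) => // r; exact: sqr_sqrtM.
Qed.

Lemma L2_udir j : L2 (udir f j).
Proof. by apply: L2_sqrtM => //; exact: primitive_measurable (pf j). Qed.

Let L2_sum_norm (h : comp -> R -> R) : (forall j, L2 (h j)) -> L2 (fun r => \sum_j `|h j r|).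
Proof. by move=> Lh; apply: L2_sum => j; exact: L2_norm (Lh j). Qed.

Let le_sum (h g0 : R -> R) r : 0 < r -> 0 <= h r -> `|g0 r| <= theta C n N r * h r ->
  `|g0 r| <= 1 * `|h r|.
Proof.
move=> r0 h0 H; apply: (le_trans H); rewrite (ger0_norm h0); apply: ler_wpM2r => //.
exact: theta1.
Qed.

Let m_ndir i : measurable_fun D (ndir P f i).
Proof. by have := primitive_measurable (primitive_ndir hP i pf). Qed.

Lemma L2_ndir i : L2 (ndir P f i).
Proof.
apply: (@L2_le _ (fun r => \sum_j `|udir f j r|) _ 1) => //; last exact: (L2_sum_norm L2_udir).
move=> r r0; apply: (le_sum (h := fun r => \sum_j `|udir f j r|)) => //; first exact: sumr_ge0.
exact: (ndir_le C0 P_bound N0 N1).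
Qed.

Hypothesis Lg : forall i, L2 (g i).
Hypothesis eqn : forall i, \forall r \ae mu, 0 < r ->
  g i r = dirac k m (udir f) (uder f fx) i r + ndir P f i r.

(** The equation is solved for u / r. Once sqrt r * fx is separated, its coefficient is kap + 1/2,
    that is S + 1 or - S, nonzero by the two exclusions on [S]; all other terms are in L^2. *)
Lemma L2_udir_inv j : L2 (fun r => udir f j r / r).
Proof.
pose i := sg j; pose kk := kap k i + 1 / 2.
have kk0 : kk != 0.
  rewrite /kk /kap; case: ifP => _.
    by rewrite opprD subrK oppr_eq0 intr_eq0.
  rewrite -addrA (_ : 1 / 2 + 1 / 2 = 1%:~R :> R); last by rewrite mulr1z; field.
  by rewrite -intrD intr_eq0 addr_eq0.
have Lfx a : L2 (fun r => Num.sqrt r * fx a r).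
  by apply: L2_sqrtM => //; exact: primitive_measurable_derivative (pf a).
have mu_inv : measurable_fun D (fun r => kk * (udir f j r / r)).
  apply: measurable_funM; first exact: measurable_cst.
  by apply: measurable_funM; [by case: (L2_udir j)|exact: measurable_inv].
have L : L2 (fun r => g i r - Num.sqrt r * fx j r - (m * ep i) * udir f (ta i) r - ndir P f i r).
  by apply: L2B; [apply: L2B; [apply: L2B|apply: L2Z; exact: L2_udir]|exact: L2_ndir].
have Lk : L2 (fun r => kk * (udir f j r / r)).
  apply: (L2_ae L) => //; apply: (ae_imply _ (eqn i)) => r H.
  rewrite /= in_itv/= andbT => r0; rewrite H // /dirac /uder /i sgK -/i /kk.
  by field; rewrite gt_eqF.
apply: L2_ext (L2Z kk^-1 Lk) => r r0.
by rewrite mulrA mulVf // mul1r.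
Qed.

Lemma sob_udir j : sob (udir f j) (uder f fx j).
Proof.
split; [exact: primitive_udir (pf j)|exact: L2_udir| |exact: L2_udir_inv].
have L1 := L2_sqrtM (primitive_measurable_derivative (pf j)) (Ifx j).
apply: L2_ext (L2D L1 (L2Z (1 / 2) (L2_udir_inv j))) => r r0.
by rewrite /uder; field; rewrite gt_eqF.
Qed.

Lemma sob_ndir i : sob (ndir P f i) (nder P DP f fx i).
Proof.
have pn := primitive_ndir hP i pf.
have mi : measurable_fun D (fun r : R => r^-1) by exact: measurable_inv.
split; [exact: pn|exact: L2_ndir| |].
- apply: (@L2_le _ (fun r => \sum_j (`|uder f fx j r| + `|udir f j r / r|)) _ 1).
  + exact: primitive_measurable_derivative pn.
  + move=> r r0; apply: (le_sum (h := fun r => \sum_j (`|uder f fx j r| + `|udir f j r / r|))) => //.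
      by apply: sumr_ge0 => j _; rewrite addr_ge0.
    exact: nder_le.
  + apply: L2_sum => j; have [_ _ L1 L2'] := sob_udir j.
    by apply: L2D; exact: L2_norm.
- apply: (@L2_le _ (fun r => \sum_j `|udir f j r / r|) _ 1).
  + by apply: measurable_funM.
  + move=> r r0; apply: (le_sum (h := fun r => \sum_j `|udir f j r / r|) (g0 := fun r => ndir P f i r / r)) => //.
      exact: sumr_ge0.
    rewrite normrM (gtr0_norm (x := r^-1)) ?invr_gt0 // ler_pdivrMr // -mulrA mulr_suml.
    apply: (le_trans (ndir_le C0 P_bound N0 N1 i af r0)).
    rewrite ler_wpM2l ?theta_ge0 //; apply: ler_sum => j _.
    by rewrite (normrM _ r^-1) (gtr0_norm (x := r^-1)) ?invr_gt0 // divfK // gt_eqF.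
  + exact: (L2_sum_norm L2_udir_inv).
Qed.

End SobolevProfiles.

(** * Time derivatives of profiles *)

Section TimeDerivative.
Context {R : realType}.
Notation mu := (@lebesgue_measure R).
Local Notation D := (`]0, +oo[%classic : set R).
Implicit Types (r t h : R) (i j : comp) (phi phit : R -> radial R).

Definition quotient phi phit t h : radial R := fun r =>
  (((h^-1)%:C)%C * ((phi (t + h) r).1 - (phi t r).1) - (phit t r).1,
   ((h^-1)%:C)%C * ((phi (t + h) r).2 - (phi t r).2) - (phit t r).2).

Lemma componentwise_coord (Psi : radial R) :
  (forall i, measurable_fun D (fun r => coord (Psi r) i)) ->
  componentwise (fun f : R -> R => measurable_fun D f) Psi.
Proof.
move=> mc; split; [exact: (mc (false, false))| |exact: (mc (true, true))|exact: (mc (false, true))].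
rewrite (_ : (fun r => _) = (fun r => 0 - coord (Psi r) (true, false))).
  by apply: measurable_funB => //; exact: measurable_cst.
by apply/funext => r; rewrite /coord /= sub0r opprK.
Qed.

Lemma in_L2_measurable (Psi : radial R) i : in_L2 Psi -> measurable_fun D (fun r => coord (Psi r) i).
Proof. by move=> [mP _]; exact: measurable_coord. Qed.

Lemma coord_quotient phi phit t h r i : coord (quotient phi phit t h r) i
  = h^-1 * (coord (phi (t + h) r) i - coord (phi t r) i) - coord (phit t r) i.
Proof.
rewrite /quotient; case: (phi (t + h) r) => [[a1 b1] [a2 b2]].
case: (phi t r) => [[c1 e1] [c2 e2]]; case: (phit t r) => [[f1 g1] [f2 g2]].
by case: i => [[] []]; rewrite /coord /=; ring.
Qed.

Lemma profile_quotient phi phit t h r i : profile (quotient phi phit t h) i r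
  = h^-1 * (profile (phi (t + h)) i r - profile (phi t) i r) - profile (phit t) i r.
Proof. rewrite /profile coord_quotient; ring. Qed.

Lemma profileB (Psi Chi : radial R) r i :
  profile (fun r => Psi r - Chi r) i r = profile Psi i r - profile Chi i r.
Proof. by rewrite /profile coordB mulrBr. Qed.

Lemma profile_derivative phi phit t i : (forall s, in_L2 (phi s)) -> in_L2 (phit t) ->
  L2_time_derivative phi phit ->
  nrm (fun r => h^-1 * (profile (phi (t + h)) i r - profile (phi t) i r)
        - profile (phit t) i r) @[h --> 0^'] --> (0 : R).
Proof.
move=> Lphi Lphit /(_ t) H.
have := @nrm_cvg0 _ _ _ _ (fun h => quotient phi phit t h) i _ H.
rewrite (_ : (fun h => nrm _) = (fun h => nrm (fun r => h^-1 *
    (profile (phi (t + h)) i r - profile (phi t) i r) - profile (phit t) i r))); last first.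
  by apply/funext => h; congr nrm; apply/funext => r; rewrite profile_quotient.
apply => h; apply: componentwise_coord => j.
rewrite (_ : (fun r => _) = (fun r => h^-1 * (coord (phi (t + h) r) j - coord (phi t r) j)
    - coord (phit t r) j)); last by apply/funext => r; rewrite coord_quotient.
apply: measurable_funB; last exact: in_L2_measurable.
apply: measurable_funM; first exact: measurable_cst.
by apply: measurable_funB; exact: in_L2_measurable.
Qed.

(** Both are L^2 limits of the same difference quotients. It identifies the derivative that
    satisfies the equation with the one that is continuous in time. *)
Lemma profile_derivative_unique phi phit phit' t i : (forall s, in_L2 (phi s)) ->
  in_L2 (phit t) -> in_L2 (phit' t) ->
  L2_time_derivative phi phit -> L2_time_derivative phi phit' ->
  nrm (fun r => profile (phit t) i r - profile (phit' t) i r) = 0.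
Proof.
move=> Lphi L1 L2' H1 H2; apply/eqP; rewrite eq_le nrm_ge0 andbT.
apply/ler_addgt0Pr => e e0; rewrite add0r.
have e20 : 0 < e / 2 by rewrite divr_gt0.
have /cvgrPdist_le/(_ _ e20) K1 := profile_derivative i Lphi L1 H1.
have /cvgrPdist_le/(_ _ e20) K2 := profile_derivative i Lphi L2' H2.
near (0 : R)^' => h.
have : `|0 - nrm (fun r => h^-1 * (profile (phi (t + h)) i r - profile (phi t) i r)
        - profile (phit t) i r)| <= e / 2 by near: h; exact: K1.
have : `|0 - nrm (fun r => h^-1 * (profile (phi (t + h)) i r - profile (phi t) i r)
        - profile (phit' t) i r)| <= e / 2 by near: h; exact: K2.
rewrite !sub0r !normrN !(ger0_norm (nrm_ge0 _)).
set q := fun r : R => h^-1 * (profile (phi (t + h)) i r - profile (phi t) i r).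
have Lq : L2 q by apply: L2Z; apply: L2B; exact: in_L2_profile.
have P1 : L2 (profile (phit t) i) by exact: in_L2_profile.
have P2 : L2 (profile (phit' t) i) by exact: in_L2_profile.
move=> h1 h2.
have h3 := nrmB_trans P1 Lq P2.
apply: (le_trans h3); rewrite nrmBC.
by move: h1 h2; rewrite /q; lra.
Unshelve. all: by end_near. Qed.

Lemma ae_comp (Q : comp -> R -> Prop) : (forall i, \forall r \ae mu, Q i r) ->
  \forall r \ae mu, forall i, Q i r.
Proof.
move=> H; have := ae_and (ae_and (H (false, false)) (H (false, true)))
  (ae_and (H (true, false)) (H (true, true))).
by apply: ae_imply => r [[? ?] [? ?]] [[] []].
Qed.

End TimeDerivative.

(** With k = z + 1/2 one has k^2 - k = z^2 - 1/4 and k^2 + k = (z + 1)^2 - 1/4, and a nonzero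
    integer has square at least 1. *)
Lemma half_integer (R : realType) (z : int) : z != 0 -> z != -1 ->
  3 / 4 <= (z%:~R + 1 / 2 : R) ^+ 2 - (z%:~R + 1 / 2)
  /\ 3 / 4 <= (z%:~R + 1 / 2 : R) ^+ 2 + (z%:~R + 1 / 2).
Proof.
move=> z0 z1.
have sq (y : int) : y != 0 -> 1 <= (y%:~R : R) ^+ 2.
  move=> y0; rewrite -rmorphXn /= -[leLHS]/(1%:~R) ler_int -gtz0_ge1.
  by rewrite exprn_even_gt0.
have h1 := sq z z0.
have h2 : 1 <= ((z + 1)%:~R : R) ^+ 2 by apply: sq; rewrite addr_eq0.
by rewrite intrD in h2; split; lra.
Qed.

(** In the application s = sqrt r, A and B are the sizes of the derivative and of the value of phi,
    c = chi and w = chi'. Each singular factor B / s is compensated by c <= r or by a factor s, so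
    nothing worse than B^2 remains at the origin. *)
Lemma density_product (R : realType) (r s A B c w L : R) : 0 < r -> 0 < s -> r = s ^+ 2 ->
  0 <= A -> 0 <= B -> 0 <= c -> c <= r -> c <= L -> 0 <= w -> w <= 1 -> 0 < L ->
  (s * A + B / s + s * B) * (c * (s * A + B / s) + s * B * w)
    <= 2 * (L + 3) * (r * A ^+ 2 + r * B ^+ 2 + B ^+ 2).
Proof.
move=> r0 s0 rE A0 B0 c0 c1 c2 w0 w1 L0.
have AB : A * B <= A ^+ 2 + B ^+ 2.
  by rewrite -subr_ge0; have := sqr_ge0 (A - B / 2); have := sqr_ge0 B; lra.
have AB0 : 0 <= A * B by exact: mulr_ge0.
have t1 : c * (r * A ^+ 2) <= L * (r * A ^+ 2).
  by rewrite ler_wpM2r // mulr_ge0 ?sqr_ge0 // ltW.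
have t2 : c * (A * B) <= r * (A * B) by rewrite ler_wpM2r.
have t3 : w * (r * (A * B)) <= r * (A * B) by rewrite ler_piMl // mulr_ge0 // ltW.
have t4 : c * (B ^+ 2 / r) <= B ^+ 2.
  rewrite mulrA ler_pdivrMr // mulrC ler_wpM2l ?sqr_ge0 //.
have t5 : w * B ^+ 2 <= B ^+ 2 by rewrite ler_piMl ?sqr_ge0.
have t6 : c * (r * (A * B)) <= L * (r * (A * B)).
  by rewrite ler_wpM2r // mulr_ge0 // ltW.
have t7 : c * B ^+ 2 <= r * B ^+ 2 by rewrite ler_wpM2r ?sqr_ge0.
have t8 : w * (r * B ^+ 2) <= r * B ^+ 2 by rewrite ler_piMl // mulr_ge0 ?sqr_ge0 // ltW.
have t9 : r * (A * B) <= r * A ^+ 2 + r * B ^+ 2 by rewrite -mulrDr ler_wpM2l // ltW.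
have t10 : L * (r * (A * B)) <= L * (r * A ^+ 2) + L * (r * B ^+ 2).
  by rewrite -mulrDr ler_wpM2l // ltW.
have q1 : 0 <= r * A ^+ 2 by rewrite mulr_ge0 ?sqr_ge0 // ltW.
have q2 : 0 <= r * B ^+ 2 by rewrite mulr_ge0 ?sqr_ge0 // ltW.
have q3 : 0 <= L * (r * B ^+ 2) by rewrite mulr_ge0 // ltW.
have q4 : 0 <= L * B ^+ 2 by rewrite mulr_ge0 ?sqr_ge0 // ltW.
have q6 : 0 <= L * (r * A ^+ 2) by rewrite mulr_ge0 // ltW.
have q5 := sqr_ge0 B.
have -> : (s * A + B / s + s * B) * (c * (s * A + B / s) + s * B * w)
    = c * (r * A ^+ 2) + 2 * (c * (A * B)) + w * (r * (A * B)) + c * (B ^+ 2 / r)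
      + w * B ^+ 2 + c * (r * (A * B)) + c * B ^+ 2 + w * (r * B ^+ 2).
  by rewrite rE; field; rewrite gt_eqF.
have -> : 2 * (L + 3) * (r * A ^+ 2 + r * B ^+ 2 + B ^+ 2) =
   2 * (L * (r * A ^+ 2)) + 2 * (L * (r * B ^+ 2)) + 2 * (L * B ^+ 2)
   + 6 * (r * A ^+ 2) + 6 * (r * B ^+ 2) + 6 * B ^+ 2 by ring.
move: t1 t2 t3 t4 t5 t6 t7 t8 t9 t10 q1 q2 q3 q4 q5 q6; lra.
Qed.

Lemma sum_product_le (R : realType) (X Y Z a b : R) : 0 <= X -> 0 <= Y -> 0 <= Z ->
  0 <= a -> 0 <= b -> X + Y + a * Y + b * Z + Z <= (1 + a + b) * (X + Y + Z).
Proof.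
move=> X0 Y0 Z0 a0 b0.
have := mulr_ge0 a0 X0; have := mulr_ge0 a0 Z0; have := mulr_ge0 b0 X0.
by have := mulr_ge0 b0 Y0; rewrite !mulrDl !mul1r !mulrDr; lra.
Qed.

Lemma sum_comp_le (R : realType) (f : comp -> R) c : (forall j, f j <= c) -> \sum_j f j <= 4 * c.
Proof.
move=> H; apply: (le_trans (ler_sum _ (fun j _ => H j))).
by rewrite sum_comp; lra.
Qed.

Lemma sum_comp_ge (R : realType) (f : comp -> R) c : (forall j, c <= f j) -> 4 * c <= \sum_j f j.
Proof.
move=> H; apply: le_trans (ler_sum _ (fun j _ => H j)).
by rewrite sum_comp; lra.
Qed.

(** * From a small radial solution to the abstract system *)

Section Dynamics.
Context {R : realType}.
Notation mu := (@lebesgue_measure R).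
Local Notation D := (`]0, +oo[%classic : set R).
Implicit Types (r t s h : R) (i j : comp).

Variables (P : comp -> (comp -> R) -> R) (DP : comp -> (comp -> R) -> (comp -> R) -> R).
Variables (W1 W2 : nonlinearity R) (C : R) (n : nat) (S : int) (m : R).
Hypothesis C0 : 0 < C.
Hypothesis hP : forall i, rpoly (P i) (DP i).
Hypothesis PE : forall v, nl_eval W1 (mkspinor v) = (P (true, false) v +i* P (false, false) v)%C
  /\ nl_eval W2 (mkspinor v) = (- P (false, true) v +i* P (true, true) v)%C.
Hypothesis P_bound : forall i v, cabs v < 1 -> `|P i v| <= C * cabs v ^+ n.*2 * cabs v.
Hypothesis DP_bound : forall i v w, cabs v < 1 -> `|DP i v w| <= C * cabs v ^+ n.*2 * cabs w.
Hypothesis hS1 : S != -1.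
Hypothesis hS0 : S != 0.
Local Notation k := (S%:~R + 1 / 2 : R).

Variables (delta d e eta : R).
Hypothesis d0 : 0 < d.
Hypothesis d4 : d <= 1 / 4.
Hypothesis ddelta : d <= delta.
Hypothesis e0 : 0 < e.
Hypothesis e1 : 32 * e ^+ 2 < 1.
(** 32 = 4 * 8, the sum of the bounds on the four components. *)
Let N r : R := 32 * e ^+ 2 * wgt d r.
Hypothesis eta0 : 0 <= eta.
Hypothesis eta1 : eta <= 1.
Hypothesis thetaw : forall r, 0 < r -> theta C n N r <= eta * wgt d r.
Hypothesis thetam : forall r, 0 < r -> `|m| * theta C n N r <= eta * wgt d r / r.
Hypothesis eta_small : eta * Kst d k <= 3 / 128.

Variables (phi phit phit' : R -> radial R).
Hypothesis Lphi : forall t, in_L2 (phi t).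
Hypothesis Lphit : forall t, in_L2 (phit t).
Hypothesis Dphit : L2_time_derivative phi phit.
Hypothesis Lphit' : forall t, in_L2 (phit' t).
Hypothesis Dphit' : L2_time_derivative phi phit'.
Hypothesis Cphit' : forall t,
  sL2norm `]0, +oo[ (fun r => phit' s r - phit' t r) @[s --> t] --> 0%E.
Hypothesis eqphi : forall t : R, \forall r \ae mu, 0 < r ->
          'i%C * (phit t r).1
            = (dr (phi t) r).2 + (((S + 1)%:~R / r)%:C)%C * (phi t r).2
              - (m%:C)%C * (phi t r).1 + nl_eval W1 (phi t r)
          /\
          'i%C * (phit t r).2
            = - ((dr (phi t) r).1 - ((S%:~R / r)%:C)%C * (phi t r).1)
              + (m%:C)%C * (phi t r).2 + nl_eval W2 (phi t r).

(* The solution is only small for [t >= 0]; for negative times it is frozen. *)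
Let T0 t : R := Num.max t 0.
Let fx t i r : R := coord (dr (phi (T0 t)) r) i.
Variable f : R -> comp -> R -> R.
Hypothesis Hf : forall t i,
  [/\ primitive (f t i) (fun r => coord (dr (phi (T0 t)) r) i),
      \forall r \ae mu, 0 < r -> coord (phi (T0 t) r) i = f t i r,
      forall r, 0 < r -> f t i r ^+ 2 <= 8 * e ^+ 2 * wgt d r,
      itg D (fun r => r * f t i r ^+ 2) /\ \int[mu]_(r in D) (r * f t i r ^+ 2) <= e ^+ 2 &
      itg D (fun r => r * coord (dr (phi (T0 t)) r) i ^+ 2) /\
      \int[mu]_(r in D) (r * coord (dr (phi (T0 t)) r) i ^+ 2) <= e ^+ 2].

Let pf t i : primitive (f t i) (fx t i). Proof. by case: (Hf t i). Qed.

Let N0 r : 0 < r -> 0 <= N r.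
Proof. by move=> r0; rewrite /N !mulr_ge0 ?sqr_ge0 // ltW // wgt_gt0. Qed.

Let N1 r : 0 < r -> N r < 1.
Proof.
move=> r0; apply: le_lt_trans e1; rewrite /N ler_piMr ?wgt_le1 //.
by rewrite mulr_ge0 ?sqr_ge0.
Qed.

Let theta1 r : 0 < r -> theta C n N r <= 1.
Proof.
move=> r0; apply: (le_trans (thetaw r0)); rewrite -[leRHS]mulr1.
by apply: ler_pM => //; [exact/ltW/wgt_gt0|exact: wgt_le1].
Qed.

Let af t : admissible N (f t).
Proof.
move=> r r0; rewrite cabs_sqr sum_comp.
have H i : f t i r ^+ 2 <= 8 * e ^+ 2 * wgt d r by case: (Hf t i) => _ _ /(_ r r0).
have := H (false, false); have := H (false, true); have := H (true, false); have := H (true, true).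
rewrite /N; lra.
Qed.

Let u t := udir (f t).
Let ux t := uder (f t) (fx t).
Let F t := ndir P (f t).
Let Fx t := nder P DP (f t) (fx t).

Let profile_u t i : \forall r \ae mu, D r -> profile (phi (T0 t)) i r = u t i r.
Proof.
have [_ fE _ _ _] := Hf t i; apply: (ae_imply _ fE) => r H.
by rewrite /= in_itv/= andbT => r0; rewrite /profile /u /udir H.
Qed.

Let T0E t : 0 <= t -> T0 t = t. Proof. by move=> t0; rewrite /T0 max_l. Qed.

Let eqn t i : \forall r \ae mu, 0 < r ->
  profile (phit (T0 t)) i r = dirac k m (u t) (ux t) i r + F t i r.
Proof.
have fE : \forall r \ae mu, forall j, 0 < r -> coord (phi (T0 t) r) j = f t j r.
  by apply: ae_comp => j; case: (Hf t j).
apply: (ae_imply _ (ae_and fE (eqphi (T0 t)))) => r [H1 H2] r0.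
have [E1 E2] := H2 r0.
exact: (coord_equation (f := f t) (fx := fx t) r0 PE (fun j => H1 j r0) (fun j => erefl) E1 E2).
Qed.

Let If t j : itg D (fun r => r * f t j r ^+ 2). Proof. by case: (Hf t j) => _ _ _ []. Qed.
Let Ifx t j : itg D (fun r => r * fx t j r ^+ 2). Proof. by case: (Hf t j) => _ _ _ _ []. Qed.
Let Lg t i : L2 (profile (phit (T0 t)) i). Proof. exact: in_L2_profile. Qed.

Let Su t i : sob (u t i) (ux t i).
Proof. exact: (sob_udir C0 hP P_bound N0 N1 theta1 hS1 hS0 (pf t) (af t) (If t) (Ifx t) (Lg t) (eqn t)). Qed.

Let SF t i : sob (F t i) (Fx t i).
Proof. exact: (sob_ndir C0 hP P_bound DP_bound N0 N1 theta1 hS1 hS0 (pf t) (af t) (If t) (Ifx t) (Lg t) (eqn t)). Qed.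

Let FB s t i r : 0 < r ->
  `|F s i r - F t i r| <= theta C n N r * \sum_j `|u s j r - u t j r|.
Proof. by move=> r0; exact: (ndir_lipschitz C0 hP DP_bound N0 N1). Qed.

Let F0 t i r : 0 < r -> `|F t i r| <= theta C n N r * \sum_j `|u t j r|.
Proof. by move=> r0; exact: (ndir_le C0 P_bound N0 N1). Qed.

Let Fx0 t i r : 0 < r ->
  `|Fx t i r| <= theta C n N r * \sum_j (`|ux t j r| + `|u t j r / r|).
Proof. by move=> r0; exact: nder_le. Qed.

Let mtheta : measurable_fun D (theta C n N).
Proof.
apply: measurable_funM; first exact: measurable_cst.
apply: measurable_funX; apply: measurable_funM; first exact: measurable_cst.
exact: primitive_measurable (primitive_wgt d).
Qed.

Let Lut t i : L2 (ut k m u ux F t i).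
Proof. by apply: L2D; [apply: L2_dirac|case: (SF t i)]. Qed.

Let utE t i : nrm (fun r => profile (phit (T0 t)) i r - ut k m u ux F t i r) = 0.
Proof.
rewrite (nrm_ae (g := fun=> 0)).
- rewrite /nrm (@Rint_ext _ _ _ (fun=> 0)) ?Rint0 ?sqrtr0 // => r _.
  by rewrite expr0n.
- by case: (L2B (Lg t i) (Lut t i)).
- exact: measurable_cst.
- apply: (ae_imply _ (eqn t i)) => r H; rewrite /= in_itv/= andbT => r0.
  by rewrite H // /ut subrr.
Qed.

Let du t i : 0 < t ->
  nrm (fun r => h^-1 * (u (t + h) i r - u t i r) - ut k m u ux F t i r) @[h --> 0^'] --> (0 : R).
Proof.
move=> t0; have := profile_derivative i Lphi (Lphit t) Dphit.
apply: cvg_trans; apply: near_eq_cvg; near=> h.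
have th : 0 < t + h.
  have : `|h| < t.
    near: h; exists t => //= x /= xt _; by move: xt; rewrite distrC subr0.
  by rewrite ltr_norml => /andP[+ _]; rewrite -ltrBlDl sub0r.
have Lu s : L2 (u s i) by case: (Su s i).
apply: nrm_ae.
- by case: (L2B (L2Z h^-1 (L2B (in_L2_profile i (Lphi (t + h))) (in_L2_profile i (Lphi t)))) (in_L2_profile i (Lphit t))).
- by case: (L2B (L2Z h^-1 (L2B (Lu (t + h)) (Lu t))) (Lut t i)).
- have E1 := profile_u (t + h) i; have E2 := profile_u t i; have E3 := eqn t i.
  rewrite (T0E (ltW th)) in E1; rewrite (T0E (ltW t0)) in E2; rewrite (T0E (ltW t0)) in E3.
  apply: (ae_imply _ (ae_and E1 (ae_and E2 E3))) => r [H1 [H2 H3]] Dr.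
  rewrite H1 // H2 // H3 //.
  by move: Dr; rewrite /= in_itv/= andbT.
Unshelve. all: by end_near. Qed.

(** At positive times [ut] has L^2 distance 0 from the profile of [phit'], which is continuous in
    time. *)
Let cut t i : 0 < t ->
  nrm (fun r => ut k m u ux F s i r - ut k m u ux F t i r) @[s --> t] --> (0 : R).
Proof.
move=> t0.
have Lp s : L2 (profile (phit' s) i) by exact: in_L2_profile.
have zero s : 0 < s -> nrm (fun r => ut k m u ux F s i r - profile (phit' s) i r) = 0.
  move=> s0; apply/eqP; rewrite eq_le nrm_ge0 andbT.
  apply: (le_trans (nrmB_trans (Lut s i) (Lg s i) (Lp s))).
  rewrite nrmBC utE add0r T0E ?(ltW s0) //.
  by rewrite (profile_derivative_unique i Lphi (Lphit s) (Lphit' s) Dphit Dphit').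
have := @nrm_cvg0 _ _ _ _ (fun s r => phit' s r - phit' t r) i _ (Cphit' t).
have mq s : componentwise (fun f : R -> R => measurable_fun D f) (fun r => phit' s r - phit' t r).
  apply: componentwise_coord => j.
  rewrite (_ : (fun r => _) = fun r => coord (phit' s r) j - coord (phit' t r) j).
    by apply: measurable_funB; exact: in_L2_measurable.
  by apply/funext => r; rewrite coordB.
move=> /(_ (nbhs_filter t) mq) H.
apply: (@nrm_cvg_le _ _ _ _ _ _ _ H); near=> s.
have s0 : 0 < s by near: s; exact: lt_nbhsr.
rewrite (@nrm_ext _ (profile _ i) (fun r => profile (phit' s) i r - profile (phit' t) i r)); last first.
  by move=> r _; rewrite profileB.
apply: (le_trans (nrmB_trans (Lut s i) (Lp s) (Lut t i))).
rewrite zero // add0r.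
apply: (le_trans (nrmB_trans (Lp s) (Lp t) (Lut t i))).
by rewrite (nrmBC (profile (phit' t) i)) zero // addr0.
Unshelve. all: by end_near. Qed.

(** Near the origin the norms with measure r dr do not control the integral of |phi|^2 dr; there the
    pointwise bound on phi is integrated instead. *)
Let near0 r : R := if r <= 1 then 1 else 0.

Let near0_ge0 r : 0 <= near0 r. Proof. by rewrite /near0; case: ifP. Qed.

Let itg_near0 : itg D near0.
Proof.
have sub : (`]0, 1%R]%classic : set R) `<=` D.
  by move=> r /=; rewrite !in_itv/= andbT => /andP[].
have m01 : measurable (`]0, 1%R]%classic : set R) by exact: measurable_itv.
have out r : D r -> ~ (`]0, 1%R]%classic : set R) r -> near0 r = 0.
  rewrite /= !in_itv/= andbT /near0 => r0; case: ifP => // r1 [].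
  by rewrite r0.
have [+ _] := itg_vanish m01 (measurable_itv _) sub out.
apply; apply: (@itg_ext _ _ (fun=> 1)) => //.
  by move=> r /=; rewrite in_itv/= /near0 => /andP[_ ->].
by apply: (itg_sub _ _ _ (itg_cst 0 1 1)) => //; exact: subset_itv_oc_cc.
Qed.

Let Kv : R := 16 * (1 + `|k| + `|m|) * (d^-1 + 3).

Let Kv0 : 0 <= Kv.
Proof. by rewrite /Kv !mulr_ge0 ?addr_ge0 // invr_ge0 ltW. Qed.

Let dens0 t r : R := \sum_j (r * f t j r ^+ 2) + \sum_j (r * fx t j r ^+ 2) + near0 r.

(* Near the origin [chi r <= r] compensates the singular factors [1 / r]. *)
Let virial_density t i r : 0 < r ->
  `|ut k m u ux F t i r * mult d (u t i) (ux t i) r| <= Kv * dens0 t r.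
Proof.
move=> r0.
pose A := \sum_j `|fx t j r|; pose B := \sum_j `|f t j r|; pose s := Num.sqrt r.
have s0 : 0 < s by rewrite sqrtr_gt0.
have rE : r = s ^+ 2 by rewrite sqr_sqrtr // ltW.
have A0 : 0 <= A by apply: sumr_ge0.
have B0 : 0 <= B by apply: sumr_ge0.
have fA j : `|fx t j r| <= A by exact: (le_sum_comp (f := fun j => `|fx t j r|)).
have fB j : `|f t j r| <= B by exact: (le_sum_comp (f := fun j => `|f t j r|)).
have uB j : `|u t j r| <= s * B.
  by rewrite /u /udir normrM (gtr0_norm s0) ler_wpM2l // ltW.
have uxB j : `|ux t j r| <= s * A + B / s.
  rewrite /ux /uder; apply: (le_trans (ler_normD _ _)); apply: lerD.
    by rewrite normrM (gtr0_norm s0) ler_wpM2l // ltW.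
  rewrite normrM (gtr0_norm (x := (2 * r)^-1)) ?invr_gt0 ?mulr_gt0 //.
  apply: (@le_trans _ _ (s * B / (2 * r))).
    by rewrite ler_wpM2r ?uB // invr_ge0 mulr_ge0 // ltW.
  rewrite rE (_ : s * B / (2 * s ^+ 2) = B / s / 2); last by field; rewrite gt_eqF.
  by rewrite ler_pdivrMr // ler_peMr ?ler1n // divr_ge0 // ltW.
have c0 := chi_gt0 d0 r0; have c1 := chi_le d0 r0; have c2 := chi_le_cst d0 r0.
have w0 := wgt_gt0 d r0; have w1 := wgt_le1 d0 r0.
set c := chi d r in c0 c1 c2; set w := wgt d r in w0 w1.
have L0 : 0 < d^-1 by rewrite invr_gt0.
set L := d^-1 in c2 L0.
have Hmult : `|mult d (u t i) (ux t i) r| <= c * (s * A + B / s) + s * B * w.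
  rewrite /mult -/c -/w; apply: (le_trans (ler_normD _ _)); apply: lerD.
    by rewrite normrM (gtr0_norm c0) ler_wpM2l ?(ltW c0).
  rewrite (normrM _ 2^-1) (normrM w) (gtr0_norm w0) (gtr0_norm (x := 2^-1)) // mulrC mulrA.
  apply: (@le_trans _ _ (`|u t i r| * w)).
    by rewrite [leLHS]mulrC ler_wpM2l // ler_piMl ?(ltW w0) // invf_le1 // ler1n.
  by rewrite ler_wpM2r ?uB // ltW.
have Hut : `|ut k m u ux F t i r| <= (1 + `|k| + `|m|) * (s * A + B / s + s * B).
  have H1 : `|kap k i / r * u t (sg i) r| <= `|k| * (B / s).
    rewrite (normrM _ (u t _ _)) (normrM _ r^-1) (gtr0_norm (x := r^-1)) ?invr_gt0 //.
    have -> : `|kap k i| = `|k| by rewrite /kap; case: ifP => // _; rewrite normrN.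
    rewrite -mulrA ler_wpM2l //; apply: (@le_trans _ _ (r^-1 * (s * B))).
      by rewrite ler_wpM2l ?uB // invr_ge0 ltW.
    by rewrite rE le_eqVlt; apply/orP; left; apply/eqP; field; rewrite gt_eqF.
  have H2 : `|m * ep i * u t (ta i) r| <= `|m| * (s * B).
    rewrite (normrM _ (u t _ _)) (normrM m); have -> : `|ep i| = 1 :> R by rewrite /ep; case: ifP; rewrite ?normrN normr1.
    by rewrite mulr1 ler_wpM2l.
  have H3 : `|F t i r| <= s * B.
    apply: (le_trans (F0 t i r0)).
    have -> : \sum_j `|u t j r| = s * B by rewrite -sqrt_sum.
    by rewrite ler_piMl ?theta1 // mulr_ge0 // ltW.
  have := uxB (sg i).
  rewrite /ut /dirac => H0.
  apply: (le_trans (ler_normD _ _)); apply: (@le_trans _ _ (s * A + B / s + `|k| * (B / s)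
     + `|m| * (s * B) + s * B)).
    apply: lerD => //; apply: (le_trans (ler_normD _ _)); apply: lerD => //.
    by apply: (le_trans (ler_normD _ _)); apply: lerD.
  have P1 : 0 <= s * A by rewrite mulr_ge0 // ltW.
  have P2 : 0 <= B / s by rewrite divr_ge0 // ltW.
  have P3 : 0 <= s * B by rewrite mulr_ge0 // ltW.
  by apply: sum_product_le.
rewrite normrM; apply: (le_trans (ler_pM _ _ Hut Hmult)) => //.
have SB : B ^+ 2 <= 4 * \sum_j f t j r ^+ 2.
  apply: (le_trans (sum_comp_sqr _)); rewrite ler_wpM2l //; apply: ler_sum => j _.
  by rewrite real_normK ?num_real.
have SA : A ^+ 2 <= 4 * \sum_j fx t j r ^+ 2.
  apply: (le_trans (sum_comp_sqr _)); rewrite ler_wpM2l //; apply: ler_sum => j _.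
  by rewrite real_normK ?num_real.
(* For r > 1 the factor r is enough; for r <= 1 the bound 8 e^2 on each square and 32 e^2 < 1 give
   the constant 4. *)
have B2 : B ^+ 2 <= r * B ^+ 2 + 4 * near0 r.
  rewrite /near0; case: (leP r 1) => r1; last first.
    by rewrite mulr0 addr0 ler_peMl ?sqr_ge0 // ltW.
  rewrite mulr1 -[leLHS]add0r; apply: lerD; first by rewrite mulr_ge0 ?sqr_ge0 // ltW.
  have H j : f t j r ^+ 2 <= 8 * e ^+ 2.
    case: (Hf t j) => _ _ /(_ r r0) h _ _; apply: (le_trans h).
    by rewrite ler_piMr // mulr_ge0 ?sqr_ge0.
  apply: (le_trans SB); rewrite sum_comp.
  have := H (false, false); have := H (false, true); have := H (true, false); have := H (true, true).
  move: e1; lra.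
have prod : (s * A + B / s + s * B) * (c * (s * A + B / s) + s * B * w)
    <= 2 * (L + 3) * (r * A ^+ 2 + r * B ^+ 2 + B ^+ 2).
  by apply: density_product => //; [exact: ltW|exact: ltW].
have fin : r * A ^+ 2 + r * B ^+ 2 + B ^+ 2 <= 8 * dens0 t r.
  rewrite /dens0 -!mulr_sumr.
  have h1 : r * A ^+ 2 <= 4 * (r * \sum_j fx t j r ^+ 2) by rewrite [leRHS]mulrCA ler_wpM2l // ltW.
  have h2 : r * B ^+ 2 <= 4 * (r * \sum_j f t j r ^+ 2) by rewrite [leRHS]mulrCA ler_wpM2l // ltW.
  have h3 : 0 <= r * \sum_j fx t j r ^+ 2.
    by rewrite mulr_ge0 ?(ltW r0) // sumr_ge0 // => j _; exact: sqr_ge0.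
  have h4 := near0_ge0 r.
  move: h1 h2 h3 h4 B2; set X := r * \sum_j _; set Y := r * \sum_j _; lra.
rewrite -[leLHS]mulrA.
apply: (@le_trans _ _ ((1 + `|k| + `|m|) * (2 * (L + 3) * (8 * dens0 t r)))).
  rewrite ler_wpM2l ?addr_ge0 //; apply: (le_trans prod).
  by rewrite ler_wpM2l // mulr_ge0 // addr_ge0 // ltW.
by rewrite /Kv -/L le_eqVlt; apply/orP; left; apply/eqP; ring.
Qed.

Let virial_bound : exists B, forall t, 0 < t -> B <= virial d k m u ux F t.
Proof.
pose J := \int[mu]_(r in D) near0 r.
(* The outer 4 counts components. Inside, 8 e^2 is 4 e^2 from the values and 4 e^2 from the
   derivatives, and [J] comes from the region near the origin. *)
exists (- (4 * (Kv * (8 * e ^+ 2 + J)))) => t _.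
have Id : itg D (dens0 t).
  by rewrite /dens0; apply: itgD => //; apply: itgD => //; apply: itg_sum.
have Ed : \int[mu]_(r in D) dens0 t r <= 8 * e ^+ 2 + J.
  rewrite /dens0 RintD //; last by apply: itgD => //; apply: itg_sum.
  rewrite lerD2r RintD //; [|exact: itg_sum|exact: itg_sum].
  rewrite !Rint_sum // (_ : 8 * e ^+ 2 = 4 * e ^+ 2 + 4 * e ^+ 2); last by ring.
  by apply: lerD; apply: sum_comp_le => j; [case: (Hf t j) => _ _ _ []|case: (Hf t j) => _ _ _ _ []].
have Hip i : `|ip (ut k m u ux F t i) (mult d (u t i) (ux t i))| <= Kv * (8 * e ^+ 2 + J).
  have Lm : L2 (mult d (u t i) (ux t i)) by exact: L2_mult.
  have Ip := L2_itgM (Lut t i) Lm.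
  apply: (le_trans (Rint_norm _ Ip)) => //.
  apply: (@le_trans _ _ (\int[mu]_(r in D) (Kv * dens0 t r))).
    apply: Rint_le => //; [exact: itg_norm|exact: itgZ|].
    by move=> r /=; rewrite in_itv/= andbT => r0; exact: virial_density.
  by rewrite RintZ // ler_wpM2l.
rewrite /virial -mulrN; apply: sum_comp_ge => i.
by have := Hip i; rewrite ler_norml => /andP[].
Qed.

Lemma solution_decay rho : 0 < rho ->
  sL2norm `]0, rho[ (phi t) @[t --> +oo] --> 0%E.
Proof.
move=> rho0; have [B HB] := virial_bound.
have [k1 k2] := half_integer R hS0 hS1.
have lm := local_mass_decay d0 d4 k1 k2 mtheta (theta_ge0 n C0 N0) thetaw thetam eta0 eta1
  Su SF FB F0 Fx0 du cut eta_small HB.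
have w0 : 0 < wgt (3 : R) rho by exact: wgt_gt0.
have sub : (`]0, rho[%classic : set R) `<=` D.
  by move=> r /=; rewrite !in_itv/= andbT => /andP[].
(* For r < rho the weight is at least its value at [rho], which compares the norm over that region
   with the local mass. *)
pose G t := Num.sqrt ((wgt 3 rho)^-1 * local_mass u t).
have G0 : (G t)%:E @[t --> +oo] --> 0%E.
  apply: cvg_EFin; first by near=> t.
  rewrite -[X in _ --> X](_ : Num.sqrt ((wgt 3 rho)^-1 * 0) = 0); last by rewrite mulr0 sqrtr0.
  apply: continuous_cvg; first exact: sqrt_continuous.
  by apply: cvgM => //; exact: cvg_cst.
apply: (squeeze_cvge (f := fun=> 0%E) (h := fun t => (G t)%:E)); [|exact: cvg_cst|exact: G0].
near=> t.
have t0 : 0 < t by near: t; exact: nbhs_pinfty_gt.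
rewrite sL2normE // lee_fin sqrtr_ge0 /= lee_fin /G.
have wu r : 0 < r -> 0 <= wgt 3 r * u t (false, false) r ^+ 2.
  by move=> r0; rewrite mulr_ge0 ?sqr_ge0 // ltW // wgt_gt0.
have Lu i : L2 (u t i) by case: (Su t i).
have Lwu i : L2 (fun r => wgt 3 r * u t i r).
  apply: (L2_bounded_mul (K := 1)) => //.
    exact: primitive_measurable (primitive_wgt 3).
  by move=> r r0; rewrite gtr0_norm ?wgt_gt0 // wgt_le1.
rewrite ler_sqrt; last first.
  rewrite mulr_ge0 ?invr_ge0 ?(ltW w0) //; apply: sumr_ge0 => i _.
  apply: Rint_ge0 => r /=; rewrite in_itv/= andbT => r0.
  by rewrite -mulrA -expr2 mulr_ge0 ?sqr_ge0 // ltW // wgt_gt0.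
rewrite /local_mass mulr_sumr; apply: ler_sum => i _.
have Ip := L2_itgM (Lwu i) (Lu i).
have Ip2 : itg D (fun r => (wgt 3 rho)^-1 * (wgt 3 r * u t i r * u t i r)) by exact: itgZ.
rewrite /ip -RintZ //.
have -> : \int[mu]_(r in `]0, rho[) (profile (phi t) i r ^+ 2)
    = \int[mu]_(r in `]0, rho[) (u t i r ^+ 2).
  apply: Rint_ae => //.
  - by apply: measurable_funX; apply: (measurable_funS _ sub) => //; case: (in_L2_profile i (Lphi t)).
  - by apply: measurable_funX; apply: (measurable_funS _ sub) => //; case: (Lu i).
  - have := profile_u t i; rewrite T0E ?(ltW t0) //.
    by apply: ae_imply => r H /sub Dr; rewrite H.
apply: (@le_trans _ _ (\int[mu]_(r in `]0, rho[) ((wgt 3 rho)^-1 * (wgt 3 r * u t i r * u t i r)))).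
  apply: Rint_le => //.
  - by apply: (itg_sub _ _ sub) => //; case: (Lu i).
  - exact: (itg_sub _ _ sub).
  move=> r /=; rewrite in_itv/= => /andP[r0 rr].
  rewrite -[wgt 3 r * _ * _]mulrA -expr2 mulrA ler_peMl ?sqr_ge0 // mulrC ler_pdivlMr // mul1r.
  rewrite /wgt !powRN lef_pV2 ?posrE ?powR_gt0 ?addr_gt0 //.
  by apply: ge0_ler_powR; rewrite ?nnegrE ?addr_ge0 ?(ltW r0) ?(ltW rho0) // lerD2l ltW.
apply: Rint_subset => // r /=; rewrite in_itv/= andbT => r0.
by rewrite mulr_ge0 ?invr_ge0 ?(ltW w0) // -mulrA -expr2 mulr_ge0 ?sqr_ge0 // ltW // wgt_gt0.
Unshelve. all: by end_near. Qed.

End Dynamics.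

(** * Solitons and breathers *)

Section Vanishing.
Context {R : realType}.
Notation mu := (@lebesgue_measure R).
Local Notation D := (`]0, +oo[%classic : set R).
Implicit Types (r t : R) (z : spinor R).

Lemma spinor_abs_eq0 z : spinor_abs z = 0 -> z = 0.
Proof.
rewrite spinor_absE => z0.
have c0 i : coord z i = 0.
  have := cabs_sqr (coord z); rewrite z0 expr0n /= => /esym E.
  by apply/eqP; rewrite -sqrf_eq0; apply/eqP/(psumr_eq0P _ E) => // j _; exact: sqr_ge0.
by rewrite -[z]coordK /mkspinor !c0 oppr0.
Qed.

Lemma spinor_abs_cis (a : R) z : spinor_abs (cis a * z.1, cis a * z.2) = spinor_abs z.
Proof.
case: z => [[a1 b1] [a2 b2]]; rewrite /spinor_abs /cis /=; congr Num.sqrt.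
have <- : (cos a ^+ 2 + sin a ^+ 2) * (a1 ^+ 2 + b1 ^+ 2 + a2 ^+ 2 + b2 ^+ 2)
  = a1 ^+ 2 + b1 ^+ 2 + a2 ^+ 2 + b2 ^+ 2 by rewrite cos2Dsin2 mul1r.
ring.
Qed.

Variable phi : R -> radial R.
Hypothesis Lphi : forall t, in_L2 (phi t).
Hypothesis decay : forall rho, 0 < rho -> sL2norm `]0, rho[ (phi t) @[t --> +oo] --> 0%E.

(** On the bounded part of [A] the norm at [t0] equals the norm at arbitrarily late times, which is
    as small as desired. *)
Lemma recurrent_vanish (A : set R) t0 : measurable A -> A `<=` D ->
  (forall M, exists t, M < t /\
    \forall r \ae mu, A r -> spinor_abs (phi t r) = spinor_abs (phi t0 r)) ->
  \forall r \ae mu, A r -> phi t0 r = 0.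
Proof.
move=> mA AD rec.
pose dns t r := \sum_i profile (phi t) i r ^+ 2.
have dnsE t r : D r -> dns t r = spinor_abs (phi t r) ^+ 2 * r.
  by rewrite /= in_itv/= andbT => r0; rewrite profile_sqr.
have Id t : itg D (dns t) by apply: itg_sum => // i; case: (in_L2_profile i (Lphi t)).
(* [A] may be unbounded while the decay is known for bounded radii only; countably many bounded
   pieces exhaust it. *)
suff H n : \forall r \ae mu, (A `&` `]0, n.+1%:R[%classic) r -> phi t0 r = 0.
  apply: (ae_imply _ (ae_foralln H)) => r Hr Ar.
  have := AD r Ar; rewrite /= in_itv/= andbT => r0.
  apply: (Hr (Num.truncn r)); split => //=; rewrite in_itv/= r0 /=; exact: truncnS_gt.
pose B : set R := `]0, n.+1%:R[%classic.
have mB : measurable B by exact: measurable_itv.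
have BD : B `<=` D by move=> r /=; rewrite /B /= !in_itv/= andbT => /andP[].
have mAB : measurable (A `&` B) by exact: measurableI.
have ABD : A `&` B `<=` D by move=> r [/AD].
have IAB t : itg (A `&` B) (dns t) by exact: (itg_sub _ _ ABD).
have IB t : itg B (dns t) by exact: (itg_sub _ _ BD).
have Bz : Num.sqrt (\int[mu]_(r in B) dns t r) @[t --> +oo] --> (0 : R).
  have n0 : (0 : R) < n.+1%:R by [].
  have := decay n0.
  rewrite (_ : (fun t => sL2norm _ _) = (fun t => (Num.sqrt (\int[mu]_(r in B) dns t r))%:E)).
    by move=> /fine_cvgP[].
  apply/funext => t; rewrite sL2normE // -Rint_sum // => i.
  by apply: (itg_sub _ _ BD) => //; case: (in_L2_profile i (Lphi t)).
have dge0 t r : 0 <= dns t r by apply: sumr_ge0 => i _; exact: sqr_ge0.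
have E0 : \int[mu]_(r in A `&` B) dns t0 r = 0.
  have I0 : 0 <= \int[mu]_(r in A `&` B) dns t0 r by apply: Rint_ge0.
  suff : Num.sqrt (\int[mu]_(r in A `&` B) dns t0 r) <= 0.
    move=> h; apply/eqP; rewrite eq_le I0 andbT -sqrtr_eq0 eq_le h sqrtr_ge0 //.
  apply/ler_addgt0Pr => e e0; rewrite add0r.
  have /cvgrPdist_le/(_ _ e0)[M [_ HM]] := Bz.
  have [t [Mt tE]] := rec M.
  have := HM t Mt; rewrite /= sub0r normrN ger0_norm ?sqrtr_ge0 //.
  apply: le_trans; rewrite ler_sqrt; last by apply: Rint_ge0.
  rewrite (@Rint_ae _ _ (dns t0) (dns t)) //.
  - exact: (Rint_subset mAB mB (@subIsetr _ _ _)).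
  - exact: itg_meas (IAB t0).
  - exact: itg_meas (IAB t).
  - by apply: (ae_imply _ tE) => r H [Ar Br]; rewrite !dnsE ?H //; exact: AD.
have := Rint_eq0_ae mAB (IAB t0) (fun r _ => dge0 t0 r) E0.
apply: ae_imply => r H ABr; apply: spinor_abs_eq0.
have Dr := ABD r ABr; move: (H ABr); rewrite dnsE // => /eqP.
move: Dr; rewrite /= in_itv/= andbT => r0.
by rewrite mulf_eq0 (gt_eqF r0) orbF sqrf_eq0 => /eqP.
Qed.

(** The phase has modulus 1, so the modulus of the solution on [A] does not depend on time. *)
Lemma no_standing_soliton (A : set R) : measurable A -> A `<=` D ->
  ~ standing_soliton_on A phi.
Proof.
move=> mA AD [omega [Q [H nQ]]]; apply: nQ.
have abs t : \forall r \ae mu, A r -> spinor_abs (phi t r) = spinor_abs (Q r).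
  by apply: (ae_imply _ (H t)) => r Hr Ar; rewrite Hr // spinor_abs_cis.
have := @recurrent_vanish A 0 mA AD.
have rec M : exists t, M < t /\
    \forall r \ae mu, A r -> spinor_abs (phi t r) = spinor_abs (phi 0 r).
  exists (M + 1); split; first by rewrite ltrDl.
  by apply: (ae_imply _ (ae_and (abs (M + 1)) (abs 0))) => r [H1 H2] Ar; rewrite H1 // H2.
move=> /(_ rec) V; apply: (ae_imply _ (ae_and V (abs 0))) => r [H1 H2] Ar.
by apply: spinor_abs_eq0; rewrite -H2 // H1 // /spinor_abs /= expr0n /= !addr0 sqrtr0.
Qed.

Lemma no_breather (A : set R) : measurable A -> A `<=` D -> ~ breather_on A phi.
Proof.
move=> mA AD [[T T0 H] nH]; apply: nH => t; apply: recurrent_vanish => // M.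
have per n : \forall r \ae mu, A r -> phi (t + n%:R * T) r = phi t r.
  elim: n => [|n IH]; first by rewrite mul0r addr0; apply: (ae_imply _ (H t)).
  apply: (ae_imply _ (ae_and IH (H (t + n%:R * T)))) => r [H1 H2] Ar.
  by rewrite -H1 // -H2 // -natr1 mulrDl mul1r addrA.
(* Enough periods to pass beyond the time [M]. *)
pose n := (Num.truncn (`|M - t| / T)).+1.
exists (t + n%:R * T); split.
  rewrite -ltrBlDl; apply: (le_lt_trans (ler_norm _)).
  by rewrite -ltr_pdivrMr // truncnS_gt.
by apply: (ae_imply _ (per n)) => r Hr Ar; rewrite Hr.
Qed.

End Vanishing.

Theorem theorem1p1 (R : realType) (m : R) (S : int)
    (hS1 : S != -1) (hS0 : S != 0)
    (W1 W2 : nonlinearity R)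
    (hgauge : gauge_property S W1 W2)
    (C p : R) (hC : 0 < C) (hp : p_star m <= p)
    (hW : nl_bound C p W1 W2)
    (hdW : nl_derivative_bound C p W1 W2)
    (delta : R) (hdelta : 0 < delta) :
  exists2 eps : R, 0 < eps &
    forall phi : R -> radial R,
      C1_L2 phi -> C0_E delta phi ->
      radial_global_solution m S W1 W2 phi ->
      (ereal_sup [set ELinfnorm delta (phi t) | t in [set t | (0 <= t)%R]]
         < eps%:E)%E ->
      [/\ forall rho : R, 0 < rho ->
            sL2norm `]0, rho[ (phi t) @[t --> +oo] --> 0%E,
          ~ standing_soliton_on `]0, +oo[ phi /\
          ~ breather_on `]0, +oo[ phi &
          forall K : set R, compact K ->
            ~ standing_soliton_on (K `&` `]0, +oo[) phi /\
            ~ breather_on (K `&` `]0, +oo[) phi].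
Proof.
(* In both cases 2 n + 1 is [p_star m]. *)
pose n : nat := if m == 0 then 1 else 2.
have n0 : (0 < n.*2)%N by rewrite /n; case: ifP.
have np : n.*2.+1%:R <= p by move: hp; rewrite /p_star /n; case: ifP.
have [P [DP [hP PE P_bound DP_bound]]] := nonlinearity_components hC n0 np hW hdW.
pose d : R := Num.min delta (1 / 4).
have d0 : 0 < d by rewrite lt_min hdelta divr_gt0.
have d4 : d <= 1 / 4 by rewrite ge_min lexx orbT.
have ddelta : d <= delta by rewrite ge_min lexx.
pose K := `|Kst d (S%:~R + 1 / 2 : R)| + 1.
have K1 : 1 <= K by rewrite lerDr.
have K0 : 0 < K by exact: lt_le_trans K1.
pose M : R := C * (1 + `|m|).
have m1 : 0 < 1 + `|m| by rewrite (lt_le_trans ltr01) // lerDl.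
have M0 : 0 < M by rewrite mulr_gt0.
(* [x] will be 32 e^2. The second bound gives eta K <= 3/128 for eta = x M; the first gives x < 1,
   hence |phi| < 1. *)
pose x : R := Num.min (1 / 2) (3 / (128 * K * M)).
have x0 : 0 < x by rewrite lt_min !divr_gt0 ?mulr_gt0.
have x1 : x < 1 by rewrite gt_min ltr_pdivrMr // mul1r ltr1n.
pose eta := x * M.
have eta0 : 0 <= eta by rewrite mulr_ge0 // ltW.
have etaK : eta * K <= 3 / 128.
  rewrite /eta -mulrA -ler_pdivlMr ?mulr_gt0 //.
  rewrite (_ : 3 / 128 / (M * K) = 3 / (128 * K * M)); first by rewrite ge_min lexx orbT.
  by field; rewrite !gt_eqF.
have eta1 : eta <= 1.
  apply: (@le_trans _ _ (eta * K)); first by rewrite ler_peMr.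
  by apply: (le_trans etaK); rewrite ler_pdivrMr // mul1r ler_nat.
have eta_small : eta * Kst d (S%:~R + 1 / 2 : R) <= 3 / 128.
  apply: le_trans etaK; rewrite ler_wpM2l // /K.
  by apply: (le_trans (ler_norm _)); rewrite lerDl.
pose e := Num.sqrt (x / 32).
have e0 : 0 < e by rewrite sqrtr_gt0 divr_gt0.
have e2 : 32 * e ^+ 2 = x by rewrite sqr_sqrtr ?divr_ge0 ?(ltW x0) // mulrC divfK.
exists e => // phi [Lphi [phit' [Dphit' [Lphit' Cphit']]]] [EE _] [phit [Lphit Dphit eqphi]] small.
have xw r : 0 < r -> 0 <= x * wgt d r <= 1.
  move=> r0; have w0 := wgt_gt0 d r0; have w1 := wgt_le1 d0 r0.
  by rewrite mulr_ge0 ?(ltW x0) ?(ltW w0) //= -[leRHS]mulr1 ler_pM // ltW.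
have thetaE r : 0 < r -> theta C n (fun r => x * wgt d r) r <= C * (x * wgt d r).
  move=> r0; have /andP[h0 h1] := xw r r0.
  rewrite /theta ler_pM2l // /n; case: ifP => // _.
  by rewrite expr2 ler_piMl.
have thetaw r : 0 < r -> theta C n (fun r => 32 * e ^+ 2 * wgt d r) r <= eta * wgt d r.
  move=> r0; rewrite e2; apply: (le_trans (thetaE r r0)).
  rewrite /eta /M mulrA [C * x]mulrC ler_wpM2r ?(ltW (wgt_gt0 d r0)) //.
  by rewrite ler_wpM2l ?(ltW x0) // ler_peMr ?(ltW hC) // lerDl.
have thetam r : 0 < r ->
    `|m| * theta C n (fun r => 32 * e ^+ 2 * wgt d r) r <= eta * wgt d r / r.
  move=> r0; rewrite e2; have w0 := wgt_gt0 d r0; have rw := wgt_r_le1 d0 r0.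
  have rhs0 : 0 <= eta * wgt d r / r by rewrite divr_ge0 ?(ltW r0) // mulr_ge0 // ltW.
  rewrite /theta /n; case: eqP => [->|_]; first by rewrite normr0 mul0r.
  (* For m != 0 the exponent is n = 2, and one of the two factors [wgt] is spent on r wgt <= 1. *)
  rewrite ler_pdivlMr // /eta /M.
  have -> : `|m| * (C * (x * wgt d r) ^+ 2) * r
    = (x * (C * `|m|) * wgt d r) * (x * (r * wgt d r)) by ring.
  rewrite -[leRHS]mulr1; apply: ler_pM.
  - by rewrite !mulr_ge0 ?(ltW x0) ?(ltW hC) ?(ltW w0).
  - by rewrite !mulr_ge0 ?(ltW x0) ?(ltW r0) ?(ltW w0).
  - by rewrite ler_wpM2r ?(ltW w0) // ler_wpM2l ?(ltW x0) // ler_wpM2l ?(ltW hC) // lerDr.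
  - by rewrite -[leRHS]mulr1; apply: ler_pM => //; rewrite ?mulr_ge0 ?(ltW x0) ?(ltW r0) ?(ltW w0) ?(ltW x1).
have smallt t : 0 <= t -> (ELinfnorm delta (phi t) < e%:E)%E.
  by move=> t0; apply: le_lt_trans small; apply: ereal_sup_ubound; exists t.
have max0 (t : R) : 0 <= Num.max t 0 by rewrite le_max lexx orbT.
have rep t := @regular_representative R delta d d0 d4 ddelta (phi (Num.max t 0)) e
  (EE _) e0 (smallt _ (max0 t)).
have [f Hf] := choice rep.
have e1 : 32 * e ^+ 2 < 1 by rewrite e2.
have decay rho : 0 < rho -> sL2norm `]0, rho[ (phi t) @[t --> +oo] --> 0%E.
  exact: (solution_decay hC hP PE P_bound DP_bound hS1 hS0 d0 d4 e0 e1 eta0 eta1 thetaw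
    thetam eta_small Lphi Lphit Dphit Lphit' Dphit' Cphit' eqphi Hf).
split => //.
  by split; [apply: no_standing_soliton|apply: no_breather].
move=> K' cK.
have mK : measurable (K' `&` `]0, +oo[%classic).
  by apply: measurableI; [exact: compact_measurable|exact: measurable_itv].
by split; [apply: no_standing_soliton|apply: no_breather] => //; exact: subIsetr.
Qed.
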